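(* The polynomials $\hat R_p(n;x;\beta;N)$ diagonalize the algebras $\mathcal{A}_x=\mathbb{R}[\mathfrak{L}^x_1,\dots,\mathfrak{L}^x_p]$ and $\mathcal{A}_n=\mathbb{R}[\mathfrak{L}^n_1,\dots,\mathfrak{L}^n_p]$. More precisely, for $j=1,2,\dots,p$ the following spectral equations hold: $$\mathfrak{L}^x_j\,\hat R_p(n;x;\beta;N)=\mu_j(n)\,\hat R_p(n;x;\beta;N),$$ $$\mathfrak{L}^n_j\,\hat R_p(n;x;\beta;N)=\kappa_j(x)\,\hat R_p(n;x;\beta;N),$$ where $$\mu_j(n)=-(n_1+\cdots+n_j)(n_1+\cdots+n_j-1+\beta_{j+1}-\beta_0),\qquad \kappa_j(x)=-(x_{p+1-j}-N)(x_{p+1-j}+\beta_{p+1-j}+N).$$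
   Context: Notation: $p\ge1$, $x=(x_1,\dots,x_p)$, $x_{p+1}=N$, $\beta=(\beta_0,\dots,\beta_{p+1})\in\mathbb{R}^{p+2}$, $N\in\mathbb{R}$, $|n|=n_1+\cdots+n_p$, $N_1^j=n_1+\cdots+n_j$, $N_1^0=0$, $(a)_k=a(a+1)\cdots(a+k-1)$; $E_{x_i}f(x)=f(x+e_i)$, $E_{n_i}$ is the analogous shift in $n_i$. The operator $\mathcal{L}_q(x_1,\dots,x_q;\beta_0,\dots,\beta_{q+1};M)$ (for $q\ge1$): Let $\triangle_{x_i}=E_{x_i}-1$, $\nabla_{x_i}=1-E_{x_i}^{-1}$ (with multi-index powers), and for $1\le i\le q$ let $I_i$ be the substitution $x_i\mapsto -x_i-\beta_i$ (everything else fixed) on rational functions. For $\nu\in\{0,1\}^q\setminus\{0\}$ with nonzero components at positions $i_1<\cdots<i_s$ put $$A_\nu=(x_{i_1}+\beta_{i_1}-\beta_0)(x_{i_1}+\beta_{i_1})\,\frac{\prod_{k=2}^s(x_{i_k}+x_{i_{k-1}}+\beta_{i_k})(x_{i_k}+x_{i_{k-1}}+\beta_{i_k}+1)}{\prod_{k=1}^s(2x_{i_k}+\beta_{i_k})(2x_{i_k}+\beta_{i_k}+1)}\,(x_{i_s}+\beta_{q+1}+M)(M-x_{i_s}).$$ With $\nu_j^+=\max(\nu_j,0)$, $\nu_j^-=-\min(\nu_j,0)$, for $\nu\in\{-1,0,1\}^q\setminus\{0,1\}^q$ put $A_\nu=I^{\nu^-}(A_{\nu^++\nu^-})$, where $I^{\nu^-}$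 is the composition of the $I_i$ with $\nu_i^-=1$. Then $\mathcal{L}_q=\sum_{\nu\in\{-1,0,1\}^q\setminus\{0\}}(-1)^{|\nu^-|}A_\nu\triangle_x^{\nu^+}\nabla_x^{\nu^-}$. Put $$\mathfrak{L}^x_j=\mathcal{L}_j(x_1,\dots,x_j;\beta_0,\dots,\beta_{j+1};x_{j+1}),\quad j=1,\dots,p.$$ Dual operators: Let $\mathcal{D}_x^{\beta,N}$ (resp. $\mathcal{D}_n^{\beta,N}$) be the associative algebra of difference operators in $x_1,\dots,x_p$ (resp. $n_1,\dots,n_p$) whose coefficients are rational functions of $x$ (resp. $n$) and of $\beta,N$. Let $\mathfrak b:\mathcal{D}_x^{\beta,N}\to\mathcal{D}_n^{\beta,N}$ be the algebra isomorphism determined by $\mathfrak b(N)=N$, $\mathfrak b(\beta_0)=\beta_0$, $\mathfrak b(\beta_k)=\beta_0-\beta_{p+2-k}-2N+1$ ($1\le k\le p+1$), $\mathfrak b(x_k)=n_1+\cdots+n_{p+1-k}+\beta_{p+2-k}-\beta_0+N-1$ and $\mathfrak b(E_{x_k})=E_{n_{p+1-k}}E_{n_{p+2-k}}^{-1}$ ($1\le k\le p$), with $E_{n_{p+1}}$ the identity. Put $\mathfrak{L}^n_j=\mathfrak b(\mathfrak{L}^x_j)$. Racah polynomials: $$r_n(\alpha,\beta,\gamma,\delta;x)=(\alpha+1)_n(\beta+\delta+1)_n(\gamma+1)_n\;{}_4F_3\!\left[\begin{matrix}-n,\ n+\alpha+\beta+1,\ -x,\ x+\gamma+\delta+1\\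 \alpha+1,\ \beta+\delta+1,\ \gamma+1\end{matrix};1\right]$$ (denominators of the terminating series cancelled against the prefactor, so that $r_n$ is a polynomial in all its arguments and parameters), $$R_p(n;x;\beta;N)=\prod_{k=1}^p r_{n_k}\big(2N_1^{k-1}+\beta_k-\beta_0-1,\ \beta_{k+1}-\beta_k-1,\ N_1^{k-1}-x_{k+1}-1,\ N_1^{k-1}+\beta_k+x_{k+1};\ -N_1^{k-1}+x_k\big),$$ $$\hat R_p(n;x;\beta;N)=\frac{R_p(n;x;\beta;N)}{(-N)_{|n|}\,(-N-\beta_0)_{|n|}\,\prod_{k=1}^p(\beta_{k+1}-\beta_k)_{n_k}}.$$ Conventions: if $N\notin\mathbb{N}_0$, all $n\in\mathbb{N}_0^p$ are considered; if $N\in\mathbb{N}_0$, only $n\in\mathbb{N}_0^p$ with $|n|\le N$. The real parameters are assumed to be such that the denominators occurring (in $\hat R_p$ and, at the points $n$ considered, in the coefficients of $\mathfrak{L}^n_j$) do not vanish, apart from the factor $(-N)_{|k|}$ in the limit described next. Terms of $\mathfrak{L}^n_j\hat R_p$ involving $\hat R_p$ at an index with a negative component have vanishing coefficient and are taken to be $0$. When $N\in\mathbb{N}_0$ and $|n|=N$, the second equation contains terms $\hat R_p(k;x;\beta;N)$ with $|k|=N+1$ whose coefficient contains the factor $|n|-N$; each such term is interpreted as the limit $N'\to N$ of the corresponding term with $N$ replaced by $N'\notin\mathbb{N}_0$. *)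

(* Defs.v *)
From HB Require Import structures.
From mathcomp Require Import all_boot all_order all_algebra finmap.
From mathcomp Require Import all_classical all_reals all_analysis.
(* The notations of monalg clash with those of MathComp-Analysis. *)
From mathcomp Require Import -(notations) monalg.

Set Implicit Arguments.
Unset Strict Implicit.
Unset Printing Implicit Defensive.

Import Order.TTheory GRing.Theory Num.Theory.
Import numFieldNormedType.Exports.

Local Open Scope classical_set_scope.
Local Open Scope ring_scope.

Section Coordinates.

(* k-th coordinate counted from 0, with value d out of range. *)
Definition crd (T : Type) (m : nat) (v : 'rV[T]_m) (d : T) (k : nat) : T :=
  oapp (v ord0) d (insub k).

Variables (R : realType) (p : nat).

(* Indexing from 1 as in x_1, ..., x_p; the default value gives x_{p+1} = N. *)
Definition xc (x : 'rV[R]_p) (N : R) (k : nat) : R := crd x N k.-1.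

(* Indexing from 0 as in beta_0, ..., beta_{p+1}. *)
Definition bc (b : 'rV[R]_p.+2) (k : nat) : R := crd b 0 k.

(* Indexing from 1 as in n_1, ..., n_p. *)
Definition nc (n : 'rV[nat]_p) (k : nat) : nat := crd n 0%N k.-1.

(* N_1^j = n_1 + ... + n_j *)
Definition psum (n : 'rV[nat]_p) (j : nat) : nat := \sum_(1 <= k < j.+1) nc n k.

Definition nsum (n : 'rV[nat]_p) : nat := psum n p.

End Coordinates.

Section DifferenceOperators.
Variables (R : realType) (p : nat).

(* The point at which a coefficient is evaluated: the variables (x_1, ..., x_p,
   or n_1, ..., n_p on the dual side) and the parameters beta and N. *)
Record pt := Pt { ptx : 'rV[R]_p; ptb : 'rV[R]_p.+2; ptN : R }.

(* A rational function of the variables and of beta, N is represented by the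
   function of its values; the values at the poles are irrelevant. *)
Definition dop := malg 'rV[int]_p (pt -> R).

Definition shift_pt (m : 'rV[int]_p) (v : pt) : pt :=
  Pt (ptx v + map_mx intr m) (ptb v) (ptN v).

(* c E^m *)
Definition dmon (c : pt -> R) (m : 'rV[int]_p) : dop := mkmalgU m c.

(* (c E^m) (c' E^l) = c (E^m c') E^(m + l) *)
Definition dmul (F G : dop) : dop :=
  \sum_(m <- msupp F) \sum_(l <- msupp G)
    dmon (fun v => mcoeff m F v * mcoeff l G (shift_pt m v)) (m + l).

Definition dop1 : dop := dmon (fun=> 1) 0.

(* k is counted from 1, and ek k = 0 if k is not in 1, ..., p. *)
Definition ek (k : nat) : 'rV[int]_p := \row_i (i.+1 == k)%:R.

Definition Delta (k : nat) : dop := dmon (fun=> 1) (ek k) - dop1.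
Definition Nabla (k : nat) : dop := dop1 - dmon (fun=> 1) (- ek k).

(* The value at x of F f, where beta and N are fixed. *)
Definition dact (F : dop) (f : 'rV[R]_p -> R) (b : 'rV[R]_p.+2) (N : R)
    (x : 'rV[R]_p) : R :=
  \sum_(m <- msupp F) mcoeff m F (Pt x b N) * f (x + map_mx intr m).

(* The substitution x_k := - x_k - beta_k. *)
Definition refl_pt (k : nat) (v : pt) : pt :=
  Pt (\row_i if i.+1 == k then - ptx v 0 i - bc (ptb v) k else ptx v 0 i)
    (ptb v) (ptN v).

Definition Isub (k : nat) (c : pt -> R) : pt -> R :=
  fun v => c (refl_pt k v).

(* A_nu for nu in {0,1}^q with nonzero components exactly at the increasing
   positions s = [:: i_1; ...; i_s]. *)
Definition Acoef (q : nat) (M : pt -> R) (s : seq nat) (v : pt) : R :=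
  let x := xc (ptx v) (ptN v) in
  let b := bc (ptb v) in
  let i k := nth 0%N s k.-1 in
  (x (i 1%N) + b (i 1%N) - b 0%N) * (x (i 1%N) + b (i 1%N)) *
  ((\prod_(2 <= k < (size s).+1)
      ((x (i k) + x (i k.-1) + b (i k)) * (x (i k) + x (i k.-1) + b (i k) + 1))) /
   (\prod_(1 <= k < (size s).+1)
      ((2 * x (i k) + b (i k)) * (2 * x (i k) + b (i k) + 1)))) *
  (x (i (size s)) + b q.+1 + M v) * (M v - x (i (size s))).

(* nu in {-1,0,1}^q is encoded by values in 'I_3, shifted by 1. *)
Definition nu_neg (q : nat) (nu : {ffun 'I_q -> 'I_3}) : seq nat :=
  map (fun k : 'I_q => k.+1) [seq k <- enum 'I_q | nu k == 0%N :> nat].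
Definition nu_pos (q : nat) (nu : {ffun 'I_q -> 'I_3}) : seq nat :=
  map (fun k : 'I_q => k.+1) [seq k <- enum 'I_q | nu k == 2%N :> nat].
Definition nu_supp (q : nat) (nu : {ffun 'I_q -> 'I_3}) : seq nat :=
  map (fun k : 'I_q => k.+1) [seq k <- enum 'I_q | nu k != 1%N :> nat].

Definition Anu (q : nat) (M : pt -> R) (nu : {ffun 'I_q -> 'I_3}) : pt -> R :=
  foldr Isub (Acoef q M (nu_supp nu)) (nu_neg nu).

(* L_q(x_1, ..., x_q; beta_0, ..., beta_{q+1}; M), for q <= p and M not
   depending on x_1, ..., x_q. *)
Definition Lop (q : nat) (M : pt -> R) : dop :=
  \sum_(nu : {ffun 'I_q -> 'I_3} | nu_supp nu != [::])
    dmul (dmon (fun v => (-1) ^+ size (nu_neg nu) * Anu M nu v) 0)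
      (dmul (\big[dmul/dop1]_(k <- nu_pos nu) Delta k)
            (\big[dmul/dop1]_(k <- nu_neg nu) Nabla k)).

Definition Lx (j : nat) : dop := Lop j (fun v => xc (ptx v) (ptN v) j.+1).

(* The images under the isomorphism b of x_1, ..., x_p, beta_0, ..., beta_{p+1}
   and N, evaluated at a point (n, beta, N); here k = i + 1 for x_k. *)
Definition bpoint (v : pt) : pt :=
  let b := bc (ptb v) in
  let N := ptN v in
  Pt
    (\row_(i < p) (\sum_(1 <= l < (p.+1 - i.+1).+1) xc (ptx v) 0 l
                   + b (p.+2 - i.+1)%N - b 0%N + N - 1))
    (\row_(k < p.+2) if k == 0%N :> nat then b 0%N
                     else b 0%N - b (p.+2 - k)%N - 2 * N + 1)
    N.

(* E_{x_k} is sent to E_{n_{p+1-k}} E_{n_{p+2-k}}^{-1}; ek p.+1 = 0. *)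
Definition bshift (m : 'rV[int]_p) : 'rV[int]_p :=
  \sum_(i < p) (ek (p.+1 - i.+1) - ek (p.+2 - i.+1)) *~ m 0 i.

(* The isomorphism b from operators in x to operators in n. *)
Definition bdual (F : dop) : dop :=
  \sum_(m <- msupp F) dmon (fun v => mcoeff m F (bpoint v)) (bshift m).

Definition Ln (j : nat) : dop := bdual (Lx j).

(* The denominators of the coefficients of Lx j do not vanish at v; the factors
   2 x_k + beta_k - 1 come from the substitutions x_k := - x_k - beta_k. By
   construction those of Ln j do not vanish at v iff Lx_regular j (bpoint v). *)
Definition Lx_regular (j : nat) (v : pt) : Prop :=
  forall k, (1 <= k <= j)%N ->
    let d := 2 * xc (ptx v) (ptN v) k + bc (ptb v) k in
    [/\ d - 1 != 0, d != 0 & d + 1 != 0].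

End DifferenceOperators.

Section RacahPolynomials.
Variable R : realType.

(* (a)_k *)
Definition poch (a : R) (k : nat) : R := \prod_(i < k) (a + i%:R).

(* The prefactor (a+1)_n (b+d+1)_n (g+1)_n is divided by the denominators
   (a+1)_k (b+d+1)_k (g+1)_k of the k-th term by (u)_n = (u)_k (u+k)_{n-k}. *)
Definition racah (n : nat) (a b g d x : R) : R :=
  \sum_(k < n.+1)
    poch (- n%:R) k * poch (n%:R + a + b + 1) k * poch (- x) k *
    poch (x + g + d + 1) k / (k`!)%:R *
    (poch (a + 1 + k%:R) (n - k) * poch (b + d + 1 + k%:R) (n - k) *
     poch (g + 1 + k%:R) (n - k)).

Variable p : nat.
Implicit Types (n : 'rV[nat]_p) (x : 'rV[R]_p) (b : 'rV[R]_p.+2) (N : R).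

Definition Rpol n x b N : R :=
  \prod_(1 <= k < p.+1)
    let S := (psum n k.-1)%:R in
    racah (nc n k)
      (2 * S + bc b k - bc b 0 - 1)
      (bc b k.+1 - bc b k - 1)
      (S - xc x N k.+1 - 1)
      (S + bc b k + xc x N k.+1)
      (- S + xc x N k).

(* The denominator of Rhat without its factor (-N)_{|n|}. *)
Definition Rden n b N : R :=
  poch (- N - bc b 0) (nsum n) *
  \prod_(1 <= k < p.+1) poch (bc b k.+1 - bc b k) (nc n k).

Definition Rhat n x b N : R := Rpol n x b N / (poch (- N) (nsum n) * Rden n b N).

Definition mu (j : nat) n b : R :=
  - (psum n j)%:R * ((psum n j)%:R - 1 + bc b j.+1 - bc b 0).

Definition kappa (j : nat) x b N : R :=
  - (xc x N (p.+1 - j) - N) * (xc x N (p.+1 - j) + bc b (p.+1 - j) + N).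

(* The indices n considered: all of them if N is not a natural number, those
   with |n| <= N otherwise. *)
Definition admissible n N : Prop :=
  forall M : nat, N = M%:R -> (nsum n <= M)%N.

Definition nreal n : 'rV[R]_p := map_mx (fun k : nat => k%:R) n.

(* n + m, for the index reached from n by the shift m *)
Definition nshift n (m : 'rV[int]_p) : 'rV[int]_p := map_mx Posz n + m.

Definition has_neg (k : 'rV[int]_p) : bool := [exists i, k 0 i < 0].

(* The index n + m, when it has no negative component *)
Definition nadd n (m : 'rV[int]_p) : 'rV[nat]_p := map_mx absz (nshift n m).

(* The term of (Ln j Rhat)(n) attached to the shift m *)
Definition raw_term (j : nat) n x b (m : 'rV[int]_p) (N : R) : R :=
  mcoeff m (Ln R p j) (Pt (nreal n) b N) * Rhat (nadd n m) x b N.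

(* N is a natural number, |n| = N and |n + m| = N + 1 *)
Definition boundary n (m : 'rV[int]_p) N : bool :=
  (N == (nsum n)%:R) && (nsum (nadd n m) == (nsum n).+1).

(* The deleted neighbourhood filter N^' is the filter of N' -> N with N' not a
   natural number, since the natural numbers are discrete. *)
Definition dual_term (j : nat) n x b N (m : 'rV[int]_p) : R :=
  if has_neg (nshift n m) then 0
  else if boundary n m N then lim (raw_term j n x b m @ N^')
  else raw_term j n x b m N.

(* (Ln j Rhat)(n) *)
Definition dact_n (j : nat) n x b N : R :=
  \sum_(m <- msupp (Ln R p j)) dual_term j n x b N m.

(* The denominators of the terms of Ln j Rhat do not vanish at n, apart from
   the factors (-N)_{|k|}, which vanish only in the terms defined by a limit. *)
Definition dual_regular (j : nat) n b N : Prop :=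
  Lx_regular j (bpoint (Pt (nreal n) b N)) /\
  forall m, m \in msupp (Ln R p j) -> ~~ has_neg (nshift n m) ->
    Rden (nadd n m) b N != 0.

End RacahPolynomials.

(* Main.v *)
Require Import Defs.
From HB Require Import structures.
From mathcomp Require Import all_boot all_order all_algebra finmap.
From mathcomp Require Import all_classical all_reals all_analysis.
From mathcomp Require Import -(notations) monalg.
From mathcomp Require Import ring lra zify.

Set Implicit Arguments.
Unset Strict Implicit.
Unset Printing Implicit Defensive.

Import Order.TTheory GRing.Theory Num.Theory.
Import numFieldNormedType.Exports.

Local Open Scope classical_set_scope.
Local Open Scope ring_scope.

(** Both spectral equations are instances of one mechanism.

    The coefficient A_nu of L_q is a product of factors linking consecutive
    nonzero positions of nu.  Hence the action of L_q on a function is a sum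
    over chains of positions, which can be built one position at a time
    ([chain_sum], [pairing_Lx]).  The factor of a link is a quadratic in the
    coordinate y of the earlier position, and the empty chain acts as the
    linear functional on quadratics with y |-> - (beta_0 + 1) / 2 and
    y^2 |-> (beta_0 + 1) / 2, so that nu = 0 can be included at the price of a
    scalar.  Reducing a quadratic modulo the two links available at a position
    leaves a multiple of one fixed quadratic ([ending_split]); expanding the
    differences then turns the chain into a product of 3 x 3 matrices indexed
    by the shifts, in {-1, 0, 1}, of two neighbouring coordinates
    ([chain_sum_step]).

    The function acted upon is a product whose k-th factor depends only on the
    k-th and (k+1)-st coordinates.  The chain therefore contracts position by
    position as soon as every factor satisfies three identities, one for each
    shift of the later coordinate ([chain_contraction]).

    In the variables x the factors are the one-variable Racah polynomials, and
    the three identities are their difference equation and two contiguous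
    relations ([racah_factor_step]); the accumulated scalar is governed by the
    partial sum n_1 + ... + n_k.  On the dual side the variables x_k become
    the partial sums n_1 + ... + n_{p+1-k} up to a translation, and the factor
    r_{n_k} depends on two neighbouring ones: the chain runs through the same
    factors in the opposite order, and the three identities are the three-term
    recurrence in the degree and two mixed contiguous relations ([dual_step]).
    All six identities concern one terminating balanced 4F3 series ([F4]); they
    follow by comparing coefficients in a basis (a)_i (b)_i and telescoping.

    The dual identities are obtained for parameters at which no Pochhammer
    symbol vanishes ([second_equation_generic]).  Every term of the dual
    equation is continuous along a line of such parameters through the given
    ones.  This includes the terms with |n| = N and index of weight N + 1: all
    chains contributing to their coefficient begin with a factor |n| - N, which
    cancels the zero of (-N)_{|n|+1}, and the limit N' -> N yields the same
    quotient ([tends_raw]). *)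

(** * The balanced 4F3 polynomial and its relations in x *)

Section Hypergeometric.
Variable R : realType.
Implicit Types (a b c u v w z : R) (n i : nat).

Lemma poch0 a : poch a 0 = 1.
Proof. by rewrite /poch big_ord0. Qed.

Lemma pochS a i : poch a i.+1 = poch a i * (a + i%:R).
Proof. by rewrite /poch big_ord_recr. Qed.

Lemma pochSl a i : poch a i.+1 = a * poch (a + 1) i.
Proof.
rewrite /poch big_ord_recl /= addr0; congr (_ * _).
by apply: eq_bigr => k _; rewrite -addrA -[1 + _](natrD _ 1).
Qed.

Lemma poch_tail a n i : (i < n)%N ->
  poch (a + i%:R) (n - i) = (a + i%:R) * poch (a + i.+1%:R) (n - i.+1).
Proof.
by move=> lt_in; rewrite -(subnSK lt_in) pochSl -addrA natr1.
Qed.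

Lemma poch_natN_eq0 n i : (n < i)%N -> poch (- n%:R : R) i = 0.
Proof.
move=> lt_ni; rewrite /poch (bigD1 (Ordinal lt_ni)) //=.
by rewrite addNr mul0r.
Qed.

Lemma sum_telescope n (F T : nat -> R) : T 0%N = 0 -> T n = 0 ->
  (forall i, (i < n)%N -> F i = T i - T i.+1) -> \sum_(i < n) F i = 0.
Proof.
move=> T0 Tn FT; rewrite (eq_bigr (fun i : 'I_n => T i - T i.+1)); last first.
  by move=> i _; apply: FT.
rewrite -(big_mkord xpredT (fun i => T i - T i.+1)) /=.
rewrite (eq_bigr (fun i => - (T i.+1 - T i))); last by move=> i _; rewrite opprB.
by rewrite sumrN telescope_sumr // T0 Tn subr0 oppr0.
Qed.

(** [F4] is the terminating 4F3 series at 1 with upper parameters -n, e, a, b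
    and lower parameters u, v, w, multiplied by (u)_n (v)_n (w)_n; the series
    is balanced, which determines e.  The dependence on v and w is kept apart
    in [F4tail], because shifts of x_{k+1} act on it alone. *)
Definition F4head n u e i : R :=
  poch (- n%:R) i * poch e i / (i`!)%:R * poch (u + i%:R) (n - i).

Definition F4tail n v w i : R := poch (v + i%:R) (n - i) * poch (w + i%:R) (n - i).

Definition F4 n u v w a b : R :=
  \sum_(i < n.+1) F4head n u (n%:R + u + v + w - a - b - 1) i
     * F4tail n v w i * (poch a i * poch b i).

Lemma F4headS n u e i : (i <= n)%N ->
  F4head n u e i.+1 * (i.+1%:R * (u + i%:R)) =
  F4head n u e i * ((i%:R - n%:R) * (e + i%:R)).
Proof.
rewrite leq_eqVlt => /orP[/eqP->|lt_in].
  by rewrite /F4head poch_natN_eq0 // !mul0r subrr mul0r mulr0.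
rewrite /F4head (poch_tail _ lt_in) !pochS factS natrM.
have i0 : (i`!)%:R != 0 :> R by rewrite pnatr_eq0 -lt0n fact_gt0.
have iS : i%:R + 1 != 0 :> R by rewrite natr1 pnatr_eq0.
rewrite -natr1; field; by rewrite i0 iS.
Qed.

Definition quad q0 q1 q2 a : R := q0 + q1 * a + q2 * a ^+ 2.
(** The diagonal coefficient, at index i, of the triangular operator of
    [xdiff_basis]: a linear functional of the quadratic. *)
Definition quad_mean q0 q1 q2 z i : R :=
  q0 + q1 * ((z + 1) / 2 - i%:R) + q2 * (i%:R ^+ 2 - i%:R * (1 + z) + (z + 1) / 2).

(** The second-order difference operator attached to a quadratic q is
    triangular in the basis (a)_i (b)_i: the two shifts multiply a basis
    function by rational factors whose poles at a = b and a = b +- 1 cancel in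
    the sum.  The value of q at 1 - i in the off-diagonal coefficient is what
    reduces the relations below to two-term recurrences. *)
Lemma xdiff_basis (q0 q1 q2 u a b : R) i (q := quad q0 q1 q2) (z := a + b - u) :
  b - a != 0 -> b - a + 1 != 0 -> b - a - 1 != 0 ->
  (- q2 + q a / ((b - a) * (b - a + 1)) + q b / ((a - b) * (a - b + 1)))
    * (- a * b + (z + 1) * (a + b - 1) / 2) * (poch a i * poch b i)
  + q a / ((b - a) * (b - a + 1)) * (b * (u - a)) * (poch (a - 1) i * poch (b + 1) i)
  + q b / ((a - b) * (a - b + 1)) * (a * (u - b)) * (poch (a + 1) i * poch (b - 1) i)
  = quad_mean q0 q1 q2 z i * (poch a i * poch b i)
    - i%:R * (u + i%:R - 1) * q (1 - i%:R) * (poch a i.-1 * poch b i.-1).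
Proof.
move=> d0 d1 d2.
have e0 : a - b != 0 by rewrite -opprB oppr_eq0.
have e1 : a - b + 1 != 0 by rewrite -oppr_eq0 opprD opprB.
case: i => [|i] /=; rewrite /q /z /quad /quad_mean.
  by rewrite !poch0; field; rewrite d0 d1 e1 e0.
have ba : b * poch (b + 1) i.+1 = poch b i * (b + i%:R) * (b + i.+1%:R).
  by rewrite -pochSl !pochS.
have ab : a * poch (a + 1) i.+1 = poch a i * (a + i%:R) * (a + i.+1%:R).
  by rewrite -pochSl !pochS.
have aS : poch (a - 1) i.+1 = (a - 1) * poch a i by rewrite pochSl subrK.
have bS : poch (b - 1) i.+1 = (b - 1) * poch b i by rewrite pochSl subrK.
rewrite aS bS.
rewrite (_ : _ * (b * (u - a)) * _ = quad q0 q1 q2 a / ((b - a) * (b - a + 1))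
   * (u - a) * (a - 1) * poch a i * (b * poch (b + 1) i.+1)); last first.
  by rewrite /quad; field; rewrite d0 d1.
rewrite (_ : _ * (a * (u - b)) * _ = quad q0 q1 q2 b / ((a - b) * (a - b + 1))
   * (u - b) * (b - 1) * poch b i * (a * poch (a + 1) i.+1)); last first.
  by rewrite /quad; field; rewrite e0 e1.
rewrite ba ab /quad !pochS -natr1.
by field; rewrite d0 d1 e1 e0.
Qed.


(** The off-diagonal contributions of [xdiff_basis] telescope.  The functions f
    and g stand for the part of the coefficients that depends on x_{k+1}, which
    may be shifted between the two sides. *)
Lemma xdiff_sum (q0 q1 q2 u a b e L : R) n (f g : nat -> R)
    (q := quad q0 q1 q2) (z := a + b - u) :
  b - a != 0 -> b - a + 1 != 0 -> b - a - 1 != 0 ->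
  (forall i, (i <= n)%N ->
     f i * quad_mean q0 q1 q2 z i - (i%:R - n%:R) * (e + i%:R) * f i.+1 * q (- i%:R)
     = L * g i) ->
  (- q2 + q a / ((b - a) * (b - a + 1)) + q b / ((a - b) * (a - b + 1)))
    * (- a * b + (z + 1) * (a + b - 1) / 2)
    * (\sum_(i < n.+1) F4head n u e i * f i * (poch a i * poch b i))
  + q a / ((b - a) * (b - a + 1)) * (b * (u - a))
    * (\sum_(i < n.+1) F4head n u e i * f i * (poch (a - 1) i * poch (b + 1) i))
  + q b / ((a - b) * (a - b + 1)) * (a * (u - b))
    * (\sum_(i < n.+1) F4head n u e i * f i * (poch (a + 1) i * poch (b - 1) i))
  = L * (\sum_(i < n.+1) F4head n u e i * g i * (poch a i * poch b i)).
Proof.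
move=> d0 d1 d2 fg; apply/eqP; rewrite -subr_eq0; apply/eqP.
rewrite !mulr_sumr -!big_split -sumrB /=.
pose T i := - (F4head n u e i * f i * (i%:R * (u + i%:R - 1) * q (1 - i%:R)
               * (poch a i.-1 * poch b i.-1))).
apply: (sum_telescope (T := T)
  (F := fun i => _ * (F4head n u e i * f i * (poch a i * poch b i))
   + _ * (F4head n u e i * f i * (poch (a - 1) i * poch (b + 1) i))
   + _ * (F4head n u e i * f i * (poch (a + 1) i * poch (b - 1) i))
   - L * (F4head n u e i * g i * (poch a i * poch b i)))).
- by rewrite /T !mul0r mulr0 oppr0.
- by rewrite /T /F4head poch_natN_eq0 // !mul0r oppr0.
move=> i; rewrite ltnS => le_in.
have := xdiff_basis q0 q1 q2 u i d0 d1 d2; rewrite -/q -/z => opi.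
have fgi := fg i le_in; have hS := F4headS u e le_in.
have -> : T i.+1 = - ((F4head n u e i.+1 * (i.+1%:R * (u + i%:R))) * f i.+1
     * q (- i%:R) * (poch a i * poch b i)).
  rewrite /T /= (_ : 1 - i.+1%:R = - i%:R :> R); last by rewrite -natr1; ring.
  by rewrite -natr1; ring.
rewrite hS.
have -> : L * (F4head n u e i * g i * (poch a i * poch b i)) =
  F4head n u e i * (L * g i) * (poch a i * poch b i) by ring.
rewrite -fgi.
transitivity (F4head n u e i * f i * (quad_mean q0 q1 q2 z i * (poch a i * poch b i)
    - i%:R * (u + i%:R - 1) * q (1 - i%:R) * (poch a i.-1 * poch b i.-1))
  - F4head n u e i *
  (f i * quad_mean q0 q1 q2 z i - (i%:R - n%:R) * (e + i%:R) * f i.+1 * q (- i%:R))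
  * (poch a i * poch b i)).
  by rewrite -opi; ring.
by rewrite /T; ring.
Qed.

Lemma F4tailC n v w i : F4tail n v w i = F4tail n w v i.
Proof. exact: mulrC. Qed.

Lemma F4C n u v w a b : F4 n u v w a b = F4 n u w v a b.
Proof.
rewrite /F4 (_ : n%:R + u + v + w = n%:R + u + w + v); last by ring.
by apply: eq_bigr => i _; rewrite F4tailC.
Qed.

Lemma F4tail_xdiff n v w i z e : (i <= n)%N -> e = n%:R + v + w - z - 1 ->
  F4tail n v w i * quad_mean (- (v * w)) (v + w) (- 1) z i
  - (i%:R - n%:R) * (e + i%:R) * F4tail n v w i.+1
    * quad (- (v * w)) (v + w) (- 1) (- i%:R)
  = (- (v * w) + (z + 1) * (v + w - 1) / 2 - n%:R * (n%:R - 1 + v + w - z))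
    * F4tail n v w i.
Proof.
move=> + ->; rewrite leq_eqVlt => /orP[/eqP->|lt_in].
  by rewrite /quad_mean subrr; field.
rewrite /F4tail !(poch_tail _ lt_in) /quad_mean /quad.
by field.
Qed.

(** Here the quadratic is (v - a) (v - a + 1), whereas it is (v - a) (a - w)
    in [F4tail_xdiff]. *)
Lemma F4tail_xdiff_up n v w i z e : (i <= n)%N -> e = n%:R + v + w - z - 1 ->
  F4tail n (v + 1) (w - 1) i * quad_mean (v * (v + 1)) (- (v *+ 2 + 1)) 1 z i
  - (i%:R - n%:R) * (e + i%:R) * F4tail n (v + 1) (w - 1) i.+1
    * quad (v * (v + 1)) (- (v *+ 2 + 1)) 1 (- i%:R)
  = ((v + n%:R) * (v + n%:R - z)) * F4tail n v w i.
Proof.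
move=> + ->; rewrite leq_eqVlt => /orP[/eqP->|lt_in].
  by rewrite /F4tail subnn !poch0 /quad_mean subrr; field.
have [m ->] : exists m, n = (i + m.+1)%N by exists (n - i.+1)%N; lia.
rewrite /F4tail (_ : i + m.+1 - i = m.+1)%N; last by lia.
rewrite (_ : i + m.+1 - i.+1 = m)%N; last by lia.
rewrite (pochS (v + 1 + _)) (pochSl (v + _)) (pochSl (w - 1 + _)) (pochS (w + _)).
have -> : w - 1 + i%:R + 1 = w + i%:R by ring.
have -> : w - 1 + i.+1%:R = w + i%:R by rewrite -natr1; ring.
have -> : v + 1 + i%:R = v + i%:R + 1 by ring.
have vE : (v + i%:R + 1) * poch (v + 1 + i.+1%:R) m =
    poch (v + i%:R + 1) m * (v + i%:R + 1 + m%:R).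
  by rewrite -pochS pochSl; congr (_ * poch _ _); rewrite -natr1; ring.
have -> : quad (v * (v + 1)) (- (v *+ 2 + 1)) 1 (- i%:R) =
    (v + i%:R + 1) * (v + i%:R) by rewrite /quad; ring.
rewrite [X in _ - X](_ : _ = (i%:R - (i + m.+1)%:R) *
  ((i + m.+1)%:R + v + w - z - 1 + i%:R) * poch (w + i%:R) m * (v + i%:R) *
  ((v + i%:R + 1) * poch (v + 1 + i.+1%:R) m)); last by ring.
rewrite vE natrD -natr1 /quad_mean.
by field.
Qed.

(** The case e = 0 of [chain_eig] in the parameters of [F4]; it does not depend
    on S once it is written in this way. *)
Definition chain_eig0 z v w n : R :=
  - (v * w) + (z + 1) * (v + w - 1) / 2 - n%:R * (n%:R - 1 + v + w - z).

(** The difference equation of the Racah polynomials, as a relation between a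
    factor and its shifts in x_k. *)
Lemma F4_xdiff n u v w a b (z := a + b - u)
    (A := (v - a) * (a - w) / ((b - a) * (b - a + 1)))
    (B := (v - b) * (b - w) / ((a - b) * (a - b + 1))) :
  b - a != 0 -> b - a + 1 != 0 -> b - a - 1 != 0 ->
  (1 + A + B) * chain_eig0 z a b 0 * F4 n u v w a b
  + A * (b * (u - a)) * F4 n u v w (a - 1) (b + 1)
  + B * (a * (u - b)) * F4 n u v w (a + 1) (b - 1)
  = chain_eig0 z v w n * F4 n u v w a b.
Proof.
move=> d0 d1 d2.
have := xdiff_sum (u := u) d0 d1 d2
  (fun i li => @F4tail_xdiff n v w i _ _ li (erefl _)).
rewrite -/z /F4 /chain_eig0 => H.
have eq_e (x y : R) : x + y = a + b ->
    n%:R + u + v + w - x - y - 1 = n%:R + v + w - z - 1.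
  by move=> xy; rewrite /z -xy; ring.
rewrite !eq_e; [|by ring|by ring|by []].
rewrite -H; congr (_ * _ * _ + _ * _ * _ + _ * _ * _).
- by rewrite /A /B /quad opprK; congr (_ + _ / _ + _ / _); ring.
- by ring.
- by rewrite /A /quad; congr (_ / _); ring.
- by rewrite /B /quad; congr (_ / _); ring.
Qed.

(** A contiguous relation between the values x_{k+1} + 1, on the left, and
    x_{k+1}, on the right. *)
Lemma F4_xdiff_up n u v w a b (z := a + b - u)
    (A := (v - a) * (v - a + 1) / ((b - a) * (b - a + 1)))
    (B := (v - b) * (v - b + 1) / ((a - b) * (a - b + 1))) :
  b - a != 0 -> b - a + 1 != 0 -> b - a - 1 != 0 ->
  (- 1 + A + B) * chain_eig0 z a b 0 * F4 n u (v + 1) (w - 1) a b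
  + A * (b * (u - a)) * F4 n u (v + 1) (w - 1) (a - 1) (b + 1)
  + B * (a * (u - b)) * F4 n u (v + 1) (w - 1) (a + 1) (b - 1)
  = ((v + n%:R) * (v + n%:R - z)) * F4 n u v w a b.
Proof.
move=> d0 d1 d2.
have := xdiff_sum (u := u) d0 d1 d2
  (fun i li => @F4tail_xdiff_up n v w i _ _ li (erefl _)).
rewrite -/z /F4 /chain_eig0 => H.
have eq_e (x y v' w' : R) : x + y = a + b -> v' + w' = v + w ->
    n%:R + u + v' + w' - x - y - 1 = n%:R + v + w - z - 1.
  by move=> xy /(canRL (addKr _)) ->; rewrite /z -xy; ring.
rewrite !eq_e; do ?[by ring].
rewrite -H; congr (_ * _ * _ + _ * _ * _ + _ * _ * _).
- by rewrite /A /B /quad; congr (_ + _ / _ + _ / _); ring.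
- by ring.
- by rewrite /A /quad; congr (_ / _); ring.
- by rewrite /B /quad; congr (_ / _); ring.
Qed.

(** The reflection x_{k+1} |-> - x_{k+1} - beta_{k+1} exchanges v and w. *)
Lemma F4_xdiff_down n u v w a b (z := a + b - u)
    (A := (w - a) * (w - a + 1) / ((b - a) * (b - a + 1)))
    (B := (w - b) * (w - b + 1) / ((a - b) * (a - b + 1))) :
  b - a != 0 -> b - a + 1 != 0 -> b - a - 1 != 0 ->
  (- 1 + A + B) * chain_eig0 z a b 0 * F4 n u (v - 1) (w + 1) a b
  + A * (b * (u - a)) * F4 n u (v - 1) (w + 1) (a - 1) (b + 1)
  + B * (a * (u - b)) * F4 n u (v - 1) (w + 1) (a + 1) (b - 1)
  = ((w + n%:R) * (w + n%:R - z)) * F4 n u v w a b.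
Proof.
by move=> d0 d1 d2; rewrite !(F4C _ _ (v - 1)) (F4C _ _ v); apply: F4_xdiff_up.
Qed.

(** * Relations in the degree, for generic parameters *)

(** Genericity is expressed by nonintegrality because it survives the integer
    shifts of all parameters and keeps Pochhammer symbols away from 0. *)
Definition nonint (a : R) : Prop := a \isn't a Num.int.

Lemma nonintD a c : nonint a -> c \is a Num.int -> nonint (a + c).
Proof. by move=> /negP na ci; apply/negP; rewrite rpredDr. Qed.

Lemma nonint_neq0 a : nonint a -> a != 0.
Proof. by apply: contraNneq => ->; rewrite rpred0. Qed.

Lemma nonint_nz a c x : nonint a -> c \is a Num.int -> x = a + c -> x != 0.
Proof. by move=> na ci ->; apply/nonint_neq0/nonintD. Qed.

Lemma poch_nonint a i : nonint a -> poch a i != 0.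
Proof.
move=> na; apply/prodf_neq0 => k _.
by apply: (nonint_nz na) (erefl _); rewrite natr_int.
Qed.

Lemma poch_split a i n : (i <= n)%N ->
  poch a n = poch a i * poch (a + i%:R) (n - i).
Proof.
elim: i => [|i IH] le_in; first by rewrite poch0 mul1r addr0 subn0.
by rewrite (IH (ltnW le_in)) (poch_tail _ le_in) pochS mulrA.
Qed.

(** For generic u, v, w the coefficients are hypergeometric terms in i up to a
    factor independent of i, and vanish by themselves beyond the degree. *)
Definition hterm n e u v w i : R :=
  poch (- n%:R) i * poch e i / (i`!)%:R / (poch u i * poch v i * poch w i).

Lemma hterm_eq0 n e u v w i : (n < i)%N -> hterm n e u v w i = 0.
Proof. by move=> lt_ni; rewrite /hterm poch_natN_eq0 // !mul0r. Qed.

Lemma F4_hterm n m u v w a b : (n < m)%N -> nonint u -> nonint v -> nonint w ->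
  F4 n u v w a b = poch u n * poch v n * poch w n *
    \sum_(i < m) hterm n (n%:R + u + v + w - a - b - 1) u v w i
      * (poch a i * poch b i).
Proof.
move=> lt_nm hu hv hw; rewrite /F4 mulr_sumr.
rewrite (big_ord_widen m (fun i => F4head n u _ i * F4tail n v w i *
  (poch a i * poch b i)) lt_nm) big_mkcond /=; apply: eq_bigr => i _.
case: ifP => [|/negbT]; rewrite ltnS; last first.
  by rewrite -ltnNge => lt_ni; rewrite hterm_eq0 // mul0r mulr0.
move=> le_in; rewrite /F4head /F4tail /hterm.
rewrite (poch_split u le_in) (poch_split v le_in) (poch_split w le_in).
have u0 := poch_nonint i hu; have v0 := poch_nonint i hv.
have w0 := poch_nonint i hw.
by field; rewrite u0 v0 w0 pnatr_eq0 -lt0n fact_gt0.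
Qed.
Lemma poch_up a i : a != 0 -> poch (a + 1) i = poch a i * (a + i%:R) / a.
Proof. by move=> a0; rewrite -pochS pochSl mulrC mulKf. Qed.

Lemma poch_predS a i : poch (a - 1) i.+1 = (a - 1) * poch a i.
Proof. by rewrite pochSl subrK. Qed.

(** The cases e = 0 and e = -1 of [dual_eig] in the parameters of [F4]. *)
Definition dual_eig0 (z v w n : R) : R :=
  v * w + n * (n + v + w - z - 1) + (z + 1) * (z - v - w) / 2.
Definition dual_eigN1 (z v w n : R) : R :=
  (w + n - 1) * (w + n - 1 - z) * (v + n - 1 - z) * (v + n - 1).

(** The coefficient of (a + 1)_i (b + 1)_i in [F4_ndiff_up].  The right-hand
    side re-expands (a)_i (b)_i, through a b = (a + i) (b + i) - i (a + b + i)
    with a + b = u + z. *)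
Lemma hterm_ndiff_up m i u v w z (n := m.+2%:R : R) (e := n + v + w - z - 1)
    (d := e + n) (k := v + w - u - z)
    (A := e * (e + 1) / (d * (d + 1))) (B := n * (n - 1) / (d * (d - 1))) :
  nonint u -> nonint v -> nonint w -> nonint (v + w - z) ->
  (- 1 + A + B) * dual_eig0 z v w n * (k + n - 1)
    * (poch (u + 2) m.+1 * poch (v + 1) m.+1 * poch (w + 1) m.+1
       * hterm m.+1 (e + 1) (u + 2) (v + 1) (w + 1) i)
  + A * (poch (u + 2) m.+2 * poch (v + 1) m.+2 * poch (w + 1) m.+2
       * hterm m.+2 (e + 2) (u + 2) (v + 1) (w + 1) i)
  + B * dual_eigN1 z v w n * ((k + n - 1) * (k + n - 2))
    * (poch (u + 2) m * poch (v + 1) m * poch (w + 1) m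
       * hterm m e (u + 2) (v + 1) (w + 1) i)
  = poch u m.+2 * poch v m.+2 * poch w m.+2
    * (hterm m.+2 e u v w i - i.+1%:R * (u + z + i.+1%:R) * hterm m.+2 e u v w i.+1).
Proof.
move=> hu hv hw hz.
have nat_i (j : nat) : (j%:R : R) \is a Num.int by rewrite natr_int.
have intE := (nat_i, rpredD, rpredN, rpred1).
have d0 (c : R) : c \is a Num.int -> d + c != 0.
  move=> ci; apply: (nonint_nz hz (c := n + n - 1 + c)); rewrite ?intE //.
  by rewrite /d /e; ring.
have e0 (c : R) : c \is a Num.int -> e + c != 0.
  move=> ci; apply: (nonint_nz hz (c := n - 1 + c)); rewrite ?intE //.
  by rewrite /e; ring.
have d1 := d0 1 (rpred1 _); have dm1 := d0 (-1) (rpredN1 _).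
have dd : d != 0 by have := d0 0 (rpred0 _); rewrite addr0.
have ee : e != 0 by have := e0 0 (rpred0 _); rewrite addr0.
have e1 := e0 1 (rpred1 _).
have uj (a : R) (j : nat) : nonint a -> a + j%:R != 0.
  by move=> ha; apply: (nonint_nz ha) (erefl _); rewrite natr_int.
have u1 := uj _ 1%N hu; have u1i := uj _ i.+1 hu;
rewrite -(natr1 i) (addrC i%:R) addrA in u1i.
have v1 := uj _ 1%N hv; have w1 := uj _ 1%N hw.
have ui := uj _ i hu; have vi := uj _ i hv; have wi := uj _ i hw.
have u0 := nonint_neq0 hu; have v0 := nonint_neq0 hv; have w0 := nonint_neq0 hw.
have pu := poch_nonint i hu; have pv := poch_nonint i hv.
have pw := poch_nonint i hw.
have i0 : (i`!)%:R != 0 :> R by rewrite pnatr_eq0 -lt0n fact_gt0.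
have i1 : i%:R + 1 != 0 :> R by rewrite natr1 pnatr_eq0.
have nE : n = m%:R + 2 by rewrite /n -!natr1; ring.
have m1E : - m.+1%:R = - n + 1 :> R by rewrite nE -natr1; ring.
have m0E : - m%:R = - n + 1 + 1 :> R by rewrite nE; ring.
have nn : - n != 0 by rewrite nE oppr_eq0 -[2]/(1 + 1) addrA.
have nn1 : - n + 1 != 0.
  by rewrite nE -oppr_eq0 (_ : - _ = m%:R + 1) //; ring.
rewrite /hterm m1E m0E -/n.
have E2 (a : R) : a + 2 = a + 1 + 1 by ring.
rewrite !(poch_up i nn1) !(poch_up i nn).
rewrite !(pochS _ i) factS natrM -(natr1 i).
rewrite (E2 e) (poch_up i e1) !(poch_up i ee).
have -> : poch u m.+2 = u * (u + 1) * poch (u + 2) m.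
  by rewrite !pochSl -mulrA; congr (_ * (_ * poch _ _)); ring.
rewrite !(pochSl v m.+1) !(pochSl w m.+1).
rewrite [poch (u + 2) i](_ : _ = poch (u + 1 + 1) i); last by congr poch; ring.
rewrite (poch_up i u1) (poch_up i u0) (poch_up i v0) (poch_up i w0).
rewrite !(pochS _ m.+1) !(pochS _ m) -!(natr1 m).
(* Eliminating z in favour of e keeps the rational identity small. *)
rewrite /A /B /dual_eig0 /dual_eigN1 /k.
have -> : z = n + v + w - 1 - e by rewrite /e; ring.
have -> : m%:R = n - 2 :> R by rewrite nE addrK.
move: d1 dm1 dd ee e1 nn nn1 u1; rewrite /d.
move: (poch (- n) i) (poch e i) (poch (u + 2) _) (poch (v + 1) _) => pn pe p1 p2.
move: (poch (w + 1) _) => p3.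
move: (e) (n) => x y d1' dm1' dd' ee' e1' nn' nn1' u1'.
by field; rewrite oppr_eq0 in nn'; do !(apply/andP; split=> //).
Qed.

(** The coefficient of (a)_i (b)_i in [F4_ndiff]: multiplication by
    (a + i) (b + i) raises the index, whence the preceding coefficient on the
    right. *)
Lemma hterm_ndiff m i u v w z (n := m.+1%:R : R) (e := n + v + w - z - 1)
    (d := e + n) (k := v + w - u - z)
    (A := - e / (d * (d + 1))) (B := - n * (n + u - 1) / (d * (d - 1))) :
  nonint u -> nonint v -> nonint w -> nonint (v + w - z) ->
  ((1 + A * (k + n) + B) * dual_eig0 z v w n
     + ((z + 1) * u / 2 + i%:R * (u + z) + i%:R ^+ 2))
    * (poch u m.+1 * poch v m.+1 * poch w m.+1 * hterm m.+1 e u v w i)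
  + A * (poch u m.+2 * poch v m.+2 * poch w m.+2 * hterm m.+2 (e + 1) u v w i)
  + B * dual_eigN1 z v w n * (k + n - 1)
    * (poch u m * poch v m * poch w m * hterm m (e - 1) u v w i)
  = poch u m.+1 * poch v m.+1 * poch w m.+1
    * (if i is j.+1 then hterm m.+1 e u v w j else 0).
Proof.
move=> hu hv hw hz.
have nat_i (j : nat) : (j%:R : R) \is a Num.int by rewrite natr_int.
have intE := (nat_i, rpredD, rpredN, rpred1).
have d0 (c : R) : c \is a Num.int -> d + c != 0.
  move=> ci; apply: (nonint_nz hz (c := n + n - 1 + c)); rewrite ?intE //.
  by rewrite /d /e; ring.
have e0 (c : R) : c \is a Num.int -> e + c != 0.
  move=> ci; apply: (nonint_nz hz (c := n - 1 + c)); rewrite ?intE //.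
  by rewrite /e; ring.
have d1 := d0 1 (rpred1 _); have dm1 := d0 (-1) (rpredN1 _).
have dd : d != 0 by have := d0 0 (rpred0 _); rewrite addr0.
have ee : e != 0 by have := e0 0 (rpred0 _); rewrite addr0.
have uj (a : R) (j : nat) : nonint a -> a + j%:R != 0.
  by move=> ha; apply: (nonint_nz ha) (erefl _); rewrite natr_int.
have nE : n = m%:R + 1 by rewrite /n -!natr1; ring.
have nn : n != 0 by rewrite pnatr_eq0.
have nn' : - n != 0 by rewrite oppr_eq0.
have zE : z = n + v + w - 1 - e by rewrite /e; ring.
rewrite !pochS.
case: i => [|j].
  rewrite /hterm !poch0 fact0 /A /B /dual_eig0 /dual_eigN1 /k zE -(natr1 m).
  have -> : m%:R = n - 1 :> R by rewrite nE addrK.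
  move: d1 dm1 dd ee nn; rewrite /d.
  move: (poch u m) (poch v m) (poch w m) (e) (n) => p1 p2 p3 x y d1' dm1' dd' ee' y0.
  by field; do !(apply/andP; split=> //).
have ui := uj _ j hu; have vi := uj _ j hv; have wi := uj _ j hw.
have pu := poch_nonint j hu; have pv := poch_nonint j hv.
have pw := poch_nonint j hw.
have i0 : (j`!)%:R != 0 :> R by rewrite pnatr_eq0 -lt0n fact_gt0.
have i1 : j%:R + 1 != 0 :> R by rewrite natr1 pnatr_eq0.
have m2E : - m.+2%:R = - n - 1 :> R by rewrite nE -!natr1; ring.
have m1E : - m.+1%:R = - n :> R by [].
have m0E : - m%:R = - n + 1 :> R by rewrite nE; ring.
rewrite /hterm m2E m1E m0E (poch_predS (- n)) (poch_predS e).
rewrite (poch_up _ nn') (poch_up _ ee) !(pochS _ j) factS natrM -(natr1 j).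
rewrite /A /B /dual_eig0 /dual_eigN1 /k zE -(natr1 m).
have -> : m%:R = n - 1 :> R by rewrite nE addrK.
move: d1 dm1 dd ee nn; rewrite /d.
move: (poch u m) (poch v m) (poch w m) (poch (- n) j) (poch e j) => p1 p2 p3 p4 p5.
move: (e) (n) => x y d1' dm1' dd' ee' y0.
by field; do !(apply/andP; split=> //).
Qed.

(** The coefficient of (a - 1)_i (b - 1)_i in [F4_ndiff_down], whose right-hand
    side has degree two in a b, so that indices rise by one or two. *)
Lemma hterm_ndiff_down n i u v w z (e := n%:R + v + w - z - 1)
    (d := e + n%:R) (k := v + w - u - z)
    (A := (d * (d + 1))^-1) (B := (n%:R + u - 1) * (n%:R + u - 2) / (d * (d - 1)))
    (g := hterm n e u v w) :
  nonint u -> nonint v -> nonint w -> nonint (v + w - z) -> k + n%:R != 0 ->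
  (- 1 + A * ((k + n%:R) * (k + n%:R + 1)) + B) * dual_eig0 z v w n%:R / (k + n%:R)
    * (poch (u - 2) n.+1 * poch (v - 1) n.+1 * poch (w - 1) n.+1
       * hterm n.+1 (e - 1) (u - 2) (v - 1) (w - 1) i)
  + A * (poch (u - 2) n.+2 * poch (v - 1) n.+2 * poch (w - 1) n.+2
       * hterm n.+2 e (u - 2) (v - 1) (w - 1) i)
  + B * dual_eigN1 z v w n%:R
    * (poch (u - 2) n * poch (v - 1) n * poch (w - 1) n
       * hterm n (e - 2) (u - 2) (v - 1) (w - 1) i)
  = poch u n * poch v n * poch w n
    * match i with
      | 0 => 0
      | 1 => - ((z + 1) * (u - 1) * g 0%N)
      | j.+2 => g j - (z + j.+2%:R) * (u + j%:R) * g j.+1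
      end.
Proof.
move=> hu hv hw hz k0.
have nat_i (j : nat) : (j%:R : R) \is a Num.int by rewrite natr_int.
have intE := (nat_i, rpredD, rpredN, rpred1).
have d0 (c : R) : c \is a Num.int -> d + c != 0.
  move=> ci; apply: (nonint_nz hz (c := n%:R + n%:R - 1 + c)); rewrite ?intE //.
  by rewrite /d /e; ring.
have d1 := d0 1 (rpred1 _); have dm1 := d0 (-1) (rpredN1 _).
have dd : d != 0 by have := d0 0 (rpred0 _); rewrite addr0.
have uj (a : R) (j : nat) : nonint a -> a + j%:R != 0.
  by move=> ha; apply: (nonint_nz ha) (erefl _); rewrite natr_int.
have uz (a c : R) : nonint a -> c \is a Num.int -> a + c != 0.
  by move=> ha hc; apply: (nonint_nz ha hc).
have u1 := uz _ (-1) hu (rpredN1 _); have v1 := uz _ (-1) hv (rpredN1 _).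
have w1 := uz _ (-1) hw (rpredN1 _).
have u2 := uz _ (-2) hu; rewrite rpredN nat_i in u2; have {}u2 := u2 isT.
have un1 := uz _ (n%:R - 1) hu; have un2 := uz _ (n%:R - 2) hu.
have vn1 := uz _ (n%:R - 1) hv; have wn1 := uz _ (n%:R - 1) hw.
rewrite !intE // in un1 un2 vn1 wn1.
have {}un1 := un1 isT; have {}un2 := un2 isT.
have {}vn1 := vn1 isT; have {}wn1 := wn1 isT.
rewrite !addrA in un1 un2 vn1 wn1.
have zE : z = n%:R + v + w - 1 - e by rewrite /e; ring.
have poch2 (a : R) j : poch (a - 2) j.+2 = (a - 2) * (a - 1) * poch a j.
  by rewrite !pochSl -mulrA; congr (_ * (_ * poch _ _)); ring.
have um1 : poch (u - 2) n.+1 = (u - 2) * (u - 1) * poch u n / (u + n%:R - 1).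
  rewrite -poch2 (pochS _ n.+1) -(natr1 n).
  by rewrite (_ : u - 2 + (n%:R + 1) = u + n%:R - 1) ?mulfK //; ring.
have um0 : poch (u - 2) n = (u - 2) * (u - 1) * poch u n / (u + n%:R - 1)
    / (u + n%:R - 2).
  rewrite -um1 pochS.
  by rewrite (_ : u - 2 + n%:R = u + n%:R - 2) ?mulfK //; ring.
have vm0 (a : R) : a + n%:R - 1 != 0 ->
    poch (a - 1) n = (a - 1) * poch a n / (a + n%:R - 1).
  move=> a0; rewrite -poch_predS pochS.
  by rewrite (_ : a - 1 + n%:R = a + n%:R - 1) ?mulfK //; ring.
rewrite um0 um1 (vm0 v) // (vm0 w) // !poch_predS poch2 !(pochS _ n).
have um_i : i = 0%N \/ i = 1%N \/ exists j, i = j.+2.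
  by case: i => [|[|j]]; [left|right; left|right; right; exists j].
rewrite /g /A /B /dual_eig0 /dual_eigN1.
case: um_i => [->|[->|[j ->]]].
- rewrite /hterm !poch0 fact0.
  move: k0; rewrite /k zE /d => k0.
  move: d1 dm1 dd k0; rewrite /d.
  move: (poch u n) (poch v n) (poch w n) (e) (n%:R : R) un1 un2 vn1 wn1.
  move=> p1 p2 p3 x y un1 un2 vn1 wn1 d1' dm1' dd' k0.
  by field; do !(apply/andP; split=> //).
- rewrite /hterm !pochS !poch0 fact0 (_ : 1`! = 1)%N //.
  have -> : n.+2%:R = n%:R + 2 :> R by rewrite -addn2 natrD.
  have -> : n.+1%:R = n%:R + 1 :> R by rewrite -natr1.
  move: k0; rewrite /k zE /d => k0.
  move: d1 dm1 dd k0; rewrite /d.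
  move: (poch u n) (poch v n) (poch w n) (e) (n%:R : R) un1 un2 vn1 wn1.
  move=> p1 p2 p3 x y un1 un2 vn1 wn1 d1' dm1' dd' k0.
  by field; rewrite ?addr0; do !(apply/andP; split=> //).
have ui := uj _ j hu; have vi := uj _ j hv; have wi := uj _ j hw.
have pu := poch_nonint j hu; have pv := poch_nonint j hv.
have pw := poch_nonint j hw.
have i0 : (j`!)%:R != 0 :> R by rewrite pnatr_eq0 -lt0n fact_gt0.
have i1 : j%:R + 1 != 0 :> R by rewrite natr1 pnatr_eq0.
have i2 : j%:R + 1 + 1 != 0 :> R by rewrite !natr1 pnatr_eq0.
have n2E : - n.+2%:R = - n%:R - 2 :> R by rewrite -addn2 natrD opprD.
have n1E : - n.+1%:R = - n%:R - 1 :> R by rewrite -natr1 opprD.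
rewrite /hterm n2E n1E !poch2 (poch_predS (- n%:R)) (poch_predS e).
rewrite (poch_predS v) (poch_predS w) !(pochS _ j.+1) !(pochS _ j) !factS !natrM.
have -> : j.+2%:R = j%:R + 1 + 1 :> R by rewrite !natr1.
have -> : j.+1%:R = j%:R + 1 :> R by rewrite natr1.
move: k0; rewrite /k zE /d => k0.
move: d1 dm1 dd k0; rewrite /d.
move: (poch u n) (poch v n) (poch w n) (poch (- n%:R) j) (poch e j).
move: (e) (n%:R : R) un1 un2 vn1 wn1 => x y.
move=> un1 un2 vn1 wn1 p1 p2 p3 p4 p5 d1' dm1' dd' k0.
by field; do !(apply/andP; split=> //).
Qed.
Lemma F4_0 u v w a b : F4 0 u v w a b = 1.
Proof.
by rewrite /F4 /F4head /F4tail big_ord1 /= !poch0 fact0 invr1 !mulr1.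
Qed.

Lemma F4_1 u v w a b :
  F4 1 u v w a b = u * v * w - (u + v + w - a - b) * (a * b).
Proof.
rewrite /F4 /F4head /F4tail !big_ord_recr big_ord0 /= !pochS !poch0.
by rewrite (_ : 1`! = 1)%N // fact0; field.
Qed.

(** For s = n_1 + ... + n_{k-1}, the parameters on the left belong to s + 1 and
    those on the right to s, the sum s + n_k being shifted by -1, 0 or 1.  The
    coefficients of the degrees n - 1 and n - 2 vanish when these are negative,
    so the truncated predecessors are harmless. *)
Lemma F4_ndiff_up n u v w a b (z := a + b - u) (e := n%:R + v + w - z - 1)
    (d := e + n%:R) (k := v + w - a - b)
    (A := e * (e + 1) / (d * (d + 1))) (B := n%:R * (n%:R - 1) / (d * (d - 1))) :
  nonint u -> nonint v -> nonint w -> nonint (v + w - z) ->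
  (- 1 + A + B) * dual_eig0 z v w n%:R * (k + n%:R - 1)
    * F4 n.-1 (u + 2) (v + 1) (w + 1) (a + 1) (b + 1)
  + A * F4 n (u + 2) (v + 1) (w + 1) (a + 1) (b + 1)
  + B * dual_eigN1 z v w n%:R * ((k + n%:R - 1) * (k + n%:R - 2))
    * F4 n.-2 (u + 2) (v + 1) (w + 1) (a + 1) (b + 1)
  = F4 n u v w a b.
Proof.
move=> hu hv hw hz.
have z0 (c : R) : c \is a Num.int -> v + w - z + c != 0.
  by move=> ci; apply: (nonint_nz hz ci).
have zz := nonint_neq0 hz; have z1 := z0 1 (rpred1 _).
have z2 := z0 (1 + 1) (rpredD (rpred1 _) (rpred1 _)); rewrite addrA in z2.
have zm1 := z0 (-1) (rpredN1 _).
case: n => [|[|m]] in e d A B *.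
- rewrite /= !F4_0 /B !mul0r addr0 addr0 !mulr1.
  have -> : A = 1.
    rewrite /A /d /e /= !add0r addr0 divff // mulf_neq0 //.
    by rewrite subrK.
  by rewrite addNr !mul0r add0r.
- rewrite /= !F4_0 !F4_1 /B subrr mulr0 !mul0r !addr0 /A /d /e /dual_eig0 /k.
  have xE : 1 + v + w - z - 1 = v + w - z by ring.
  rewrite xE !mulr1; move: zz z1 z2 zm1; rewrite /z => *.
  by field; do !(apply/andP; split=> //).
have hu2 : nonint (u + 2) by apply: nonintD hu _; rewrite natr_int.
have hv1 : nonint (v + 1) by apply: nonintD hv (rpred1 _).
have hw1 : nonint (w + 1) by apply: nonintD hw (rpred1 _).
rewrite /= !(@F4_hterm _ m.+3) //; do ?by lia.
have kE : k = v + w - u - z by rewrite /k /z; ring.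
have C i := hterm_ndiff_up m i hu hv hw hz.
rewrite -/e -/d -kE -/A -/B in C.
have -> : m.+1%:R + (u + 2) + (v + 1) + (w + 1) - (a + 1) - (b + 1) - 1 = e + 1.
  by rewrite /e /z -!(natr1 m.+1); ring.
have -> : m.+2%:R + (u + 2) + (v + 1) + (w + 1) - (a + 1) - (b + 1) - 1 = e + 2.
  by rewrite /e /z; ring.
have -> : m%:R + (u + 2) + (v + 1) + (w + 1) - (a + 1) - (b + 1) - 1 = e.
  by rewrite /e /z -!(natr1 m.+1) -(natr1 m); ring.
have -> : m.+2%:R + u + v + w - a - b - 1 = e by rewrite /e /z; ring.
apply/eqP; rewrite -subr_eq0; apply/eqP.
rewrite !mulr_sumr -!(@big_split R 0) -sumrB /=.
pose PP := poch u m.+2 * poch v m.+2 * poch w m.+2.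
pose T i := PP * (i%:R * (u + z + i%:R) * hterm m.+2 e u v w i *
                  (poch (a + 1) i.-1 * poch (b + 1) i.-1)).
apply: (sum_telescope (T := T)
  (F := fun i => _ * (_ * (hterm m.+1 (e + 1) (u + 2) (v + 1) (w + 1) i
                      * (poch (a + 1) i * poch (b + 1) i)))
   + _ * (_ * (hterm m.+2 (e + 2) (u + 2) (v + 1) (w + 1) i
                      * (poch (a + 1) i * poch (b + 1) i)))
   + _ * (_ * (hterm m e (u + 2) (v + 1) (w + 1) i
                      * (poch (a + 1) i * poch (b + 1) i)))
   - _ * (hterm m.+2 e u v w i * (poch a i * poch b i)))).
- by rewrite /T !mul0r mulr0.
- by rewrite /T hterm_eq0 // mulr0 mul0r mulr0.
move=> i _.
transitivity (PP * (hterm m.+2 e u v w i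
    - i.+1%:R * (u + z + i.+1%:R) * hterm m.+2 e u v w i.+1)
    * (poch (a + 1) i * poch (b + 1) i)
   - PP * (hterm m.+2 e u v w i * (poch a i * poch b i))).
  by rewrite /PP -C; ring.
rewrite /T /=; case: i => [|j].
  by rewrite !poch0; ring.
rewrite /= (pochS (a + 1)) (pochS (b + 1)) (pochSl a) (pochSl b) -(natr1 j).
by rewrite /z; ring.
Qed.

(** The three-term recurrence of the Racah polynomials. *)
Lemma F4_ndiff n u v w a b (z := a + b - u) (e := n%:R + v + w - z - 1)
    (d := e + n%:R) (k := v + w - a - b)
    (A := - e / (d * (d + 1))) (B := - n%:R * (n%:R + u - 1) / (d * (d - 1))) :
  nonint u -> nonint v -> nonint w -> nonint (v + w - z) ->
  (1 + A * (k + n%:R) + B) * dual_eig0 z v w n%:R * F4 n u v w a b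
  + A * F4 n.+1 u v w a b
  + B * dual_eigN1 z v w n%:R * (k + n%:R - 1) * F4 n.-1 u v w a b
  = dual_eig0 z a b 0 * F4 n u v w a b.
Proof.
move=> hu hv hw hz.
have z0 (c : R) : c \is a Num.int -> v + w - z + c != 0.
  by move=> ci; apply: (nonint_nz hz ci).
have zz := nonint_neq0 hz; have zm1 := z0 (-1) (rpredN1 _).
case: n => [|m] in e d A B *.
- rewrite /= !F4_0 !F4_1 /B oppr0 !mul0r !addr0 /A /d /e /dual_eig0 /k.
  rewrite !add0r !addr0 subrK; move: zz zm1; rewrite /z => *.
  by field; do !(apply/andP; split=> //).
rewrite /= !(@F4_hterm _ m.+3) //; do ?by lia.
have kE : k = v + w - u - z by rewrite /k /z; ring.
have C i := hterm_ndiff m i hu hv hw hz.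
rewrite -/e -/d -kE -/A -/B in C.
have -> : m.+1%:R + u + v + w - a - b - 1 = e by rewrite /e /z; ring.
have -> : m.+2%:R + u + v + w - a - b - 1 = e + 1.
  by rewrite /e /z -!(natr1 m.+1); ring.
have -> : m%:R + u + v + w - a - b - 1 = e - 1.
  by rewrite /e /z -!(natr1 m); ring.
apply/eqP; rewrite -subr_eq0; apply/eqP.
rewrite !mulr_sumr -!(@big_split R 0) -sumrB /=.
pose PP := poch u m.+1 * poch v m.+1 * poch w m.+1.
pose T i := if i is j.+1 then
  PP * (hterm m.+1 e u v w j * (poch a i * poch b i)) else 0.
apply: (sum_telescope (T := T)
  (F := fun i => _ * (_ * (hterm m.+1 e u v w i * (poch a i * poch b i)))
   + _ * (_ * (hterm m.+2 (e + 1) u v w i * (poch a i * poch b i)))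
   + _ * (_ * (hterm m (e - 1) u v w i * (poch a i * poch b i)))
   - _ * (_ * (hterm m.+1 e u v w i * (poch a i * poch b i))))) => //.
- by rewrite /T hterm_eq0 // mul0r mulr0.
move=> i _.
transitivity (PP * (if i is j.+1 then hterm m.+1 e u v w j else 0)
    * (poch a i * poch b i)
   - ((z + 1) * u / 2 + i%:R * (u + z) + i%:R ^+ 2 + dual_eig0 z a b 0)
     * (PP * (hterm m.+1 e u v w i * (poch a i * poch b i)))).
  by rewrite /PP -C; ring.
have -> : (z + 1) * u / 2 + i%:R * (u + z) + i%:R ^+ 2 + dual_eig0 z a b 0
    = (a + i%:R) * (b + i%:R) by rewrite /dual_eig0 /z; field.
by rewrite /T !pochS; case: i => [|j]; ring.
Qed.

(** The companion of [F4_ndiff_up] with the parameters of s - 1 on the left. *)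
Lemma F4_ndiff_down n u v w a b (z := a + b - u) (e := n%:R + v + w - z - 1)
    (d := e + n%:R) (k := v + w - a - b)
    (A := (d * (d + 1))^-1) (B := (n%:R + u - 1) * (n%:R + u - 2) / (d * (d - 1))) :
  nonint u -> nonint v -> nonint w -> nonint (v + w - z) -> k + n%:R != 0 ->
  (- 1 + A * ((k + n%:R) * (k + n%:R + 1)) + B) * dual_eig0 z v w n%:R / (k + n%:R)
    * F4 n.+1 (u - 2) (v - 1) (w - 1) (a - 1) (b - 1)
  + A * F4 n.+2 (u - 2) (v - 1) (w - 1) (a - 1) (b - 1)
  + B * dual_eigN1 z v w n%:R * F4 n (u - 2) (v - 1) (w - 1) (a - 1) (b - 1)
  = ((a - 1) * (a - 1 - z) * (b - z - 1) * (b - 1)) * F4 n u v w a b.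
Proof.
move=> hu hv hw hz k0.
have hu2 : nonint (u - 2) by apply: nonintD hu _; rewrite rpredN natr_int.
have hv1 : nonint (v - 1) by apply: nonintD hv (rpredN1 _).
have hw1 : nonint (w - 1) by apply: nonintD hw (rpredN1 _).
rewrite /= !(@F4_hterm _ n.+3) //; do ?by lia.
have kE : k = v + w - u - z by rewrite /k /z; ring.
have k0' := k0; rewrite kE in k0'.
have C i := hterm_ndiff_down i hu hv hw hz k0'.
rewrite -kE -/e -/d -/A -/B in C.
have -> : n.+1%:R + (u - 2) + (v - 1) + (w - 1) - (a - 1) - (b - 1) - 1 = e - 1.
  by rewrite /e /z -!(natr1 n); ring.
have -> : n.+2%:R + (u - 2) + (v - 1) + (w - 1) - (a - 1) - (b - 1) - 1 = e.
  by rewrite /e /z -(natr1 n.+1) -(natr1 n); ring.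
have -> : n%:R + (u - 2) + (v - 1) + (w - 1) - (a - 1) - (b - 1) - 1 = e - 2.
  by rewrite /e /z; ring.
have -> : n%:R + u + v + w - a - b - 1 = e by rewrite /e /z; ring.
apply/eqP; rewrite -subr_eq0; apply/eqP.
rewrite !mulr_sumr -!(@big_split R 0) -sumrB /=.
pose PP := poch u n * poch v n * poch w n.
pose g := hterm n e u v w.
pose f i := poch (a - 1) i * poch (b - 1) i.
pose T i := PP * match i with
  | 0 => 0
  | 1 => g 0%N * f 2%N - (z + 1) * (u - 1) * g 0%N * f 1%N
  | j.+2 => g j * f j.+2 + g j.+1 * f j.+3
            - (z + j.+2%:R) * (u + j%:R) * g j.+1 * f j.+2
  end.
apply: (sum_telescope (T := T)
  (F := fun i => _ * (_ * (hterm n.+1 (e - 1) (u - 2) (v - 1) (w - 1) i * f i))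
   + _ * (_ * (hterm n.+2 e (u - 2) (v - 1) (w - 1) i * f i))
   + _ * (_ * (hterm n (e - 2) (u - 2) (v - 1) (w - 1) i * f i))
   - _ * (_ * (g i * (poch a i * poch b i))))).
- by rewrite /T mulr0.
- by rewrite /T /g !hterm_eq0 // !mul0r mulr0 mul0r addr0 subr0 mulr0.
move=> i _.
transitivity (PP * match i with
      | 0 => 0
      | 1 => - ((z + 1) * (u - 1) * g 0%N)
      | j.+2 => g j - (z + j.+2%:R) * (u + j%:R) * g j.+1
      end * f i
   - ((a - 1 - z) * (b - z - 1)) * (PP * (g i * f i.+1))).
  by rewrite /PP /g -C /f !poch_predS; ring.
have fS j : f j.+1 = f j * (a - 1 + j%:R) * (b - 1 + j%:R).
  by rewrite /f !pochS; ring.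
rewrite /T; case: i => [|[|j]]; rewrite !fS -?(natr1 j.+1) -?(natr1 j) /z; ring.
Qed.
End Hypergeometric.
(** * Operators as functionals *)

Section Pairing.
Variables (R : realType) (p : nat).
Implicit Types (F G : dop R p) (phi : 'rV[int]_p -> R) (v : pt R p).

(** An operator is handled only through this functional of phi, which is
    additive in the operator, turns products into composition, is compatible
    with the duality map, and recovers the coefficients. *)
Definition pairing F phi v : R := \sum_(m <- msupp F) mcoeff m F v * phi m.

Lemma pairing_wide (S : {fset 'rV[int]_p}) F phi v : (msupp F `<=` S)%fset ->
  pairing F phi v = \sum_(m <- S) mcoeff m F v * phi m.
Proof.
move=> sub; rewrite /pairing [LHS](big_fset_incl _ sub) //= => m mS.
by move=> /mcoeff_outdom ->; rewrite mul0r.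
Qed.

Lemma pairingB F G phi v : pairing (F - G) phi v = pairing F phi v - pairing G phi v.
Proof.
pose S := (msupp F `|` msupp G `|` msupp (F - G))%fset.
have sB : (msupp (F - G) `<=` S)%fset by rewrite fsubsetUr.
have sFG : (msupp F `|` msupp G `<=` S)%fset by rewrite fsubsetUl.
have sF := fsubset_trans (fsubsetUl _ _) sFG.
have sG := fsubset_trans (fsubsetUr _ _) sFG.
rewrite (pairing_wide _ _ sB) (pairing_wide _ _ sF) (pairing_wide _ _ sG).
by rewrite -sumrB; apply: eq_bigr => m _; rewrite mcoeffB mulrBl.
Qed.

Lemma pairing0 phi v : pairing 0 phi v = 0.
Proof. by rewrite /pairing msupp0 big_seq_fset0. Qed.

Lemma pairingD F G phi v : pairing (F + G) phi v = pairing F phi v + pairing G phi v.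
Proof.
have -> : F + G = F - (0 - G) by rewrite sub0r opprK.
by rewrite !pairingB pairing0 sub0r opprK.
Qed.

Lemma pairing_sum (I : Type) (r : seq I) (P : pred I) (H : I -> dop R p) phi v :
  pairing (\sum_(i <- r | P i) H i) phi v = \sum_(i <- r | P i) pairing (H i) phi v.
Proof.
elim/big_rec2: _ => [|i x F _ <-]; first exact: pairing0.
exact: pairingD.
Qed.

Lemma pairing_dmon c m phi v : pairing (dmon c m) phi v = c v * phi m.
Proof.
by rewrite (pairing_wide _ _ msuppU_le) big_seq_fset1 mcoeffUU.
Qed.

Lemma pairing_dmul F G phi v :
  pairing (dmul F G) phi v =
  pairing F (fun m => pairing G (fun l => phi (m + l)) (shift_pt m v)) v.
Proof.
rewrite /dmul pairing_sum; apply: eq_bigr => m _.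
rewrite pairing_sum /pairing mulr_sumr; apply: eq_bigr => l _.
by rewrite -/(pairing _ _ _) pairing_dmon mulrA.
Qed.

Lemma pairing_bdual F phi v :
  pairing (bdual F) phi v = pairing F (fun m => phi (bshift m)) (bpoint v).
Proof.
by rewrite /bdual pairing_sum; apply: eq_bigr => m _; rewrite pairing_dmon.
Qed.

Lemma mcoeff_pairing F m v : mcoeff m F v = pairing F (fun l => (l == m)%:R) v.
Proof.
rewrite (@pairing_wide (m |` msupp F)%fset) ?fsubsetUr //.
rewrite (big_fsetD1 m) ?fset1U1 //= eqxx mulr1 big1_fset ?addr0 // => l.
by rewrite !inE => /andP[/negbTE-> _] _; rewrite mulr0.
Qed.

Lemma eq_pairing F phi psi v : phi =1 psi -> pairing F phi v = pairing F psi v.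
Proof. by move=> e; apply: eq_bigr => m _; rewrite e. Qed.

Definition Diff (a : 'rV[int]_p) phi : 'rV[int]_p -> R := fun m => phi (m + a) - phi m.

Lemma DiffC a c phi : Diff a (Diff c phi) = Diff c (Diff a phi).
Proof.
by apply: funext => m; rewrite /Diff (addrAC m c a); ring.
Qed.

Definition Diffs (e : nat -> 'rV[int]_p) phi (s : seq nat) :=
  foldl (fun f k => Diff (e k) f) phi s.

Lemma Diffs_Diff e a phi s : Diffs e (Diff a phi) s = Diff a (Diffs e phi s).
Proof. by elim: s phi => //= k s IH phi; rewrite DiffC IH. Qed.

Lemma Diff_trans a phi c : (fun l => Diff a phi (c + l)) = Diff a (fun l => phi (c + l)).
Proof. by apply: funext => l; rewrite /Diff addrA. Qed.

Lemma Diffs_trans e phi s c :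
  (fun l => Diffs e phi s (c + l)) = Diffs e (fun l => phi (c + l)) s.
Proof. by elim: s phi => //= k s IH phi; rewrite -Diff_trans IH. Qed.

Lemma pairing_dop1 phi v : pairing (dop1 R p) phi v = phi 0.
Proof. by rewrite pairing_dmon mul1r. Qed.

Lemma pairing_Deltas s phi v :
  pairing (\big[@dmul R p/dop1 R p]_(k <- s) Delta R p k) phi v
  = Diffs (@ek p) phi s 0.
Proof.
elim: s phi v => [|k s IH] phi v; first by rewrite big_nil pairing_dop1.
rewrite big_cons pairing_dmul /Delta pairingB pairing_dop1 pairing_dmon mul1r !IH.
rewrite -!Diffs_trans /= addr0 addr0 -/(Diffs _ _ _) Diffs_Diff /Diff.
by rewrite add0r.
Qed.

Lemma pairing_Nablas s phi v :
  pairing (\big[@dmul R p/dop1 R p]_(k <- s) Nabla R p k) phi v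
  = (-1) ^+ size s * Diffs (fun k => - ek p k) phi s 0.
Proof.
elim: s phi v => [|k s IH] phi v; first by rewrite big_nil pairing_dop1 expr0 mul1r.
rewrite big_cons pairing_dmul /Nabla pairingB pairing_dop1 pairing_dmon mul1r !IH.
rewrite -!Diffs_trans /= !addr0 -/(Diffs _ _ _) Diffs_Diff /Diff.
by rewrite add0r exprS mulN1r mulNr -mulrBr -mulrN opprB.
Qed.

Lemma pairing_DeltasNablas s t phi v :
  pairing (dmul (\big[@dmul R p/dop1 R p]_(k <- s) Delta R p k)
                (\big[@dmul R p/dop1 R p]_(k <- t) Nabla R p k)) phi v
  = (-1) ^+ size t * Diffs (@ek p) (Diffs (fun k => - ek p k) phi t) s 0.
Proof.
rewrite pairing_dmul (@eq_pairing _ _ (fun m => (-1) ^+ size t *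
    Diffs (fun k => - ek p k) phi t m)); last first.
  by move=> m; rewrite pairing_Nablas -Diffs_trans addr0.
rewrite pairing_Deltas.
have lin c f : Diffs (@ek p) (fun m => c * f m) s = fun m => c * Diffs (@ek p) f s m.
  elim: s f => //= k s IH f; rewrite -IH; congr Diffs.
  by apply: funext => m; rewrite /Diff mulrBr.
by rewrite lin.
Qed.

End Pairing.
(** * The operator as a sum over chains *)

Section SumOverSigns.
Variable R : realType.

Definition ext (q : nat) (nu : {ffun 'I_q -> 'I_3}) (e : 'I_3) :
    {ffun 'I_q.+1 -> 'I_3} :=
  [ffun k => if unlift ord_max k is Some k' then nu k' else e].

Lemma filter_ext (P : pred 'I_3) q (nu : {ffun 'I_q -> 'I_3}) e :
  map (fun k : 'I_q.+1 => k.+1) [seq k <- enum 'I_q.+1 | P (ext nu e k)] =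
  map (fun k : 'I_q => k.+1) [seq k <- enum 'I_q | P (nu k)]
    ++ (if P e then [:: q.+1] else [::]).
Proof.
rewrite enum_ordSr filter_rcons.
have -> : ext nu e ord_max = e by rewrite ffunE unlift_none.
have -> : [seq k <- [seq widen_ord (leqnSn q) i | i <- enum 'I_q] | P (ext nu e k)]
    = map (widen_ord (leqnSn q)) [seq k <- enum 'I_q | P (nu k)].
  rewrite filter_map; congr map; apply: eq_filter => k /=.
  rewrite ffunE (_ : widen_ord _ k = lift ord_max k) ?liftK //.
  by apply: val_inj; rewrite /= /bump leqNgt ltn_ord.
case: (P e); last by rewrite cats0 -map_comp; apply: eq_map.
by rewrite map_rcons cats1 /= -map_comp.
Qed.

Lemma big_ext q (F : {ffun 'I_q.+1 -> 'I_3} -> R) :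
  \sum_nu F nu = \sum_(nu : {ffun 'I_q -> 'I_3}) \sum_e F (ext nu e).
Proof.
rewrite pair_bigA /= (reindex (fun x : {ffun 'I_q -> 'I_3} * 'I_3 => ext x.1 x.2)) //=.
exists (fun mu => ([ffun k => mu (lift ord_max k)], mu ord_max)) => /= [[nu e] _|mu _].
  congr (_, _) => /=; last by rewrite ffunE unlift_none.
  by apply/ffunP => k; rewrite !ffunE liftK.
apply/ffunP => k; rewrite ffunE /=; case: unliftP => [j ->|-> //].
by rewrite ffunE.
Qed.

End SumOverSigns.

Section Chain.
Variables (R : realType) (p : nat) (z b : nat -> R).
Implicit Types (phi : 'rV[int]_p -> R) (Q : option R -> R).

Definition mirror k : R := - z k - b k.
(** The factor of A_nu contributed by a position with coordinate w, given the
    coordinate y of the preceding nonzero position, if there is one. *)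
Definition link k (w : R) (y : option R) : R :=
  if y is Some y then (w + y + b k) * (w + y + b k + 1)
  else (w + b k - b 0%N) * (w + b k).
Definition pole k (w : R) : R := (2 * w + b k) * (2 * w + b k + 1).

(** The sum over nu of A_nu times the corresponding differences of phi at 0,
    where the closing factor (y + beta_{q+1} + M) (M - y) of A_nu is replaced
    by an arbitrary function Q of the coordinate of the last nonzero position
    (None for nu = 0): a shorter chain is closed by the next link instead, and
    a free Q makes both cases instances of the same sum.  A negative sign
    replaces z k by its mirror, and the sign (-1)^|nu^-| is absorbed into the
    direction of the difference. *)
Fixpoint chain_sum k Q phi : R :=
  if k is k'.+1 then
    chain_sum k' Q phi
    + Q (Some (z k)) / pole k (z k) * chain_sum k' (link k (z k)) (Diff (ek p k) phi)
    + Q (Some (mirror k)) / pole k (mirror k) * chain_sum k' (link k (mirror k)) (Diff (- ek p k) phi)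
  else Q None * phi 0.

Definition chain_weight (zz : nat -> R) Q (s : seq nat) : R :=
  if s is i1 :: _ then
    (zz i1 + b i1 - b 0%N) * (zz i1 + b i1) *
    ((\prod_(2 <= k < (size s).+1)
        ((zz (nth 0%N s k.-1) + zz (nth 0%N s k.-2) + b (nth 0%N s k.-1)) *
         (zz (nth 0%N s k.-1) + zz (nth 0%N s k.-2) + b (nth 0%N s k.-1) + 1))) /
     (\prod_(1 <= k < (size s).+1) pole (nth 0%N s k.-1) (zz (nth 0%N s k.-1)))) *
    Q (Some (zz (nth 0%N s (size s).-1)))
  else Q None.

Lemma chain_weight_rcons zz Q s i :
  chain_weight zz Q (rcons s i) =
  chain_weight zz (link i (zz i)) s * (Q (Some (zz i)) / pole i (zz i)).
Proof.
case: s => [|i1 s].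
  by rewrite /= big_geq // big_nat1 /= div1r -mulrA (mulrC _^-1).
rewrite [rcons _ _]/= /chain_weight; set t := i1 :: s.
have nt : nth 0%N (rcons s i) (size s) = i by rewrite nth_rcons ltnn eqxx.
have nl : nth 0%N (i1 :: rcons s i) (size s) = nth 0%N t (size s).
  by rewrite -rcons_cons nth_rcons /= ltnSn.
have nk k : (k.-1 < size t)%N -> nth 0%N (i1 :: rcons s i) k.-1 = nth 0%N t k.-1.
  by move=> kt; rewrite -rcons_cons nth_rcons kt.
rewrite [size _]/= size_rcons big_nat_recr //= [X in _ / X]big_nat_recr //=.
rewrite !nt nl invfM.
rewrite (eq_big_nat _ _ (F2 := fun k =>
  (zz (nth 0%N t k.-1) + zz (nth 0%N t k.-2) + b (nth 0%N t k.-1)) *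
  (zz (nth 0%N t k.-1) + zz (nth 0%N t k.-2) + b (nth 0%N t k.-1) + 1))); last first.
  by move=> k /andP[k2 kt]; rewrite !nk //=; lia.
rewrite [X in X^-1 * _](eq_big_nat _ _ (F2 := fun k =>
  pole (nth 0%N t k.-1) (zz (nth 0%N t k.-1)))); last first.
  by move=> k /andP[k2 kt]; rewrite !nk //=; lia.
by ring.
Qed.

Lemma eq_chain_weight zz zz' Q s :
  {in s, zz =1 zz'} -> chain_weight zz Q s = chain_weight zz' Q s.
Proof.
elim/last_ind: s Q => // s i IH Q e.
have ei : zz i = zz' i by apply: e; rewrite mem_rcons mem_head.
rewrite !chain_weight_rcons -ei IH // => k ks.
by apply: e; rewrite mem_rcons inE ks orbT.
Qed.

Definition zsign q (nu : {ffun 'I_q -> 'I_3}) k : R :=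
  if k \in nu_neg nu then mirror k else z k.

Lemma mem_nu_le (P : pred 'I_3) q (nu : {ffun 'I_q -> 'I_3}) k :
  k \in map (fun k : 'I_q => k.+1) [seq k <- enum 'I_q | P (nu k)] -> (k <= q)%N.
Proof. by case/mapP => j _ ->. Qed.

(** The recursion of [chain_sum] sorts the sign vectors by their last entry. *)
Lemma sum_signs q Q phi :
  \sum_(nu : {ffun 'I_q -> 'I_3}) chain_weight (zsign nu) Q (nu_supp nu)
     * Diffs (@ek p) (Diffs (fun k => - ek p k) phi (nu_neg nu)) (nu_pos nu) 0
  = chain_sum q Q phi.
Proof.
elim: q Q phi => [|q IH] Q phi.
  have nu0 (nu : {ffun 'I_0 -> 'I_3}) : nu = [ffun=> 0].
    by apply/ffunP => - [].
  have e0 : enum 'I_0 = [::] by apply: size0nil; rewrite size_enum_ord.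
  rewrite (big_pred1 [ffun=> 0]) => [|nu]; last by rewrite /= (nu0 nu) eqxx.
  by rewrite /nu_supp /nu_neg /nu_pos e0.
rewrite big_ext /=.
have suppE (nu : {ffun 'I_q -> 'I_3}) e : nu_supp (ext nu e) = nu_supp nu ++
    (if e != 1%N :> nat then [:: q.+1] else [::]) :=
  filter_ext (fun x => x != 1%N :> nat) nu e.
have negE (nu : {ffun 'I_q -> 'I_3}) e : nu_neg (ext nu e) = nu_neg nu ++
    (if e == 0%N :> nat then [:: q.+1] else [::]) :=
  filter_ext (fun x => x == 0%N :> nat) nu e.
have posE (nu : {ffun 'I_q -> 'I_3}) e : nu_pos (ext nu e) = nu_pos nu ++
    (if e == 2%N :> nat then [:: q.+1] else [::]) :=
  filter_ext (fun x => x == 2%N :> nat) nu e.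
rewrite -!IH !mulr_sumr -!big_split /=; apply: eq_bigr => nu _.
rewrite !big_ord_recl big_ord0 addr0 /=.
have zE e k : (k <= q)%N -> zsign (ext nu e) k = zsign nu k.
  move=> kq; rewrite /zsign negE mem_cat.
  have -> : (k \in (if e == 0%N :> nat then [:: q.+1] else [::])) = false.
    by case: ifP => // _; rewrite inE; apply/negbTE; lia.
  by rewrite orbF.
have zq e : zsign (ext nu e) q.+1 = if e == 0%N :> nat then mirror q.+1 else z q.+1.
  rewrite /zsign negE mem_cat.
  have /negbTE -> : q.+1 \notin nu_neg nu.
    by apply/negP => /(@mem_nu_le (fun x => x == 0%N :> nat)); rewrite ltnn.
  by rewrite /=; case: (e == 0%N :> nat); rewrite ?inE ?eqxx.
have cE e Q' : chain_weight (zsign (ext nu e)) Q' (nu_supp nu) = chain_weight (zsign nu) Q' (nu_supp nu).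
  apply: eq_chain_weight => k /(@mem_nu_le (fun x => x != 1%N :> nat)); exact: zE.
have Diffs_rcons e f s k : Diffs e f (rcons s k) = Diff (e k) (Diffs e f s) :> ('rV[int]_p -> R).
  by rewrite /Diffs foldl_rcons.
rewrite !suppE !negE !posE /= !cats0 !cats1.
rewrite !chain_weight_rcons !cE !zq /= !Diffs_rcons !Diffs_Diff.
by ring.
Qed.
End Chain.
Section Coordinates.
Variables (R : realType) (p : nat).

Lemma crd_lt (T : Type) m (v : 'rV[T]_m) d k (lt_km : (k < m)%N) :
  crd v d k = v ord0 (Ordinal lt_km).
Proof. by rewrite /crd insubT. Qed.

Lemma crd_ge (T : Type) m (v : 'rV[T]_m) d k : (m <= k)%N -> crd v d k = d.
Proof. by move=> le_mk; rewrite /crd insubF // ltnNge le_mk. Qed.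

Lemma bc_row (f : 'I_p.+2 -> R) k (lt_k : (k < p.+2)%N) :
  bc (\row_i f i) k = f (Ordinal lt_k).
Proof. by rewrite /bc crd_lt mxE. Qed.

Lemma xc_row (f : 'I_p -> R) N k (lt_k : (k < p)%N) :
  xc (\row_i f i) N k.+1 = f (Ordinal lt_k).
Proof. by rewrite /xc /= crd_lt mxE. Qed.

Lemma xc_gt (x : 'rV[R]_p) N k : (p < k)%N -> xc x N k = N.
Proof. by case: k => // k lt_pk; rewrite /xc crd_ge. Qed.

Lemma xc_refl k (v : pt R p) i : (0 < i <= p)%N ->
  xc (ptx (refl_pt k v)) (ptN v) i =
  if i == k then - xc (ptx v) (ptN v) i - bc (ptb v) k else xc (ptx v) (ptN v) i.
Proof.
case: i => // i /= lt_ip; rewrite xc_row /=.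
by rewrite /xc /= (crd_lt _ _ lt_ip).
Qed.

Definition refls (v : pt R p) (s : seq nat) := foldl (fun w k => refl_pt k w) v s.

Lemma foldr_Isub (c : pt R p -> R) s v : foldr (@Isub R p) c s v = c (refls v s).
Proof. by elim: s v => //= k s IH v; rewrite /Isub IH. Qed.

Lemma ptb_refls v s : ptb (refls v s) = ptb v.
Proof. by elim: s v => //= k s IH v; rewrite IH. Qed.

Lemma ptN_refls v s : ptN (refls v s) = ptN v.
Proof. by elim: s v => //= k s IH v; rewrite IH. Qed.

Lemma xc_refls v s i : uniq s -> (0 < i <= p)%N ->
  xc (ptx (refls v s)) (ptN v) i =
  if i \in s then mirror (xc (ptx v) (ptN v)) (bc (ptb v)) i else xc (ptx v) (ptN v) i.
Proof.
move=> + ip; elim: s v => //= k s IH v /andP[ks us].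
rewrite -[ptN v]/(ptN (refl_pt k v)) IH // /mirror /= !xc_refl // inE.
case: (i =P k) => [->|//]; by rewrite (negbTE ks).
Qed.

Lemma uniq_nu_neg q (nu : {ffun 'I_q -> 'I_3}) : uniq (nu_neg nu).
Proof.
rewrite /nu_neg map_inj_uniq; first exact/filter_uniq/enum_uniq.
by move=> i j [] /val_inj.
Qed.

Lemma AcoefE q (M : pt R p -> R) s v : s != [::] ->
  Acoef q M s v = chain_weight (bc (ptb v)) (xc (ptx v) (ptN v))
    (fun y => if y is Some y then (y + bc (ptb v) q.+1 + M v) * (M v - y) else 0) s.
Proof. by case: s => // i1 s _; rewrite /Acoef /chain_weight /= -!mulrA. Qed.

Lemma pairing_Lop q (M : pt R p -> R) phi v : (q <= p)%N ->
  (forall w k, (k <= q)%N -> M (refl_pt k w) = M w) ->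
  pairing (Lop q M) phi v =
  chain_sum (xc (ptx v) (ptN v)) (bc (ptb v)) q
    (fun y => if y is Some y then (y + bc (ptb v) q.+1 + M v) * (M v - y) else 0) phi.
Proof.
move=> le_qp MI; rewrite -sum_signs /Lop pairing_sum [RHS]big_mkcond /=.
rewrite [LHS]big_mkcond /=; apply: eq_bigr => nu _.
case: eqP => [->|/eqP nz] /=; first by rewrite mul0r.
rewrite pairing_dmul pairing_dmon.
rewrite (@eq_pairing _ _ _ _ phi); last by move=> l; rewrite add0r.
rewrite pairing_DeltasNablas mulrACA mulrA.
rewrite -exprD addnn -mul2n exprM sqrrN expr1n expr1n mul1r; congr (_ * _).
rewrite /Anu foldr_Isub AcoefE // ptb_refls ptN_refls.
have -> : M (refls v (nu_neg nu)) = M v.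
  have : all (fun k => k <= q)%N (nu_neg nu).
    by apply/allP => k /(@mem_nu_le (fun x => x == 0%N :> nat)).
  by elim: (nu_neg nu) v => //= k s IH w /andP[kq /IH ->]; rewrite MI.
apply: eq_chain_weight => k ks; rewrite /zsign xc_refls ?uniq_nu_neg //.
have kq := @mem_nu_le (fun x => x != 1%N :> nat) _ _ _ ks.
by rewrite (leq_trans kq le_qp) andbT; case/mapP: ks => i _ ->.
Qed.

Lemma pairing_Lx j phi v : (0 < j <= p)%N ->
  pairing (Lx R p j) phi v =
  chain_sum (xc (ptx v) (ptN v)) (bc (ptb v)) j
    (fun y => if y is Some y then
        (y + bc (ptb v) j.+1 + xc (ptx v) (ptN v) j.+1) * (xc (ptx v) (ptN v) j.+1 - y)
      else 0) phi.
Proof.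
case/andP=> j0 jp; apply: pairing_Lop => // w k kj.
have [lt_jp|] := ltnP j p; last by move=> pj; rewrite !xc_gt.
by rewrite xc_refl ?lt_jp //; case: eqP => // jk; move: kj; rewrite -jk ltnn.
Qed.

Lemma dactE j (f : 'rV[R]_p -> R) b N x :
  dact (Lx R p j) f b N x = pairing (Lx R p j) (fun m => f (x + map_mx intr m)) (Pt x b N).
Proof. by []. Qed.

End Coordinates.
(** * Contracting a chain along a product of two-coordinate factors *)

Section ChainContraction.
Variables (R : realType) (p : nat) (z b : nat -> R).
Implicit Types (phi : 'rV[int]_p -> R) (Q : option R -> R).
Local Notation chain_sum := (@chain_sum R p z b).
Local Notation mirrorz := (mirror z b).
Local Notation linkb := (link b).
Local Notation poleb := (pole b).

Lemma chain_sum_linQ k c1 c2 c3 Q1 Q2 Q3 phi :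
  chain_sum k (fun y => c1 * Q1 y + c2 * Q2 y + c3 * Q3 y) phi =
  c1 * chain_sum k Q1 phi + c2 * chain_sum k Q2 phi + c3 * chain_sum k Q3 phi.
Proof.
elim: k Q1 Q2 Q3 phi => [|k IH] Q1 Q2 Q3 phi /=; first by ring.
by rewrite IH; ring.
Qed.

Lemma chain_sum_subphi k Q phi psi :
  chain_sum k Q (fun m => phi m - psi m) = chain_sum k Q phi - chain_sum k Q psi.
Proof.
elim: k Q phi psi => [|k IH] Q phi psi /=; first by ring.
have DiffB a : Diff a (fun m => phi m - psi m) = fun m => Diff a phi m - Diff a psi m.
  by apply: funext => m; rewrite /Diff; ring.
by rewrite !DiffB !IH; ring.
Qed.

(** The hypothesis says that Q is a multiple of f modulo the two links at
    position k + 1.  Then the unshifted terms of the two differences cancel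
    against the links, and only the shifts of phi survive. *)
Lemma chain_sum_step k c Q f phi :
  (forall y, Q y = c * f y + Q (Some (z k.+1)) / poleb k.+1 (z k.+1) * linkb k.+1 (z k.+1) y
     + Q (Some (mirrorz k.+1)) / poleb k.+1 (mirrorz k.+1) * linkb k.+1 (mirrorz k.+1) y) ->
  chain_sum k.+1 Q phi = c * chain_sum k f phi
    + Q (Some (z k.+1)) / poleb k.+1 (z k.+1)
      * chain_sum k (linkb k.+1 (z k.+1)) (fun m => phi (m + ek p k.+1))
    + Q (Some (mirrorz k.+1)) / poleb k.+1 (mirrorz k.+1)
      * chain_sum k (linkb k.+1 (mirrorz k.+1)) (fun m => phi (m - ek p k.+1)).
Proof.
move=> QE; rewrite /=.
rewrite [X in chain_sum k X phi + _ + _](_ : Q = fun y => c * f y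
    + Q (Some (z k.+1)) / poleb k.+1 (z k.+1) * linkb k.+1 (z k.+1) y
    + Q (Some (mirrorz k.+1)) / poleb k.+1 (mirrorz k.+1) * linkb k.+1 (mirrorz k.+1) y); last first.
  by apply: funext => y; exact: QE.
by rewrite chain_sum_linQ /Diff !chain_sum_subphi; ring.
Qed.

(** The value at None is that of the linear functional y |-> - (b 0 + 1) / 2,
    y^2 |-> (b 0 + 1) / 2 on the quadratic in the other branch.  The same
    functional gives [link] at None, so that [ending_split] extends to None by
    linearity. *)
Definition ending0 k (y : option R) : R :=
  if y is Some y then (y + b k + z k) * (z k - y)
  else z k * (z k + b k) + (b 0%N + 1) * (b k - 1) / 2.

(** The quadratics closing a chain when the next coordinate is shifted by e:
    a shift of the next coordinate closes it by a link. *)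
Definition ending k (e : int) : option R -> R :=
  if e == 0 then ending0 k else if e == 1 then linkb k (z k) else linkb k (mirrorz k).

(** The matrix entry for an unshifted coordinate k followed by a shift e of the
    next one; its first summand is minus the leading coefficient of the
    quadratic. *)
Definition stay_coef k (e : int) : R :=
  (if e == 0 then 1 else - 1) + ending k.+1 e (Some (z k)) / poleb k (z k)
  + ending k.+1 e (Some (mirrorz k)) / poleb k (mirrorz k).

Definition regular_at k : Prop :=
  [/\ 2 * z k + b k - 1 != 0, 2 * z k + b k != 0 & 2 * z k + b k + 1 != 0].

(** Two quadratics in y with the same leading coefficient which agree at z k and
    at its mirror: at either point [ending0] and one of the two links vanish,
    and the other link equals the pole. *)
Lemma ending_split k e y : regular_at k ->
  ending k.+1 e y = stay_coef k e * ending0 k y + ending k.+1 e (Some (z k)) / poleb k (z k) * linkb k (z k) y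
     + ending k.+1 e (Some (mirrorz k)) / poleb k (mirrorz k) * linkb k (mirrorz k) y.
Proof.
case=> d1 d2 d3.
have dz : poleb k (z k) = (2 * z k + b k) * (2 * z k + b k + 1) by [].
have dm : poleb k (mirrorz k) = (2 * z k + b k) * (2 * z k + b k - 1).
  by rewrite /pole /mirror; ring.
rewrite /stay_coef dz dm /ending; case: (e == 0); last case: (e == 1);
  case: y => [y|]; rewrite /mirror /=;
  by field; do !(apply/andP; split=> //).
Qed.

Definition unit_step (e : int) : Prop := [\/ e = 0, e = 1 | e = - 1].

(** Counted from 1.  The value 0 out of range reflects that the coordinate
    following the last one is never shifted. *)
Definition coordz (m : 'rV[int]_p) k : int := crd m 0 k.-1.

(** The exponents of the shifts that occur in an operator in the first k
    variables. *)
Definition unit_box k (m : 'rV[int]_p) : Prop :=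
  forall i, (0 < i)%N -> if (i <= k)%N then unit_step (coordz m i) else coordz m i = 0.

Lemma coordzD m m' k : coordz (m + m') k = coordz m k + coordz m' k.
Proof.
rewrite /coordz; have [lt_kp|le_pk] := ltnP k.-1 p; last by rewrite !crd_ge ?addr0.
by rewrite !(crd_lt _ _ lt_kp) mxE.
Qed.

Lemma coordzN m k : coordz (- m) k = - coordz m k.
Proof.
rewrite /coordz; have [lt_kp|le_pk] := ltnP k.-1 p; last by rewrite !crd_ge ?oppr0.
by rewrite !(crd_lt _ _ lt_kp) mxE.
Qed.

Lemma coordz0 k : coordz 0 k = 0.
Proof.
rewrite /coordz; have [lt_kp|le_pk] := ltnP k.-1 p; last by rewrite !crd_ge.
by rewrite !(crd_lt _ _ lt_kp) mxE.
Qed.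

Lemma coordz_ek k i : (0 < k <= p)%N -> (0 < i)%N -> coordz (ek p k) i = (i == k)%:R.
Proof.
move=> /andP[k0 kp]; case: i => // i _; rewrite /coordz /=.
have [lt_ip|le_pi] := ltnP i p; first by rewrite (crd_lt _ _ lt_ip) mxE.
by rewrite crd_ge //; case: eqP => // ik; move: kp; rewrite -ik ltnNge le_pi.
Qed.

Lemma unit_box0 k : unit_box k 0.
Proof. by move=> i i0; rewrite coordz0; case: ifP => // _; constructor 1. Qed.

Lemma unit_box_shift k m m' c : unit_box k m -> unit_step c -> (forall i, (0 < i)%N ->
    coordz m' i = coordz m i + c * (i == k.+1)%:R) -> unit_box k.+1 m'.
Proof.
move=> sm sc mE i i0; rewrite mE //; have := sm i i0.
have [ik|ki] := leqP i k.
  by rewrite (leqW ik) (_ : (i == k.+1) = false) ?mulr0 ?addr0 //; apply/negbTE; lia.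
move=> ->; rewrite add0r; case: eqP => [->|ne]; first by rewrite leqnn mulr1.
by rewrite mulr0 (_ : (i <= k.+1)%N = false) //; apply/negbTE; lia.
Qed.

Lemma unit_box_wide k m : unit_box k m -> unit_box k.+1 m.
Proof.
move=> sm; apply: (unit_box_shift (c := 0) sm); first by constructor 1.
by move=> i _; rewrite mul0r addr0.
Qed.

Lemma eq_chain_sum k Q phi psi : (k <= p)%N -> (forall m, unit_box k m -> phi m = psi m) ->
  chain_sum k Q phi = chain_sum k Q psi.
Proof.
elim: k Q phi psi => [|k IH] Q phi psi kp e /=; first by rewrite e //; apply: unit_box0.
have e' m : unit_box k m -> phi m = psi m by move=> sm; apply/e/unit_box_wide.
have ep m : unit_box k m -> phi (m + ek p k.+1) = psi (m + ek p k.+1).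
  move=> sm; apply: e; apply: (unit_box_shift (c := 1) sm); first by constructor 2.
  by move=> i i0; rewrite coordzD coordz_ek // mul1r.
have em m : unit_box k m -> phi (m - ek p k.+1) = psi (m - ek p k.+1).
  move=> sm; apply: e; apply: (unit_box_shift (c := -1) sm); first by constructor 3.
  by move=> i i0; rewrite coordzD coordzN coordz_ek // mulN1r.
rewrite (IH Q phi psi) ?(ltnW kp) //; congr (_ + _ * _ + _ * _); apply: IH.
- exact: ltnW.
- by move=> m sm; rewrite /Diff ep // e'.
- exact: ltnW.
- by move=> m sm; rewrite /Diff em // e'.
Qed.

Section Contraction.
Variables (q : nat) (rho : nat -> int -> int -> R) (lam : nat -> int -> R).
Hypothesis le_qp : (q <= p)%N.
Hypothesis reg : forall k, (0 < k <= q)%N -> regular_at k.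
Hypothesis lam_init : forall e, unit_step e -> lam 0 e = ending 1 e None.
Hypothesis lam_step : forall k e, (0 < k <= q)%N -> unit_step e ->
  stay_coef k e * lam k.-1 0 * rho k 0 e
  + ending k.+1 e (Some (z k)) / poleb k (z k) * lam k.-1 1 * rho k 1 e
  + ending k.+1 e (Some (mirrorz k)) / poleb k (mirrorz k) * lam k.-1 (- 1) * rho k (- 1) e
  = lam k e * rho k 0 0.

(** The first k factors and the sums over the shifts of the first k coordinates
    collapse to the scalar lam k e, for each shift e of the coordinate k + 1;
    the induction needs all three values of e although only e = 0 is wanted in
    the end. *)
Lemma chain_contraction k e phi C : (k <= q)%N -> unit_step e ->
  (forall m, unit_box k m -> phi m =
     C * \prod_(1 <= i < k.+1) rho i (coordz m i) (if i == k then e else coordz m i.+1)) ->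
  chain_sum k (ending k.+1 e) phi = C * lam k e * \prod_(1 <= i < k.+1) rho i 0 0.
Proof.
elim: k e phi C => [|k IH] e phi C kq se phiE.
  by rewrite /= phiE ?big_geq // ?mulr1; [rewrite mulrC lam_init | apply: unit_box0].
have kp := leq_trans kq le_qp.
have shift c m m' : unit_box k m -> unit_step c ->
    (forall i, (0 < i)%N -> coordz m' i = coordz m i + c * (i == k.+1)%:R) ->
    phi m' = C * rho k.+1 c e *
      \prod_(1 <= i < k.+1) rho i (coordz m i) (if i == k then c else coordz m i.+1).
  move=> sm sc mE; rewrite phiE; last exact: unit_box_shift sm sc mE.
  rewrite big_nat_recr //= eqxx -mulrA; congr (_ * _); rewrite mulrC.
  have mk : coordz m k.+1 = 0 by have := sm k.+1 isT; rewrite ltnn.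
  rewrite mE // eqxx mulr1 mk add0r; congr (_ * _).
  apply: eq_big_nat => i /andP[i0 ik].
  rewrite !mE // (_ : (i == k.+1) = false); last by apply/negbTE; lia.
  rewrite mulr0 addr0 eqSS; case: eqP => [->|_]; first by rewrite mk mulr1 add0r.
  by rewrite mulr0 addr0.
rewrite (chain_sum_step phi (fun y => ending_split e y (reg _))) //.
have U0 : chain_sum k (ending0 k.+1) phi = C * rho k.+1 0 e * lam k 0 * \prod_(1 <= i < k.+1) rho i 0 0.
  apply: (IH 0); rewrite ?(ltnW kq) //; first by constructor 1.
  move=> m sm; apply: shift sm _ _ => //; first by constructor 1.
  by move=> i _; rewrite mul0r addr0.
have U1 : chain_sum k (linkb k.+1 (z k.+1)) (fun m => phi (m + ek p k.+1)) =
    C * rho k.+1 1 e * lam k 1 * \prod_(1 <= i < k.+1) rho i 0 0.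
  apply: (IH 1); rewrite ?(ltnW kq) //; first by constructor 2.
  move=> m sm; apply: shift sm _ _ => //; first by constructor 2.
  by move=> i i0; rewrite coordzD coordz_ek // mul1r.
have U2 : chain_sum k (linkb k.+1 (mirrorz k.+1)) (fun m => phi (m - ek p k.+1)) =
    C * rho k.+1 (- 1) e * lam k (- 1) * \prod_(1 <= i < k.+1) rho i 0 0.
  apply: (IH (- 1)); rewrite ?(ltnW kq) //; first by constructor 3.
  move=> m sm; apply: shift sm _ _ => //; first by constructor 3.
  by move=> i i0; rewrite coordzD coordzN coordz_ek // mulN1r.
rewrite U0 U1 U2 [in RHS]big_nat_recr //=.
have -> : C * lam k.+1 e * (\prod_(1 <= i < k.+1) rho i 0 0 * rho k.+1 0 0) =
  C * (lam k.+1 e * rho k.+1 0 0) * \prod_(1 <= i < k.+1) rho i 0 0 by ring.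
by rewrite -lam_step //=; ring.
Qed.

End Contraction.

End ChainContraction.
(** * The equation in x *)

Section SpectralX.
Variable R : realType.

Lemma racah_F4 n (a b g d x : R) :
  racah n a b g d x = F4 n (a + 1) (b + d + 1) (g + 1) (- x) (x + g + d + 1).
Proof.
apply: eq_bigr => i _; rewrite /F4head /F4tail.
have -> : n%:R + (a + 1) + (b + d + 1) + (g + 1) - - x - (x + g + d + 1) - 1
    = n%:R + a + b + 1 by ring.
by ring.
Qed.

(** The k-th factor of R_p, for S = n_1 + ... + n_{k-1}, X = x_k, M = x_{k+1}. *)
Definition racah_factor n (b0 b1 b2 S X M : R) : R :=
  F4 n (2 * S + b1 - b0) (b2 + S + M) (S - M) (S - X) (S + b1 + X).

Lemma racah_factorE n (b0 b1 b2 S X M : R) :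
  racah n (2 * S + b1 - b0 - 1) (b2 - b1 - 1) (S - M - 1) (S + b1 + M) (- S + X)
  = racah_factor n b0 b1 b2 S X M.
Proof.
rewrite racah_F4 /racah_factor.
have -> : 2 * S + b1 - b0 - 1 + 1 = 2 * S + b1 - b0 by ring.
have -> : b2 - b1 - 1 + (S + b1 + M) + 1 = b2 + S + M by ring.
have -> : S - M - 1 + 1 = S - M by ring.
have -> : - (- S + X) = S - X by ring.
by have -> : - S + X + (S - M - 1) + (S + b1 + M) + 1 = S + b1 + X by ring.
Qed.

(** The values on the three quadratics [ending] of the linear functional on
    quadratics that has taken the place of the empty chain once factors of
    total degree S have been contracted; S = 0 is the empty chain itself. *)
Definition chain_eig (b0 S B M : R) (e : int) : R :=
  if e == 0 then M * (M + B) + (b0 + 1) * (B - 1) / 2 - S * (S - 1 + B - b0)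
  else if e == 1 then (M + B + S) * (M + B + S - b0)
  else (S - M) * (S - M - b0).

(** The hypothesis of [chain_contraction] for the factors of R_p. *)
Lemma racah_factor_step (z b : nat -> R) k n S (e : int) : unit_step e -> regular_at z b k ->
  stay_coef z b k e * chain_eig (b 0%N) S (b k) (z k) 0
    * racah_factor n (b 0%N) (b k) (b k.+1) S (z k) (z k.+1 + e%:~R)
  + ending z b k.+1 e (Some (z k)) / pole b k (z k) * chain_eig (b 0%N) S (b k) (z k) 1
    * racah_factor n (b 0%N) (b k) (b k.+1) S (z k + 1) (z k.+1 + e%:~R)
  + ending z b k.+1 e (Some (mirror z b k)) / pole b k (mirror z b k)
    * chain_eig (b 0%N) S (b k) (z k) (- 1)
    * racah_factor n (b 0%N) (b k) (b k.+1) S (z k - 1) (z k.+1 + e%:~R)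
  = chain_eig (b 0%N) (S + n%:R) (b k.+1) (z k.+1) e
    * racah_factor n (b 0%N) (b k) (b k.+1) S (z k) (z k.+1).
Proof.
move=> se [d1 d2 d3]; rewrite /stay_coef /ending /ending0 /link /pole /mirror.
move: (z k) (z k.+1) (b 0%N) (b k) (b k.+1) d1 d2 d3 => X M b0 B B' d1 d2 d3.
pose u := 2 * S + B - b0; pose v := B' + S + M; pose w := S - M.
pose a := S - X; pose c := S + B + X.
have h1 : c - a != 0 by rewrite (_ : c - a = 2 * X + B) // /c /a; ring.
have h2 : c - a + 1 != 0 by rewrite (_ : c - a = 2 * X + B) // /c /a; ring.
have h3 : c - a - 1 != 0 by rewrite (_ : c - a = 2 * X + B) // /c /a; ring.
have E x m v' w' a' c' : B' + S + m = v' -> S - m = w' -> S - x = a' ->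
    S + B + x = c' -> racah_factor n b0 B B' S x m = F4 n u v' w' a' c'.
  by rewrite /racah_factor => -> -> -> ->.
pose D := 2 * X + B.
have BE : B = D - 2 * X by rewrite /D; ring.
have e1 : 2 * X + B = D by [].
have e2 : 2 * (- X - B) + B = - D by rewrite /D; ring.
have e3 : S + B + X - (S - X) = D by rewrite /D; ring.
have e4 : S - X - (S + B + X) = - D by rewrite /D; ring.
have D1 : D != 0 by []. have D2 : D + 1 != 0 by [].
have D3 : - D + 1 != 0 by rewrite -oppr_eq0 opprD opprK.
have D4 : - D != 0 by rewrite oppr_eq0.
have fin : [/\ chain_eig b0 S B X 0 = chain_eig0 (a + c - u) a c 0,
    chain_eig b0 S B X 1 = c * (u - a) & chain_eig b0 S B X (- 1) = a * (u - c)].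
  by rewrite /chain_eig /chain_eig0 /= /a /c /u; split; field.
case: fin => -> -> ->.
case: se => -> /=.
- have H := F4_xdiff n u v w h1 h2 h3.
  rewrite (E X _ v w a c) ?(E (X + 1) _ v w (a - 1) (c + 1))
    ?(E (X - 1) _ v w (a + 1) (c - 1)) ?(E X M v w a c);
    do ?by rewrite /v /w /a /c ?addr0; ring.
  have -> : chain_eig b0 (S + n%:R) B' M 0 = chain_eig0 (a + c - u) v w n.
    by rewrite /chain_eig /chain_eig0 /= /a /c /u /v /w; field.
  rewrite -H; clear -BE e1 e2 e3 e4 D1 D2 D3 D4.
  congr (_ * _ * _ + _ * _ * _ + _ * _ * _);
    rewrite /a /c /v /w ?e1 ?e2 ?e3 ?e4 ?BE; move: D D1 D2 D3 D4 {BE e1 e2 e3 e4};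
    move=> D D1 D2 D3 D4; field; do !(apply/andP; split=> //).
- have H := F4_xdiff_up n u v w h1 h2 h3.
  rewrite (E X _ (v + 1) (w - 1) a c) ?(E (X + 1) _ (v + 1) (w - 1) (a - 1) (c + 1))
    ?(E (X - 1) _ (v + 1) (w - 1) (a + 1) (c - 1)) ?(E X M v w a c);
    do ?by rewrite /v /w /a /c ?addr0; ring.
  have -> : chain_eig b0 (S + n%:R) B' M 1 = (v + n%:R) * (v + n%:R - (a + c - u)).
    by rewrite /chain_eig /= /a /c /u /v /w; field.
  rewrite -H; clear -BE e1 e2 e3 e4 D1 D2 D3 D4.
  congr (_ * _ * _ + _ * _ * _ + _ * _ * _);
    rewrite /a /c /v /w ?e1 ?e2 ?e3 ?e4 ?BE; move: D D1 D2 D3 D4 {BE e1 e2 e3 e4};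
    move=> D D1 D2 D3 D4; field; do !(apply/andP; split=> //).
- have H := F4_xdiff_down n u v w h1 h2 h3.
  rewrite (E X _ (v - 1) (w + 1) a c) ?(E (X + 1) _ (v - 1) (w + 1) (a - 1) (c + 1))
    ?(E (X - 1) _ (v - 1) (w + 1) (a + 1) (c - 1)) ?(E X M v w a c);
    do ?by rewrite /v /w /a /c ?addr0; ring.
  have -> : chain_eig b0 (S + n%:R) B' M (-1) = (w + n%:R) * (w + n%:R - (a + c - u)).
    by rewrite /chain_eig /= /a /c /u /v /w; field.
  rewrite -H; clear -BE e1 e2 e3 e4 D1 D2 D3 D4.
  congr (_ * _ * _ + _ * _ * _ + _ * _ * _);
    rewrite /a /c /v /w ?e1 ?e2 ?e3 ?e4 ?BE; move: D D1 D2 D3 D4 {BE e1 e2 e3 e4};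
    move=> D D1 D2 D3 D4; field; do !(apply/andP; split=> //).
Qed.
End SpectralX.
Section FirstEquation.
Variables (R : realType) (p : nat).

Lemma chain_sum_None (z b : nat -> R) k c (phi : 'rV[int]_p -> R) :
  chain_sum z b k (fun y => if y is None then c else 0) phi = c * phi 0.
Proof. by elim: k phi => //= k IH phi; rewrite IH !mul0r !addr0. Qed.

(** The subtracted value of [ending0] accounts for nu = 0, which the operator
    leaves out. *)
Lemma chain_sum_spectral (z b : nat -> R) q rho lam (phi : 'rV[int]_p -> R) C :
  (q <= p)%N ->
  (forall k, (0 < k <= q)%N -> regular_at z b k) ->
  (forall e, unit_step e -> lam 0 e = ending z b 1 e None) ->
  (forall k e, (0 < k <= q)%N -> unit_step e ->
    stay_coef z b k e * lam k.-1 0 * rho k 0 e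
    + ending z b k.+1 e (Some (z k)) / pole b k (z k) * lam k.-1 1 * rho k 1 e
    + ending z b k.+1 e (Some (mirror z b k)) / pole b k (mirror z b k) * lam k.-1 (- 1) * rho k (- 1) e
    = lam k e * rho k 0 0) ->
  (forall m, unit_box q m -> phi m =
     C * \prod_(1 <= i < q.+1) rho i (coordz m i) (coordz m i.+1)) ->
  chain_sum z b q (fun y => if y is Some y then (y + b q.+1 + z q.+1) * (z q.+1 - y) else 0) phi
  = (lam q 0 - ending0 z b q.+1 None) * phi 0.
Proof.
move=> qp reg lam_init lam_step phiE.
pose Q3 (y : option R) : R := if y is None then ending0 z b q.+1 None else 0.
rewrite (_ : (fun y => _) = fun y => 1 * ending0 z b q.+1 y + (- 1) * Q3 y + 0 * Q3 y).
  rewrite chain_sum_linQ chain_sum_None mul0r addr0 mul1r.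
  rewrite (@chain_contraction _ _ z b q rho lam qp reg lam_init lam_step q 0 phi C) //.
  - have -> : phi 0 = C * \prod_(1 <= i < q.+1) rho i 0 0.
      by rewrite phiE; [|exact: unit_box0]; under eq_bigr do rewrite !coordz0.
    by ring.
  - by constructor 1.
  move=> m sm; rewrite phiE //; congr (_ * _); apply: eq_big_nat => i /andP[i0 iq].
  by case: eqP => // ->; have := sm q.+1 isT; rewrite ltnn => ->.
by apply: funext => -[y|]; rewrite /Q3 /ending0; ring.
Qed.

Lemma xc_shift (x : 'rV[R]_p) (m : 'rV[int]_p) N k :
  xc (x + map_mx intr m) N k = xc x N k + (coordz m k)%:~R.
Proof.
rewrite /xc /coordz; have [lt_kp|le_pk] := ltnP k.-1 p; last by rewrite !crd_ge ?addr0.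
by rewrite !(crd_lt _ _ lt_kp) !mxE.
Qed.

Lemma psumS (n : 'rV[nat]_p) k : psum n k.+1 = (psum n k + nc n k.+1)%N.
Proof. by rewrite /psum big_nat_recr. Qed.

Lemma psum0 (n : 'rV[nat]_p) : psum n 0 = 0%N.
Proof. by rewrite /psum big_geq. Qed.

Lemma RpolE (n : 'rV[nat]_p) (x : 'rV[R]_p) (b : 'rV[R]_p.+2) (N : R) :
  Rpol n x b N = \prod_(1 <= k < p.+1)
    racah_factor (nc n k) (bc b 0) (bc b k) (bc b k.+1) (psum n k.-1)%:R
      (xc x N k) (xc x N k.+1).
Proof.
apply: eq_bigr => k _; exact: racah_factorE.
Qed.

(** The factors beyond the j-th do not involve x_1, ..., x_j and join the
    constant. *)
Lemma first_equation (b : 'rV[R]_p.+2) N (n : 'rV[nat]_p) j x : (0 < j <= p)%N ->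
  Lx_regular j (Pt x b N) ->
  dact (Lx R p j) (fun y => Rhat n y b N) b N x = mu j n b * Rhat n x b N.
Proof.
move=> jp reg; have [j0 lejp] := andP jp.
rewrite dactE pairing_Lx //=.
pose rho k (h e : int) := racah_factor (nc n k) (bc b 0) (bc b k) (bc b k.+1)
  (psum n k.-1)%:R (xc x N k + h%:~R) (xc x N k.+1 + e%:~R).
pose lam k (e : int) := chain_eig (bc b 0) (psum n k)%:R (bc b k.+1) (xc x N k.+1) e.
rewrite (@chain_sum_spectral (xc x N) (bc b) j rho lam _
  (\prod_(j.+1 <= k < p.+1) rho k 0 0 / (poch (- N) (nsum n) * Rden n b N))) //.
- have -> : map_mx intr (0 : 'rV[int]_p) = 0 :> 'rV[R]_p.
    by apply/rowP => i; rewrite !mxE.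
  rewrite addr0; congr (_ * _); rewrite /lam /chain_eig /mu /=.
  by ring.
- move=> e se; rewrite /lam psum0 /chain_eig /ending /ending0 /link /mirror.
  by case: se => -> /=; ring.
- move=> k e /andP[]; case: k => // k _ kj se.
  have := @racah_factor_step R (xc x N) (bc b) k.+1 (nc n k.+1) (psum n k)%:R e se.
  rewrite -natrD -psumS => H.
  rewrite /rho /lam /= addr0 mulr0z addr0 H //.
  by apply: reg; rewrite kj.
move=> m sm; rewrite /Rhat RpolE mulrAC; congr (_ / _).
rewrite (big_cat_nat (n := j.+1)) //= mulrC; congr (_ * _); apply: eq_big_nat => k /andP[k0 kj].
  rewrite /rho !xc_shift.
  have := sm k.+1 isT; rewrite ltnNge (ltnW k0) /= => ->.
  have := sm k (leq_trans (ltn0Sn j) k0).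
  by rewrite [(k <= j)%N]leqNgt k0 /= => ->.
by rewrite /rho !xc_shift.
Qed.

End FirstEquation.
(** * The dual equation for generic parameters *)

Section DualStep.
Variable R : realType.

(** The degree becomes negative when a shift leaves the range of indices; the
    factor is then 0, like the terms with a negative index. *)
Definition dual_factor (n : int) (b0 b1 b2 S X M : R) : R :=
  if n is Posz k then racah_factor k b0 b1 b2 S X M / poch (b2 - b1) k else 0.

Arguments dual_factor : simpl never.

Lemma dual_factor_pred n b0 b1 b2 S X M : nonint (b2 - b1) ->
  n%:R * dual_factor (n%:Z - 1) b0 b1 b2 S X M =
  n%:R * ((b2 - b1 + n%:R - 1) * racah_factor n.-1 b0 b1 b2 S X M / poch (b2 - b1) n).
Proof.
move=> hk; case: n => [|m]; first by rewrite !mul0r.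
rewrite (_ : m.+1%:Z - 1 = m); last by rewrite -addn1 PoszD addrK.
rewrite /dual_factor pochS -(natr1 m) addrA addrK /=.
have k1 := poch_nonint m hk.
have k2 : b2 - b1 + m%:R != 0.
  by apply: (nonint_nz hk) (erefl _); rewrite natr_int.
by field; do !(apply/andP; split=> //).
Qed.

Lemma dual_factor_pred2 n b0 b1 b2 S X M : nonint (b2 - b1) ->
  n%:R * (n%:R - 1) * dual_factor (n%:Z - 1 - 1) b0 b1 b2 S X M =
  n%:R * (n%:R - 1) * ((b2 - b1 + n%:R - 1) * (b2 - b1 + n%:R - 2)
    * racah_factor n.-2 b0 b1 b2 S X M / poch (b2 - b1) n).
Proof.
move=> hk; case: n => [|[|m]]; rewrite ?subrr ?mulr0 ?mul0r //.
rewrite (_ : m.+2%:Z - 1 - 1 = m); last by rewrite -addn2 PoszD; ring.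
have k1 := poch_nonint m hk.
have kz (i : nat) : b2 - b1 + i%:R != 0.
  by apply: (nonint_nz hk) (erefl _); rewrite natr_int.
have k2 := kz m; have k3 := kz m.+1.
rewrite /dual_factor !pochS -(natr1 m.+1) -(natr1 m) /=; rewrite -(natr1 m) in k3.
by field; do !(apply/andP; split=> //).
Qed.

(** [chain_eig] for S = N - x, up to a change of normalisation.  The weights
    (-x_k)_s (-x_k - beta_0)_s / ((-x_{k+1})_t (-x_{k+1} - beta_0)_t) with
    s = n_1 + ... + n_{k-1} and t = s + n_k telescope over k to the factor
    1 / ((-N)_{|n|} (-N - beta_0)_{|n|}) of R-hat.  Leaving them out of the
    single factors removes poles in x, and moves their quotients from the
    shift 1 to the shift -1. *)
Definition dual_eig (b0 s B M x N : R) (e : int) : R :=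
  if e == 1 then 1
  else if e == 0 then chain_eig b0 (N - x) B M 0
  else (s - 1 - x) * (s - 1 - x - b0) * chain_eig b0 (N - x) B M (- 1).

(** The hypothesis of [chain_contraction] for the chain that runs through the
    partial sums: t = n_1 + ... + n_k is the coordinate of the position and
    s = n_1 + ... + n_{k-1} that of the next one, B = beta_k, C = beta_{k+1},
    x = x_k and y = x_{k+1}. *)
Lemma dual_step (z b : nat -> R) k n (e : int) (b0 B C x y N s : R)
    (t := s + n%:R) :
  unit_step e -> b 0%N = b0 ->
  z k = t + C - b0 + N - 1 -> b k = b0 - C - 2 * N + 1 ->
  z k.+1 = s + B - b0 + N - 1 -> b k.+1 = b0 - B - 2 * N + 1 ->
  nonint (B - b0 + 2 * s) -> nonint (C + y + s) -> nonint (s - y) ->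
  nonint (C - b0 + 2 * s) -> nonint (C - B) ->
  stay_coef z b k e * dual_eig b0 t (b k) (z k) y N 0
    * dual_factor (n%:Z - e) b0 B C (s + e%:~R) x y
  + ending z b k.+1 e (Some (z k)) / pole b k (z k) * dual_eig b0 t (b k) (z k) y N 1
    * dual_factor (n%:Z + 1 - e) b0 B C (s + e%:~R) x y
  + ending z b k.+1 e (Some (mirror z b k)) / pole b k (mirror z b k)
    * dual_eig b0 t (b k) (z k) y N (- 1)
    * dual_factor (n%:Z - 1 - e) b0 B C (s + e%:~R) x y
  = dual_eig b0 s (b k.+1) (z k.+1) x N e * dual_factor n b0 B C s x y.
Proof.
move=> se; rewrite /stay_coef /ending /ending0 /link /pole /mirror => -> -> -> -> -> hu hv hw hz hk.
(* D is 2 z k + b k, from which all the denominators are made. *)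
pose u := 2 * s + B - b0; pose v := C + s + y; pose w := s - y.
pose a := s - x; pose c := s + B + x; pose D := 2 * t + C - b0 - 1.
have zE : a + c - u = b0 by rewrite /a /c /u; ring.
have hu' : nonint u by rewrite (_ : u = B - b0 + 2 * s) // /u; ring.
have hv' : nonint v by rewrite (_ : v = C + y + s) // /v; ring.
have hz' : nonint (v + w - (a + c - u)).
  by rewrite (_ : _ - _ = C - b0 + 2 * s) // zE /v /w; ring.
have hk' : nonint (v + w - a - c).
  by rewrite (_ : _ - _ - _ = C - B) // /v /w /a /c; ring.
have e1 : 2 * (t + C - b0 + N - 1) + (b0 - C - 2 * N + 1) = D by rewrite /D; ring.
have e2 : 2 * (- (t + C - b0 + N - 1) - (b0 - C - 2 * N + 1))
    + (b0 - C - 2 * N + 1) = - D by rewrite /D; ring.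
rewrite e1 e2.
have DE : n%:R + v + w - b0 - 1 + n%:R = D.
  by rewrite /v /w /D /t; ring.
have D0 c' : c' \is a Num.int -> D + c' != 0.
  move=> ci; apply: (nonint_nz hz (c := n%:R + n%:R - 1 + c')).
    by rewrite rpredD // rpredB ?rpred1 // rpredD ?natr_int.
  by rewrite /D /t; ring.
have D1 := D0 1 (rpred1 _); have D2 := D0 (-1) (rpredN1 _).
have D3 : D != 0 by have := D0 0 (rpred0 _); rewrite addr0.
have D4 : - D != 0 by rewrite oppr_eq0.
have D5 : - D + 1 != 0 by rewrite -oppr_eq0 opprD opprK.
have pk := poch_nonint n hk.
have kn : C - B + n%:R != 0.
  by apply: (nonint_nz hk) (erefl _); rewrite natr_int.
have kE : v + w - a - c = C - B by rewrite /v /w /a /c; ring.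
have kn' : v + w - a - c + n%:R != 0 by rewrite kE.
have l0 : dual_eig b0 t (b0 - C - 2 * N + 1) (t + C - b0 + N - 1) y N 0
    = dual_eig0 b0 v w n%:R.
  by rewrite /dual_eig /chain_eig /= /dual_eig0 /v /w /t; field.
have l1 : dual_eig b0 t (b0 - C - 2 * N + 1) (t + C - b0 + N - 1) y N 1 = 1 by [].
have l2 : dual_eig b0 t (b0 - C - 2 * N + 1) (t + C - b0 + N - 1) y N (- 1)
    = dual_eigN1 b0 v w n%:R.
  by rewrite /dual_eig /chain_eig /= /dual_eigN1 /v /w /t; field.
rewrite l0 l1 l2.
have rF m x' q e' : x' = s + e' -> q = (racah_factor m b0 B C x' x y) ->
    q = F4 m (u + e' *+ 2) (v + e') (w + e') (a + e') (c + e').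
  move=> -> ->; rewrite /racah_factor.
  have -> : 2 * (s + e') + B - b0 = u + e' *+ 2 by rewrite /u; ring.
  have -> : C + (s + e') + y = v + e' by rewrite /v; ring.
  have -> : s + e' - y = w + e' by rewrite /w; ring.
  have -> : s + e' - x = a + e' by rewrite /a; ring.
  by have -> : s + e' + B + x = c + e' by rewrite /c; ring.
pose P := poch (C - B) n; rewrite -/P in pk.
have CE : C = D + 1 + b0 - 2 * (s + n%:R) by rewrite /D /t; ring.
case: se => ->.
- have H := F4_ndiff n hu' hv' hw hz'.
  rewrite zE kE DE in H.
  have rE m : racah_factor m b0 B C (s + 0%:~R) x y = F4 m u v w a c.
    by rewrite (rF m _ _ 0 (erefl _) (erefl _)) mul0rn !addr0.
  have rE' : racah_factor n b0 B C s x y = F4 n u v w a c by rewrite -rE addr0.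
  have r0 : dual_factor (n%:Z - 0) b0 B C (s + 0%:~R) x y = F4 n u v w a c / P.
    by rewrite subr0 /dual_factor rE.
  have r1 : dual_factor (n%:Z + 1 - 0) b0 B C (s + 0%:~R) x y
      = F4 n.+1 u v w a c / (P * (C - B + n%:R)).
    by rewrite subr0 -PoszD addn1 /dual_factor rE pochS.
  have rm : n%:R * dual_factor (n%:Z - 1 - 0) b0 B C (s + 0%:~R) x y
      = n%:R * ((C - B + n%:R - 1) * F4 n.-1 u v w a c / P).
    by rewrite subr0 dual_factor_pred // rE.
  rewrite r0 r1 [in RHS]/dual_factor rE' -/P.
  have -> : dual_eig b0 s (b0 - B - 2 * N + 1) (s + B - b0 + N - 1) x N 0 = dual_eig0 b0 a c 0.
    by rewrite /dual_eig /chain_eig /= /dual_eig0 /a /c; field.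
  rewrite [RHS]mulrA -H.
  rewrite (_ : _ * dual_factor (n%:Z - 1 - 0) b0 B C (s + 0%:~R) x y =
    - (n%:R + u - 1) / (D * (D - 1)) * dual_eigN1 b0 v w n%:R *
     (n%:R * dual_factor (n%:Z - 1 - 0) b0 B C (s + 0%:~R) x y)); last first.
    move: (dual_factor (n%:Z - 1 - 0) _ _ _ _ _ _) (dual_eigN1 _ _ _ _) => f1 f2 /=.
    rewrite /u /t; move: D1 D2 D3 D4 D5 {e1 e2 DE D0 H CE}; move: (D) => D'.
    by move=> *; field; do !(apply/andP; split=> //).
  rewrite rm.
  move: (F4 n.-1 _ _ _ _ _) (F4 n.+1 _ _ _ _ _) (F4 n _ _ _ _ _) => f1 f2 f3.
  move: (dual_eig0 b0 v w _) (dual_eigN1 b0 v w _) (P) pk => f4 f5 P' pk' /=.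
  rewrite /u /v /w /t; rewrite CE in kn *.
  move: D1 D2 D3 D4 D5 kn {e1 e2 DE D0 H CE}; move: (D) => D' *.
  by field; do !(apply/andP; split=> //).
- have H := F4_ndiff_up n hu' hv' hw hz'.
  rewrite zE kE DE in H.
  have rE m : racah_factor m b0 B C (s + 1%:~R) x y = F4 m (u + 2) (v + 1) (w + 1) (a + 1) (c + 1).
    by rewrite (rF m _ _ 1 (erefl _) (erefl _)).
  have rE' : racah_factor n b0 B C s x y = F4 n u v w a c.
    by rewrite (rF n s _ 0 _ (erefl _)) ?mul0rn !addr0.
  have r1 : dual_factor (n%:Z + 1 - 1) b0 B C (s + 1%:~R) x y
      = F4 n (u + 2) (v + 1) (w + 1) (a + 1) (c + 1) / P.
    by rewrite addrK /dual_factor rE.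
  have rm := dual_factor_pred n b0 (s + 1%:~R) x y hk.
  have rm2 := dual_factor_pred2 n b0 (s + 1%:~R) x y hk.
  rewrite !rE in rm rm2.
  rewrite r1 [in RHS]/dual_factor rE' -/P.
  rewrite (_ : dual_eig b0 s (b0 - B - 2 * N + 1) (s + B - b0 + N - 1) x N 1 = 1) // mul1r -H.
  rewrite (_ : _ * dual_factor (n%:Z - 1) b0 B C (s + 1%:~R) x y =
    ((n%:R - 1 - 2 * D) / (D * (D + 1)) + (n%:R - 1) / (D * (D - 1)))
    * dual_eig0 b0 v w n%:R * (n%:R * dual_factor (n%:Z - 1) b0 B C (s + 1%:~R) x y)); last first.
    move: (dual_factor (n%:Z - 1) _ _ _ _ _ _) (dual_eig0 _ _ _ _) => f1 f2 /=.
    rewrite /t CE; move: D1 D2 D3 D4 D5 {e1 e2 DE D0 H CE rm rm2}; move: (D) => D'.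
    by move=> *; field; do !(apply/andP; split=> //).
  rewrite rm.
  rewrite (_ : _ * dual_factor (n%:Z - 1 - 1) b0 B C (s + 1%:~R) x y =
    (D * (D - 1))^-1 * dual_eigN1 b0 v w n%:R
    * (n%:R * (n%:R - 1) * dual_factor (n%:Z - 1 - 1) b0 B C (s + 1%:~R) x y)); last first.
    move: (dual_factor (n%:Z - 1 - 1) _ _ _ _ _ _) (dual_eigN1 _ _ _ _) => f1 f2 /=.
    rewrite /t; move: D1 D2 D3 D4 D5 {e1 e2 DE D0 H CE rm rm2}; move: (D) => D'.
    by move=> *; field; do !(apply/andP; split=> //).
  rewrite rm2 -/P {H rm rm2 r1 rE}.
  move: (F4 n.-1 _ _ _ _ _) (F4 n.-2 _ _ _ _ _) (F4 n _ _ _ _ _) => f1 f2 f3.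
  move: (dual_eig0 b0 v w _) (dual_eigN1 b0 v w _) (P) pk => f4 f5 P' pk' /=.
  rewrite /u /v /w /t; rewrite CE in kn *.
  move: D1 D2 D3 D4 D5 kn {e1 e2 DE D0 CE}; move: (D) => D' *.
  by field; do !(apply/andP; split=> //).
- have H := F4_ndiff_down hu' hv' hw hz' kn'.
  rewrite zE kE DE in H.
  have kn1 : C - B + n.+1%:R != 0.
    by apply: (nonint_nz hk) (erefl _); rewrite natr_int.
  rewrite -(natr1 n) in kn1.
  have rE m : racah_factor m b0 B C (s + (- 1)%:~R) x y = F4 m (u - 2) (v - 1) (w - 1) (a - 1) (c - 1).
    by rewrite (rF m _ _ (- 1) (erefl _) (erefl _)) mulNrn.
  have rE' : racah_factor n b0 B C s x y = F4 n u v w a c.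
    by rewrite (rF n s _ 0 _ (erefl _)) ?mul0rn !addr0.
  have r0 : dual_factor (n%:Z - - 1) b0 B C (s + (- 1)%:~R) x y
      = F4 n.+1 (u - 2) (v - 1) (w - 1) (a - 1) (c - 1) / (P * (C - B + n%:R)).
    by rewrite opprK -PoszD addn1 /dual_factor rE pochS.
  have r1 : dual_factor (n%:Z + 1 - - 1) b0 B C (s + (- 1)%:~R) x y
      = F4 n.+2 (u - 2) (v - 1) (w - 1) (a - 1) (c - 1)
        / (P * (C - B + n%:R) * (C - B + (n%:R + 1))).
    by rewrite opprK -!PoszD !addn1 /dual_factor rE !pochS natr1.
  have rm : dual_factor (n%:Z - 1 - - 1) b0 B C (s + (- 1)%:~R) x y
      = F4 n (u - 2) (v - 1) (w - 1) (a - 1) (c - 1) / P.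
    by rewrite opprK subrK /dual_factor rE.
  rewrite r0 r1 rm [in RHS]/dual_factor rE' -/P.
  have -> : dual_eig b0 s (b0 - B - 2 * N + 1) (s + B - b0 + N - 1) x N (- 1)
     = (a - 1) * (a - 1 - b0) * (c - b0 - 1) * (c - 1).
    by rewrite /dual_eig /chain_eig /= /a /c; ring.
  rewrite [RHS]mulrA -H {H rm r0 r1 rE}.
  move: (F4 n.+1 _ _ _ _ _) (F4 n.+2 _ _ _ _ _) (F4 n _ _ _ _ _) => f1 f2 f3.
  move: (dual_eig0 b0 v w _) (dual_eigN1 b0 v w _) (P) pk => f4 f5 P' pk' /=.
  rewrite /u /v /w /t; rewrite CE in kn kn1 *.
  move: D1 D2 D3 D4 D5 kn kn1 {e1 e2 DE D0 CE}; move: (D) => D' *.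
  by field; do !(apply/andP; split=> //).
Qed.
End DualStep.
Section DualChain.
Variables (R : realType) (p : nat).

Lemma eq_chain_sum_params (z z' b b' : nat -> R) k Q (phi : 'rV[int]_p -> R) :
  b 0%N = b' 0%N ->
  (forall i, (0 < i <= k)%N -> z i = z' i /\ b i = b' i) ->
  chain_sum z b k Q phi = chain_sum z' b' k Q phi.
Proof.
move=> b0; elim: k Q phi => //= k IH Q phi e.
have [ez eb] : z k.+1 = z' k.+1 /\ b k.+1 = b' k.+1 by apply: e; rewrite leqnn.
have IH' Q' (phi' : 'rV[int]_p -> R) : chain_sum z b k Q' phi' = chain_sum z' b' k Q' phi'.
  by apply: IH => i /andP[i0 ik]; apply: e; rewrite i0 leqW.
have em : mirror z b k.+1 = mirror z' b' k.+1 by rewrite /mirror ez eb.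
have eH w : link b k.+1 w = link b' k.+1 w by apply: funext => -[y|]; rewrite /link eb ?b0.
by rewrite !IH' em !eH ez /pole eb.
Qed.

Section Point.
Variables (n : 'rV[nat]_p) (b : 'rV[R]_p.+2) (N : R).

(** The values of b(x_k) and b(beta_k) at (n, beta, N).  At k = p + 1 the
    formula for [dual_x] gives the mirror image of b(x_{p+1}) = N; the closing
    quadratic is the same for both, and the formula fits [dual_step]. *)
Definition dual_x (k : nat) : R :=
  (psum n (p.+1 - k))%:R + bc b (p.+2 - k) - bc b 0 + N - 1.
Definition dual_b (k : nat) : R :=
  if k == 0%N then bc b 0 else bc b 0 - bc b (p.+2 - k) - 2 * N + 1.

Lemma xc_nreal k : xc (nreal R n) 0 k = (nc n k)%:R.
Proof.
rewrite /xc /nc; have [lt_kp|le_pk] := ltnP k.-1 p; last by rewrite !crd_ge.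
by rewrite !(crd_lt _ _ lt_kp) mxE.
Qed.

Lemma ptx_bpoint k : (0 < k <= p)%N ->
  xc (ptx (bpoint (Pt (nreal R n) b N))) N k = dual_x k.
Proof.
case: k => // k lt_kp; rewrite /= xc_row /= /dual_x; congr (_ + _ - _ + _ - _).
by rewrite /psum natr_sum; apply: eq_bigr => l _; rewrite xc_nreal.
Qed.

Lemma ptb_bpoint k : (k <= p.+1)%N ->
  bc (ptb (bpoint (Pt (nreal R n) b N))) k = dual_b k.
Proof. by rewrite -ltnS => lt_k; rewrite /= bc_row. Qed.

Lemma mirror_dual_x_last : - dual_x p.+1 - dual_b p.+1 = N.
Proof.
rewrite /dual_x /dual_b subnn psum0 /= (_ : p.+2 - p.+1 = 1)%N; first by ring.
by rewrite subSnn.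
Qed.

Lemma pairing_Ln j psi : (0 < j <= p)%N ->
  pairing (Ln R p j) psi (Pt (nreal R n) b N) =
  chain_sum dual_x dual_b j (fun y => if y is Some y then (y + dual_b j.+1 + dual_x j.+1) * (dual_x j.+1 - y) else 0)
    (fun m => psi (bshift m)).
Proof.
move=> jp; have [j0 lejp] := andP jp.
rewrite /Ln pairing_bdual pairing_Lx //=.
rewrite (@eq_chain_sum_params _ dual_x _ dual_b); first last.
- move=> i /andP[i0 ij]; have ip := leq_trans ij lejp.
  by split; [rewrite ptx_bpoint ?i0 | rewrite ptb_bpoint // leqW].
- by rewrite ptb_bpoint.
congr chain_sum; apply: funext => -[y|] //; rewrite ptb_bpoint //.
have [lt_jp|] := ltnP j p; first by rewrite ptx_bpoint.
move=> le_pj; have {le_pj}-> : j = p by apply/eqP; rewrite eqn_leq lejp.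
rewrite xc_gt //; have := mirror_dual_x_last; move: (dual_x p.+1) (dual_b p.+1) => Z B <-.
by ring.
Qed.

Lemma regular_bpoint j : (j <= p)%N ->
  Lx_regular j (bpoint (Pt (nreal R n) b N)) <->
  (forall k, (0 < k <= j)%N -> regular_at dual_x dual_b k).
Proof.
move=> le_jp; split=> reg k kj; have := reg k kj;
  have [k0 le_kj] := andP kj; have kp := leq_trans le_kj le_jp;
  by rewrite /regular_at /= ptx_bpoint ?k0 // ptb_bpoint // leqW.
Qed.

End Point.

Lemma coordz_sum (I : Type) (r : seq I) (F : I -> 'rV[int]_p) k :
  coordz (\sum_(i <- r) F i) k = \sum_(i <- r) coordz (F i) k.
Proof. by elim/big_rec2: _ => [|i x y _ <-]; [exact: coordz0 | exact: coordzD]. Qed.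

Lemma coordzMz (m : 'rV[int]_p) (c : int) k : coordz (m *~ c) k = coordz m k * c.
Proof.
rewrite /coordz; have [lt_kp|le_pk] := ltnP k.-1 p; last by rewrite !crd_ge ?mul0r.
rewrite !(crd_lt _ _ lt_kp); move: (Ordinal _) => i.
have -> : (m *~ c) ord0 i = m ord0 i *~ c.
  by case: c => c; rewrite ?NegzE ?mulrNz ?mxE -?pmulrn !mulmxnE.
by rewrite mulrzz.
Qed.

Lemma coordz_gt (m : 'rV[int]_p) k : (p < k)%N -> coordz m k = 0.
Proof. by case: k => // k lt_pk; rewrite /coordz crd_ge. Qed.

Lemma coordz_bshift (m : 'rV[int]_p) k : (0 < k <= p)%N ->
  coordz (bshift m) k = coordz m (p.+1 - k) - coordz m (p.+2 - k).
Proof.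
move=> /andP[k0 kp].
have ekE l : coordz (ek p l) k = (k == l)%:R.
  case: k k0 kp => // k _ lt_kp.
  by rewrite /coordz /= (crd_lt _ _ lt_kp) mxE.
have sumE l : (0 < l)%N -> \sum_(i < p) (i.+1 == l)%:R * coordz m i.+1 = coordz m l.
  move=> l0; have [le_lp|lt_pl] := leqP l p.
    have lt_lp : (l.-1 < p)%N by rewrite prednK.
    rewrite (bigD1 (Ordinal lt_lp)) //= prednK // eqxx mul1r big1 ?addr0 // => i ne.
    rewrite (_ : (i.+1 == l) = false) ?mul0r //; apply: contraNF ne => /eqP e.
    by rewrite -val_eqE /= -e.
  rewrite coordz_gt // big1 // => i _; rewrite (_ : (i.+1 == l) = false) ?mul0r //.
  by apply/negbTE; have := ltn_ord i; lia.
rewrite /bshift coordz_sum /= -(sumE (p.+1 - k)%N) ?subn_gt0 //.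
rewrite -(sumE (p.+2 - k)%N) ?subn_gt0 ?ltnS ?leqW // -sumrB.
apply: eq_bigr => i _.
have -> : m 0 i = coordz m i.+1.
  by rewrite /coordz /= (crd_lt _ _ (ltn_ord i)); congr (m _ _); apply: val_inj.
rewrite coordzMz coordzD coordzN !ekE mulrBl; congr (_%:R * _ - _%:R * _); congr nat_of_bool.
  by apply/eqP/eqP; have := ltn_ord i; lia.
by apply/eqP/eqP; have := ltn_ord i; lia.
Qed.

Lemma coordz_nshift (n : 'rV[nat]_p) m k : coordz (nshift n m) k = (nc n k)%:Z + coordz m k.
Proof.
rewrite /nshift coordzD; congr (_ + _); rewrite /coordz /nc.
have [lt_kp|le_pk] := ltnP k.-1 p; last by rewrite !crd_ge.
by rewrite !(crd_lt _ _ lt_kp) mxE.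
Qed.

Lemma has_negP (v : 'rV[int]_p) :
  reflect (exists2 k, (0 < k <= p)%N & coordz v k < 0) (has_neg v).
Proof.
apply: (iffP existsP) => [[i vi]|[[//|k] lt_kp vk]].
  exists i.+1; first by rewrite /= ltn_ord.
  rewrite /coordz /= (crd_lt _ _ (ltn_ord i)).
  by move: vi; congr (v _ _ < 0); apply: val_inj.
by exists (Ordinal (lt_kp : (k < p)%N)); move: vk; rewrite /coordz /= crd_lt.
Qed.

Lemma nc_nadd (n : 'rV[nat]_p) m k : ~~ has_neg (nshift n m) -> (0 < k)%N ->
  (nc (nadd n m) k)%:Z = (nc n k)%:Z + coordz m k.
Proof.
move=> nn k0; rewrite -coordz_nshift.
have [le_kp|lt_pk] := leqP k p.
  have : 0 <= coordz (nshift n m) k.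
    by rewrite leNgt; apply: contra nn => vk; apply/has_negP; exists k => //; rewrite k0.
  case: k k0 le_kp => // k _ lt_kp; rewrite /nc /coordz /= !(crd_lt _ _ lt_kp).
  move=> v0; by rewrite [nadd _ _ _ _]mxE gez0_abs.
by rewrite coordz_gt // /nc crd_ge // -ltnS prednK.
Qed.

Lemma psum_nadd (n : 'rV[nat]_p) m k : ~~ has_neg (nshift n (bshift m)) ->
  (k <= p)%N -> (psum (nadd n (bshift m)) k)%:Z = (psum n k)%:Z + coordz m (p.+1 - k).
Proof.
move=> nn; elim: k => [|k IH] lt_kp.
  by rewrite !psum0 subn0 coordz_gt.
rewrite !psumS !PoszD IH ?(ltnW lt_kp) // nc_nadd // coordz_bshift // !subSS.
by ring.
Qed.

Lemma dual_factor_neg i (b0 b1 b2 S X M : R) : i < 0 -> dual_factor i b0 b1 b2 S X M = 0.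
Proof. by case: i. Qed.

Section Generic.
Variables (n : 'rV[nat]_p) (b : 'rV[R]_p.+2) (N : R) (x : 'rV[R]_p).

Let S0 : R := (nsum n)%:R.
Let w0 : R := (poch (- N) (nsum n) * poch (- N - bc b 0) (nsum n))^-1.

(** The factor 1 / ((-N)_m (-N - beta_0)_m) of R-hat at m = |n| + h.  It involves
    the first coordinate of the dual chain only.  The quotients are used rather
    than the Pochhammer symbols because m may be -1. *)
Definition outer_weight (h : int) : R :=
  if h == 1 then w0 / ((S0 - N) * (S0 - N - bc b 0))
  else if h == 0 then w0
  else w0 * ((S0 - 1 - N) * (S0 - 1 - N - bc b 0)).

Definition dual_val (m : 'rV[int]_p) : R :=
  if has_neg (nshift n m) then 0 else Rhat (nadd n m) x b N.

Lemma outer_weightE h S' : nonint N -> nonint (N + bc b 0) -> unit_step h ->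
  (S'%:Z = (nsum n)%:Z + h) ->
  outer_weight h = (poch (- N) S' * poch (- N - bc b 0) S')^-1.
Proof.
move=> hN hNb sh S'E.
have hN' : nonint (- N) by rewrite /nonint rpredN.
have hNb' : nonint (- N - bc b 0) by rewrite /nonint -opprD rpredN.
rewrite /outer_weight; case: sh S'E => -> /=.
- by rewrite addr0 => -[->].
- rewrite -PoszD addn1 => -[->]; rewrite !pochS /w0 -!invfM /S0.
  by congr (_^-1); ring.
move=> S'E; have {S'E} nE : nsum n = S'.+1 by move: S'E; lia.
rewrite /w0 /S0 nE !pochS -natr1 addrK.
have p1 := poch_nonint S' hN'; have p2 := poch_nonint S' hNb'.
have p3 : - N + S'%:R != 0 by apply: (nonint_nz hN') (erefl _); rewrite natr_int.
have p4 : - N - bc b 0 + S'%:R != 0.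
  by apply: (nonint_nz hNb') (erefl _); rewrite natr_int.
by field; do !(apply/andP; split=> //).
Qed.

Lemma dual_valE m : nonint N -> nonint (N + bc b 0) -> unit_step (coordz m 1) ->
  dual_val (bshift m) = outer_weight (coordz m 1) * \prod_(1 <= k < p.+1)
    dual_factor ((nc n k)%:Z + coordz (bshift m) k) (bc b 0) (bc b k) (bc b k.+1)
      ((psum n k.-1)%:R + (coordz m (p.+2 - k))%:~R) (xc x N k) (xc x N k.+1).
Proof.
move=> hN hNb sm; rewrite /dual_val; case: ifPn => [/has_negP[k kp vk]|nn].
  symmetry; apply/eqP; rewrite mulf_eq0 prodf_seq_eq0; apply/orP; right.
  apply/hasP; exists k; first by rewrite mem_index_iota ltnS.
  by apply/eqP; apply: dual_factor_neg; rewrite -coordz_nshift.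
have SE : (nsum (nadd n (bshift m)))%:Z = (nsum n)%:Z + coordz m 1.
  by rewrite /nsum psum_nadd // subSnn.
rewrite (outer_weightE hN hNb sm SE) /Rhat RpolE /Rden.
rewrite [LHS](_ : _ = (poch (- N) (nsum (nadd n (bshift m))) *
     poch (- N - bc b 0) (nsum (nadd n (bshift m))))^-1 *
   ((\prod_(1 <= k < p.+1) racah_factor (nc (nadd n (bshift m)) k) (bc b 0) (bc b k)
      (bc b k.+1) (psum (nadd n (bshift m)) k.-1)%:R (xc x N k) (xc x N k.+1)) /
    (\prod_(1 <= k < p.+1) poch (bc b k.+1 - bc b k) (nc (nadd n (bshift m)) k))));
  last by rewrite !invfM; ring.
congr (_ * _); rewrite -prodf_div; apply: eq_big_nat => k /andP[k0 kp].
have km : (k.-1 <= p)%N by lia.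
have SkE : (psum (nadd n (bshift m)) k.-1)%:R =
    (psum n k.-1)%:R + (coordz m (p.+2 - k))%:~R :> R.
  have := psum_nadd nn km; rewrite (_ : p.+1 - k.-1 = p.+2 - k)%N; last by lia.
  by move=> /(congr1 (fun i : int => i%:~R : R)); rewrite intrD.
by rewrite -nc_nadd // /dual_factor SkE.
Qed.

Definition generic_params : Prop :=
  nonint (N + bc b 0) /\ forall k, (0 < k <= p)%N ->
  [/\ nonint (bc b k.+1 - bc b 0), nonint (bc b k - bc b 0),
      nonint (bc b k.+1 - bc b k), nonint (bc b k.+1 + xc x N k.+1)
    & nonint (xc x N k.+1)].

(** Position i of the dual chain carries the factor with index p + 1 - i. *)
Definition dual_rho (i : nat) (h e : int) : R :=
  (if i == 1%N then outer_weight h else 1) *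
  dual_factor ((nc n (p.+1 - i))%:Z + h - e) (bc b 0) (bc b (p.+1 - i)) (bc b (p.+2 - i))
    ((psum n (p - i))%:R + e%:~R) (xc x N (p.+1 - i)) (xc x N (p.+2 - i)).

Lemma dual_val_rho j m : (0 < j <= p)%N -> nonint N -> nonint (N + bc b 0) ->
  unit_box j m ->
  dual_val (bshift m) = (\prod_(j.+1 <= i < p.+1) dual_rho i 0 0) *
     \prod_(1 <= i < j.+1) dual_rho i (coordz m i) (coordz m i.+1).
Proof.
move=> jp hN hNb sm; have [j0 lejp] := andP jp.
have -> : \prod_(j.+1 <= i < p.+1) dual_rho i 0 0 =
    \prod_(j.+1 <= i < p.+1) dual_rho i (coordz m i) (coordz m i.+1).
  apply: eq_big_nat => i /andP[ji ip].
  have := sm i.+1 isT; rewrite ltnNge (ltnW ji) /= => ->.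
  by have := sm i (leq_trans (ltn0Sn j) ji); rewrite [(i <= j)%N]leqNgt ji /= => ->.
rewrite mulrC -(big_cat_nat) //=.
have s1 : unit_step (coordz m 1) by have := sm 1%N isT; rewrite j0.
rewrite dual_valE // /dual_rho big_split /=; congr (_ * _).
  rewrite big_ltn ?ltnS ?(leq_trans j0) //= big_nat_cond big1 ?mulr1 // => i.
  by rewrite andbT => /andP[i1 _]; rewrite gtn_eqF.
rewrite big_nat_rev /=; apply: eq_big_nat => i /andP[i0 ip].
rewrite add1n subSS coordz_bshift; last by lia.
have -> : (p.+1 - (p.+1 - i) = i)%N by lia.
have -> : (p.+2 - (p.+1 - i) = i.+1)%N by lia.
have -> : ((p.+1 - i).-1 = p - i)%N by lia.
have -> : ((p.+1 - i).+1 = p.+2 - i)%N by lia.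
by rewrite addrA.
Qed.

Lemma second_equation_generic j : (0 < j <= p)%N -> generic_params ->
  pairing (Ln R p j) dual_val (Pt (nreal R n) b N) = kappa j x b N * Rhat n x b N.
Proof.
move=> jp [hNb gen]; have [j0 lejp] := andP jp.
have p0 : (0 < p <= p)%N by rewrite leqnn (leq_trans j0).
have hN : nonint N by have [_ _ _ _] := gen p p0; rewrite xc_gt.
rewrite pairing_Ln //.
pose Z := dual_x n b N; pose B := dual_b b N.
pose lam k (e : int) := if k == 0%N then chain_eig (bc b 0) 0 (B 1%N) (Z 1%N) e else
  dual_eig (bc b 0) (psum n (p - k))%:R (B k.+1) (Z k.+1) (xc x N (p.+1 - k)) N e.
have B0 : B 0%N = bc b 0 by [].
have natint (i : nat) : (i%:R : R) \is a Num.int by rewrite natr_int.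
have n2int (i : nat) : (2 * i%:R : R) \is a Num.int by rewrite -natrM natr_int.
have step : forall k e, (0 < k <= j)%N -> unit_step e ->
    stay_coef Z B k e * lam k.-1 0 * dual_rho k 0 e
    + ending Z B k.+1 e (Some (Z k)) / pole B k (Z k) * lam k.-1 1 * dual_rho k 1 e
    + ending Z B k.+1 e (Some (mirror Z B k)) / pole B k (mirror Z B k) * lam k.-1 (- 1) * dual_rho k (- 1) e
    = lam k e * dual_rho k 0 0.
  move=> k e /andP[k0 kj] se; have kp := leq_trans kj lejp.
  pose m := (p.+1 - k)%N.
  have mE : (p.+2 - k = m.+1)%N by rewrite /m; lia.
  have m0 : (0 < m <= p)%N by rewrite /m; lia.
  have tE : (psum n (p - k))%:R + (nc n m)%:R = (psum n m)%:R :> R.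
    by rewrite -natrD; congr _%:R; rewrite /m subSn // psumS.
  have [g1 g2 g3 g4 g5] := gen m m0.
  have st := @dual_step R Z B k (nc n m) e (bc b 0) (bc b m) (bc b m.+1)
    (xc x N m) (xc x N m.+1) N (psum n (p - k))%:R se.
  rewrite tE in st.
  have {}st := st B0 _ _ _ _ (nonintD g2 (n2int _)) (nonintD g4 (natint _)) _
    (nonintD g1 (n2int _)) g3.
  have eZ : Z k = (psum n m)%:R + bc b m.+1 - bc b 0 + N - 1.
    by rewrite /Z /dual_x -/m mE.
  have eB : B k = bc b 0 - bc b m.+1 - 2 * N + 1.
    by rewrite /B /dual_b mE; case: (k) k0.
  have eZ1 : Z k.+1 = (psum n (p - k))%:R + bc b m - bc b 0 + N - 1.
    by rewrite /Z /dual_x !subSS -/m.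
  have eB1 : B k.+1 = bc b 0 - bc b m - 2 * N + 1 by rewrite /B /dual_b subSS -/m.
  have hw : nonint ((psum n (p - k))%:R - xc x N m.+1).
    by rewrite addrC; apply: nonintD (natint _); rewrite /nonint rpredN.
  have {}st := st eZ eB eZ1 eB1 hw.
  rewrite /dual_rho -/m mE.
  have lamk : lam k e = dual_eig (bc b 0) (psum n (p - k))%:R (B k.+1) (Z k.+1) (xc x N m) N e.
    by rewrite /lam -/m; case: (k) k0.
  rewrite lamk !addr0.
  have [k1|k1] := eqVneq k 1%N.
    (* The outer weight turns the empty chain into dual_eig with x = N. *)
    have mp : m = p by rewrite /m k1 subSS subn0.
    have xN : xc x N m.+1 = N by rewrite mp xc_gt.
    have ZB : Z k + B k = S0 - N.
      by rewrite eZ eB /S0 /nsum mp; ring.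
    have SN c : nonint c -> S0 - c != 0.
      move=> hc; rewrite -opprB oppr_eq0; apply: (nonint_nz hc) (erefl _).
      by rewrite rpredN natint.
    have o1 := SN _ hN; have o2 := SN _ hNb; rewrite opprD addrA in o2.
    have l0 : lam 0%N 0 * outer_weight 0 = w0 * dual_eig (bc b 0) (psum n m)%:R (B k) (Z k) N N 0.
      by rewrite /lam /= /dual_eig /= subrr k1 mulrC.
    have l1 : lam 0%N 1 * outer_weight 1 = w0 * dual_eig (bc b 0) (psum n m)%:R (B k) (Z k) N N 1.
      rewrite /lam /= /dual_eig /= /outer_weight /= /chain_eig /= addr0 -k1 ZB.
      by field; rewrite o1 o2.
    have l2 : lam 0%N (- 1) * outer_weight (- 1) =
        w0 * dual_eig (bc b 0) (psum n m)%:R (B k) (Z k) N N (- 1).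
      rewrite /lam /= /dual_eig /= /outer_weight /= subrr mp -/(nsum n) -/S0 k1.
      by ring.
    rewrite xN in st *; rewrite k1 /= -k1.
    transitivity (w0 * (dual_eig (bc b 0) (psum n (p - k))%:R (B k.+1) (Z k.+1) (xc x N m) N e
      * dual_factor (nc n m) (bc b 0) (bc b m) (bc b m.+1) (psum n (p - k))%:R (xc x N m) N)).
      have aux X l o r d : l * o = w0 * d -> X * l * (o * r) = w0 * (X * d * r).
        by move=> lo; rewrite mulrA -(mulrA X) lo; ring.
      by rewrite (aux _ _ _ _ _ l0) (aux _ _ _ _ _ l1) (aux _ _ _ _ _ l2) -st; ring.
    by rewrite /outer_weight /=; ring.
  rewrite !mul1r.
  have lamP h : lam k.-1 h =
      dual_eig (bc b 0) (psum n m)%:R (B k) (Z k) (xc x N m.+1) N h.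
    have k1F : (k.-1 == 0%N) = false by apply/negbTE; lia.
    have k2E : (p - k.-1 = m)%N by rewrite /m; lia.
    have k3E : (p.+1 - k.-1 = m.+1)%N by rewrite /m; lia.
    by rewrite /lam k1F k2E k3E (prednK k0).
  by rewrite !lamP; exact: st.
rewrite (@chain_sum_spectral _ _ Z B j dual_rho lam _ (\prod_(j.+1 <= i < p.+1) dual_rho i 0 0)) //.
- have -> : dual_val (bshift 0) = Rhat n x b N.
    have -> : bshift (0 : 'rV[int]_p) = 0.
      by rewrite /bshift big1 // => i _; rewrite mxE mulr0z.
    have e0 : nshift n 0 = map_mx Posz n by rewrite /nshift addr0.
    rewrite /dual_val /nadd e0.
    have -> : has_neg (map_mx Posz n) = false.
      by apply/negbTE/existsP => -[i]; rewrite mxE.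
    by congr Rhat; apply/rowP => i; rewrite !mxE.
  congr (_ * _); rewrite /lam gtn_eqF // /dual_eig /chain_eig /= /kappa.
  have eB : B j.+1 = bc b 0 - bc b (p.+1 - j) - 2 * N + 1 by rewrite /B /dual_b subSS.
  by rewrite B0 eB; ring.
- move=> k kj; have [k0 le_kj] := andP kj; have kp := leq_trans le_kj lejp.
  have m0 : (0 < p.+1 - k <= p)%N by lia.
  have [g1 _ _ _ _] := gen _ m0; rewrite (_ : (p.+1 - k).+1 = p.+2 - k)%N in g1; last by lia.
  have eZ : 2 * Z k + B k = (bc b (p.+2 - k) - bc b 0) + (2 * (psum n (p.+1 - k))%:R - 1).
    by rewrite /Z /dual_x /B /dual_b; case: (k) k0 => // k' _; rewrite /=; ring.
  have ci c : c \is a Num.int -> 2 * Z k + B k + c != 0.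
    move=> hc; rewrite eZ -addrA; apply: (nonint_nz g1) (erefl _).
    by rewrite rpredD // rpredB // rpred1.
  by split; [exact: ci (rpredN1 _)|have := ci 0 (rpred0 _); rewrite addr0|exact: ci (rpred1 _)].
- move=> e se; rewrite /lam /= /chain_eig /ending /ending0 /link /mirror.
  by case: se => -> /=; rewrite ?B0; ring.
by move=> m sm; apply: dual_val_rho.
Qed.

End Generic.

End DualChain.
(** * Extracting the factor contributed by the first position *)

Section NoneWeight.
Variables (R : realType) (p : nat) (z b : nat -> R).
Implicit Types (phi : 'rV[int]_p -> R) (Q : option R -> R).

(** A variant of [chain_sum] in which the factor h contributed by the first
    position of a chain is free, so that it can be taken out. *)
Definition linkH (h : nat -> R -> R) k (w : R) (y : option R) : R :=
  if y is Some y then (w + y + b k) * (w + y + b k + 1) else h k w.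

Fixpoint chain_sumH (h : nat -> R -> R) k Q phi : R :=
  if k is k'.+1 then
    chain_sumH h k' Q phi
    + Q (Some (z k)) / pole b k (z k) * chain_sumH h k' (linkH h k (z k)) (Diff (ek p k) phi)
    + Q (Some (mirror z b k)) / pole b k (mirror z b k)
      * chain_sumH h k' (linkH h k (mirror z b k)) (Diff (- ek p k) phi)
  else Q None * phi 0.

Lemma chain_sum_chain_sumH k Q phi :
  chain_sum z b k Q phi = chain_sumH (fun k w => (w + b k - b 0%N) * (w + b k)) k Q phi.
Proof. by elim: k Q phi => //= k IH Q phi; rewrite !IH. Qed.

Lemma chain_sumHS h k Q phi : chain_sumH h k.+1 Q phi =
  chain_sumH h k Q phi
  + Q (Some (z k.+1)) / pole b k.+1 (z k.+1)
    * chain_sumH h k (linkH h k.+1 (z k.+1)) (Diff (ek p k.+1) phi)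
  + Q (Some (mirror z b k.+1)) / pole b k.+1 (mirror z b k.+1)
    * chain_sumH h k (linkH h k.+1 (mirror z b k.+1)) (Diff (- ek p k.+1) phi).
Proof. by []. Qed.

Lemma chain_sumH_None h k Q Q' phi : phi 0 = 0 -> (forall y, Q (Some y) = Q' (Some y)) ->
  chain_sumH h k Q phi = chain_sumH h k Q' phi.
Proof.
move=> phi0 e; elim: k => [|k IH] /=; first by rewrite phi0 !mulr0.
by rewrite IH !e.
Qed.

(** If phi is supported on shifts that raise the first coordinate, every chain
    that contributes starts at position 1 with a positive sign. *)
Lemma chain_sumH_first h k Q phi : (k < p)%N -> (forall m, coordz m 1 != 1 -> phi m = 0) ->
  chain_sumH h k.+1 Q phi = h 1%N (z 1%N) * chain_sumH (fun _ _ => 1) k.+1 Q phi.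
Proof.
elim: k Q phi => [|k IH] Q phi lt_kp supp.
  have phi0 : phi 0 = 0 by rewrite supp // coordz0.
  have phiN : phi (- ek p 1) = 0.
    by rewrite supp // coordzN coordz_ek.
  by rewrite /= /Diff !add0r phi0 phiN subrr; ring.
have phi0 : phi 0 = 0 by rewrite supp // coordz0.
have suppT (c : 'rV[int]_p) m : coordz c 1 = 0 -> coordz m 1 != 1 -> Diff c phi m = 0.
  by move=> c0 m1; rewrite /Diff !supp ?subrr // coordzD c0 addr0.
have e1 : coordz (ek p k.+2) 1 = 0 by rewrite coordz_ek.
have e2 : coordz (- ek p k.+2) 1 = 0 by rewrite coordzN e1 oppr0.
have step w c : coordz c 1 = 0 -> chain_sumH h k.+1 (linkH h k.+2 w) (Diff c phi) =
    h 1%N (z 1%N) * chain_sumH (fun _ _ => 1) k.+1 (linkH (fun _ _ => 1) k.+2 w) (Diff c phi).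
  move=> c0; rewrite IH ?(ltnW lt_kp) //; last by move=> m; exact: suppT.
  congr (_ * _); apply: chain_sumH_None => //.
  by apply: suppT; rewrite ?c0 // coordz0.
rewrite !(chain_sumHS _ k.+1) IH ?(ltnW lt_kp) // !step //.
by ring.
Qed.

End NoneWeight.

(** * Limits along a filter *)

Section Limits.
Variables (R : realType) (T : Type) (F : set_system T).
Context {FF : ProperFilter F}.
Implicit Types (f g : T -> R).

Definition tends f (l : R) : Prop := f x @[x --> F] --> l.

Lemma tends_cst c : tends (fun=> c) c.
Proof. exact: cvg_cst. Qed.

Lemma tendsD f g a c : tends f a -> tends g c -> tends (fun t => f t + g t) (a + c).
Proof. by move=> fa gc; apply: cvgD. Qed.

Lemma tendsN f a : tends f a -> tends (fun t => - f t) (- a).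
Proof. by move=> fa; apply: cvgN. Qed.

Lemma tendsB f g a c : tends f a -> tends g c -> tends (fun t => f t - g t) (a - c).
Proof. by move=> fa gc; apply: tendsD => //; apply: tendsN. Qed.

Lemma tendsM f g a c : tends f a -> tends g c -> tends (fun t => f t * g t) (a * c).
Proof. by move=> fa gc; apply: cvgM. Qed.

Lemma tendsV f a : a != 0 -> tends f a -> tends (fun t => (f t)^-1) a^-1.
Proof. by move=> a0 fa; apply: cvgV. Qed.

Lemma tends_unique f a c : tends f a -> tends f c -> a = c.
Proof. by move=> fa fc; apply: (cvg_unique (@norm_hausdorff _ _) fa fc). Qed.

Lemma tends_near f g a : (\forall t \near F, f t = g t) -> tends f a -> tends g a.
Proof. by move=> e fa; apply: cvg_trans fa; apply: near_eq_cvg. Qed.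

Lemma tends_sum (I : Type) (r : seq I) (P : pred I) (f : I -> T -> R) (l : I -> R) :
  (forall i, P i -> tends (f i) (l i)) ->
  tends (fun t => \sum_(i <- r | P i) f i t) (\sum_(i <- r | P i) l i).
Proof. by move=> fl; apply: (cvg_big add_continuous). Qed.

Lemma tends_prod (I : Type) (r : seq I) (P : pred I) (f : I -> T -> R) (l : I -> R) :
  (forall i, P i -> tends (f i) (l i)) ->
  tends (fun t => \prod_(i <- r | P i) f i t) (\prod_(i <- r | P i) l i).
Proof. by move=> fl; apply: (cvg_big mul_continuous). Qed.

Lemma tends_poch f a k : tends f a -> tends (fun t => poch (f t) k) (poch a k).
Proof.
move=> fa; apply: tends_prod => i _; apply: tendsD => //; exact: tends_cst.
Qed.

Ltac tends_arith :=
  lazymatch goal with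
  | |- tends _ ?l =>
    first [assumption |
      lazymatch l with
      | (_ * _)%R => apply: tendsM; tends_arith
      | (_ - _)%R => apply: tendsB; tends_arith
      | (- _)%R => apply: tendsN; tends_arith
      | (_ + _)%R => apply: tendsD; tends_arith
      | poch _ _ => apply: tends_poch; tends_arith
      | _ => exact: tends_cst
      end]
  end.

Lemma tends_F4 n fu fv fw fa fb u v w a b :
  tends fu u -> tends fv v -> tends fw w -> tends fa a -> tends fb b ->
  tends (fun t => F4 n (fu t) (fv t) (fw t) (fa t) (fb t)) (F4 n u v w a b).
Proof.
move=> hu hv hw ha hb; apply: tends_sum => i _; rewrite /F4head /F4tail.
by tends_arith.
Qed.

Lemma tends_racah_factor n fb0 fb1 fb2 (S : R) fX fM b0 b1 b2 X M :
  tends fb0 b0 -> tends fb1 b1 -> tends fb2 b2 -> tends fX X -> tends fM M ->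
  tends (fun t => racah_factor n (fb0 t) (fb1 t) (fb2 t) S (fX t) (fM t))
    (racah_factor n b0 b1 b2 S X M).
Proof.
move=> h0 h1 h2 hX hM; apply: tends_F4;
by tends_arith.
Qed.

Section LimitU.
Variables (p q : nat) (zt bt : T -> nat -> R) (z b : nat -> R).
Variables (ht : T -> nat -> R -> R) (h : nat -> R -> R).
Hypothesis zl : forall k, (0 < k <= q)%N -> tends (zt^~ k) (z k).
Hypothesis bl : forall k, (0 < k <= q)%N -> tends (bt^~ k) (b k).
Hypothesis hl : forall k wt w, (0 < k <= q)%N -> tends wt w ->
  tends (fun t => ht t k (wt t)) (h k w).
Hypothesis reg : forall k, (0 < k <= q)%N -> regular_at z b k.

Lemma tends_chain_sumH k (Qt : T -> option R -> R) Q (phi : 'rV[int]_p -> R) : (k <= q)%N ->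
  tends (Qt^~ None) (Q None) ->
  (forall yt y, tends yt y -> tends (fun t => Qt t (Some (yt t))) (Q (Some y))) ->
  tends (fun t => chain_sumH (zt t) (bt t) (ht t) k (Qt t) phi) (chain_sumH z b h k Q phi).
Proof.
elim: k Qt Q phi => [|k IH] Qt Q phi kq QN QS /=.
  by apply: tendsM => //; exact: tends_cst.
have kk : (0 < k.+1 <= q)%N by [].
have zk := zl kk; have bk := bl kk; have [r1 r2 r3] := reg kk.
have mk : tends (fun t => mirror (zt t) (bt t) k.+1) (mirror z b k.+1).
  by apply: tendsB => //; apply: tendsN.
have dl wt w : tends wt w -> tends (fun t => pole (bt t) k.+1 (wt t)) (pole b k.+1 w).
  move=> wl; rewrite /pole;
  by tends_arith.
have d1 : pole b k.+1 (z k.+1) != 0 by rewrite mulf_neq0.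
have d2 : pole b k.+1 (mirror z b k.+1) != 0.
  rewrite (_ : pole _ _ _ = (2 * z k.+1 + b k.+1) * (2 * z k.+1 + b k.+1 - 1)).
    by rewrite mulf_neq0.
  by rewrite /pole /mirror; ring.
have Hl wt w (phi' : 'rV[int]_p -> R) : tends wt w ->
    tends (fun t => chain_sumH (zt t) (bt t) (ht t) k (linkH (bt t) (ht t) k.+1 (wt t)) phi')
      (chain_sumH z b h k (linkH b h k.+1 w) phi').
  move=> wl; apply: (IH (fun t => linkH (bt t) (ht t) k.+1 (wt t)) (linkH b h k.+1 w));
    [exact: ltnW| |move=> yt y yl].
  - exact: hl.
  rewrite /linkH;
  by tends_arith.
apply: tendsD; first apply: tendsD.
- by apply: (IH Qt Q phi) => //; exact: ltnW.
- by apply: tendsM; [apply: tendsM; [exact: QS|apply: tendsV => //; exact: dl]|exact: Hl].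
- by apply: tendsM; [apply: tendsM; [exact: QS|apply: tendsV => //; exact: dl]|exact: Hl].
Qed.

End LimitU.

End Limits.

Section GenericPaths.
Variable R : realType.

Lemma lt1_nonint (y : R) : 0 < `|y| < 1 -> nonint y.
Proof.
move=> /andP[y0 y1]; apply/negP => yi; have := norm_intr_ge1 yi.
by rewrite -normr_gt0 y0 => /(_ isT); rewrite leNgt y1.
Qed.

(** A nonconstant affine function takes integral values at isolated points
    only. *)
Lemma near_nonint (c s : R) : s != 0 -> \forall t \near 0^', nonint (c + t * s).
Proof.
move=> s0; have := floor_itv c; set f := Num.floor c => /andP[fc cf].
pose r := c - f%:~R.
have r0 : 0 <= r by rewrite subr_ge0.
have r1 : r < 1 by rewrite ltrBlDl -(intrD _ f 1) //.
have cE : c = r + f%:~R by rewrite /r subrK.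
have fi : f%:~R \is a (@Num.int R) by rewrite intr_int.
have [rz|rnz] := eqVneq r 0.
  have e0 : 0 < `|s|^-1 by rewrite invr_gt0 normr_gt0.
  near=> t.
  rewrite cE rz add0r addrC; apply: nonintD fi; apply: lt1_nonint.
  rewrite normrM mulr_gt0 ?normr_gt0 //=; last by near: t; exact: nbhs_dnbhs_neq.
  rewrite -ltr_pdivlMr ?normr_gt0 // div1r; near: t; exact: dnbhs0_lt.
have rp : 0 < r by rewrite lt_neqAle eq_sym rnz.
have e0 : 0 < Num.min r (1 - r) / `|s|.
  by rewrite divr_gt0 ?normr_gt0 // lt_min rp subr_gt0.
near=> t.
have : `|t * s| < Num.min r (1 - r).
  by rewrite normrM -ltr_pdivlMr ?normr_gt0 //; near: t; exact: dnbhs0_lt.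
rewrite lt_min => /andP[t1 t2].
rewrite cE addrAC; apply: nonintD fi; apply: lt1_nonint.
have : - `|t * s| <= t * s by rewrite lerNl -normrN ler_norm.
have := ler_norm (t * s) => u1 u2.
rewrite gtr0_norm; last by lra.
by apply/andP; split; lra.
Unshelve. all: by end_near.
Qed.

End GenericPaths.
(** * Convergence of the terms of the dual equation *)

Section SecondEquation.
Variables (R : realType) (p : nat) (n : 'rV[nat]_p) (j : nat).
Hypothesis jp : (0 < j <= p)%N.

Lemma chain_sum_phi0 (z b : nat -> R) k Q : chain_sum z b k Q (fun _ : 'rV[int]_p => 0) = 0.
Proof.
elim: k Q => [|k IH] Q /=; first by rewrite mulr0.
have T0 a : Diff a (fun _ : 'rV[int]_p => 0 : R) = fun=> 0.
  by apply: funext => m; rewrite /Diff subrr.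
by rewrite !T0 !IH !mulr0 !addr0.
Qed.

Lemma msupp_Ln m : m \in msupp (Ln R p j) -> exists2 l, unit_box j l & bshift l = m.
Proof.
move=> mL; apply: contrapT => none.
suff : mcoeff m (Ln R p j) = 0 by apply/eqP; rewrite mcoeff_neq0.
apply: funext => v; have [j0 lejp] := andP jp.
rewrite mcoeff_pairing /Ln pairing_bdual pairing_Lx //.
rewrite (@eq_chain_sum _ _ _ _ _ _ _ (fun=> 0)) ?chain_sum_phi0 // => l sl.
by case: eqP => // e; case: none; exists l.
Qed.

Let hitm m : 'rV[int]_p -> R := fun l => (bshift l == m)%:R.
Let Qj (b : 'rV[R]_p.+2) N (y : option R) : R :=
  if y is Some y then (y + dual_b b N j.+1 + dual_x n b N j.+1) * (dual_x n b N j.+1 - y) else 0.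

Lemma mcoeff_Ln m b N :
  mcoeff m (Ln R p j) (Pt (nreal R n) b N) =
  chain_sumH (dual_x n b N) (dual_b b N) (fun k w => (w + dual_b b N k - dual_b b N 0) * (w + dual_b b N k)) j
    (Qj b N) (hitm m).
Proof. by rewrite mcoeff_pairing pairing_Ln // chain_sum_chain_sumH. Qed.

(** The coefficient of a raising shift without the factor contributed by the
    first position. *)
Definition redcoef m b N : R :=
  chain_sumH (dual_x n b N) (dual_b b N) (fun _ _ => 1) j (Qj b N) (hitm m).

Definition raised m : Prop :=
  ~~ has_neg (nshift n m) /\ nsum (nadd n m) = (nsum n).+1.

(** A shift raises |n| if and only if it raises the first coordinate of the dual
    chain, so [chain_sumH_first] applies. *)
Lemma mcoeff_raised m b N : raised m ->
  mcoeff m (Ln R p j) (Pt (nreal R n) b N) =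
  ((nsum n)%:R - N - bc b 0) * ((nsum n)%:R - N) * redcoef m b N.
Proof.
move=> [nn Sm]; rewrite mcoeff_Ln /redcoef; have [j0 lejp] := andP jp.
rewrite -(prednK j0) chain_sumH_first ?prednK //.
  congr (_ * _); rewrite /dual_x /dual_b /= /nsum subSS subn0 (_ : p.+2 - 1 = p.+1)%N ?subn1 //.
  by congr (_ * _); ring.
move=> l l1; rewrite /hitm; case: eqP => // lm; case/eqP: l1.
have := @psum_nadd p n l p; rewrite lm => /(_ nn (leqnn p)).
by rewrite -/(nsum _) Sm subSnn => e; move: e; rewrite /nsum -addn1 PoszD => /addrI.
Qed.

(** The term after cancelling |n| - N against the last factor of
    (-N)_{|n|+1}. *)
Definition raised_term m (x : 'rV[R]_p) b N : R :=
  ((nsum n)%:R - N - bc b 0) * redcoef m b N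
  * (Rpol (nadd n m) x b N / (poch (- N) (nsum n) * Rden (nadd n m) b N)).

Lemma raw_raised m x b N : raised m -> N != (nsum n)%:R ->
  raw_term j n x b m N = raised_term m x b N.
Proof.
move=> rm neN; rewrite /raw_term mcoeff_raised // /raised_term /Rhat.
have [_ ->] := rm; rewrite pochS.
have s0 : - N + (nsum n)%:R != 0 by rewrite addrC subr_eq0 eq_sym.
rewrite (_ : poch _ _ * _ * Rden _ _ _ =
  (- N + (nsum n)%:R) * (poch (- N) (nsum n) * Rden (nadd n m) b N)); last by ring.
rewrite invfM; move: (_ * Rden _ _ _)^-1 (Rpol _ _ _ _) => c d.
by field.
Qed.

Definition limit_term m x b N : R :=
  if boundary n m N then raised_term m x b N else raw_term j n x b m N.

Section AlongFilter.
Variables (T : Type) (F : set_system T).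
Context {FF : ProperFilter F}.
Variables (bb : T -> 'rV[R]_p.+2) (xx : T -> 'rV[R]_p) (NN : T -> R).
Variables (b : 'rV[R]_p.+2) (x : 'rV[R]_p) (N : R).
Hypothesis bl : forall k, tends F (fun t => bc (bb t) k) (bc b k).
Hypothesis xl : forall k, tends F (fun t => xc (xx t) (NN t) k) (xc x N k).
Hypothesis Nl : tends F NN N.

Lemma tends_dual_x k : tends F (fun t => dual_x n (bb t) (NN t) k) (dual_x n b N k).
Proof.
have := bl; rewrite /dual_x => bl'; apply: tendsB; last exact: tends_cst.
apply: tendsD => //; apply: tendsB => //; apply: tendsD => //; exact: tends_cst.
Qed.

Lemma tends_dual_b k : tends F (fun t => dual_b (bb t) (NN t) k) (dual_b b N k).
Proof.
rewrite /dual_b; case: eqP => // _; apply: tendsD; last exact: tends_cst.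
by apply: tendsB; [exact: tendsB | apply: tendsM => //; exact: tends_cst].
Qed.

Lemma tends_chain_sumH_Ln m (ht : T -> nat -> R -> R) h :
  (forall k, (0 < k <= j)%N -> regular_at (dual_x n b N) (dual_b b N) k) ->
  (forall k wt w, (0 < k <= j)%N -> tends F wt w ->
     tends F (fun t => ht t k (wt t)) (h k w)) ->
  tends F (fun t => chain_sumH (dual_x n (bb t) (NN t)) (dual_b (bb t) (NN t)) (ht t) j
                (Qj (bb t) (NN t)) (hitm m))
          (chain_sumH (dual_x n b N) (dual_b b N) h j (Qj b N) (hitm m)).
Proof.
move=> reg hl.
apply: (@tends_chain_sumH R T F _ p j (fun t => dual_x n (bb t) (NN t)) (fun t => dual_b (bb t) (NN t))
  (dual_x n b N) (dual_b b N) ht h _ _ hl reg j (fun t => Qj (bb t) (NN t))) => //.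
- by move=> k _; exact: tends_dual_x.
- by move=> k _; exact: tends_dual_b.
- exact: tends_cst.
move=> yt y yl; have z1 := @tends_dual_x j.+1; have b1 := @tends_dual_b j.+1.
by apply: tendsM; [apply: tendsD => //; exact: tendsD | exact: tendsB].
Qed.

Lemma tends_mcoeff m :
  (forall k, (0 < k <= j)%N -> regular_at (dual_x n b N) (dual_b b N) k) ->
  tends F (fun t => mcoeff m (Ln R p j) (Pt (nreal R n) (bb t) (NN t)))
          (mcoeff m (Ln R p j) (Pt (nreal R n) b N)).
Proof.
move=> reg; rewrite mcoeff_Ln.
apply: (tends_near (f := fun t => chain_sumH (dual_x n (bb t) (NN t)) (dual_b (bb t) (NN t))
  (fun k w => (w + dual_b (bb t) (NN t) k - dual_b (bb t) (NN t) 0)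
     * (w + dual_b (bb t) (NN t) k)) j (Qj (bb t) (NN t)) (hitm m))).
  by apply: nearW => t; rewrite mcoeff_Ln.
apply: tends_chain_sumH_Ln reg _ => k wt w _ wl.
have bk := @tends_dual_b k; have b0 := @tends_dual_b 0%N.
by apply: tendsM; [apply: tendsB => //; exact: tendsD | exact: tendsD].
Qed.

Lemma tends_Rpol n' : tends F (fun t => Rpol n' (xx t) (bb t) (NN t)) (Rpol n' x b N).
Proof.
apply: (tends_near (f := fun t => \prod_(1 <= k < p.+1)
    racah_factor (nc n' k) (bc (bb t) 0) (bc (bb t) k) (bc (bb t) k.+1) (psum n' k.-1)%:R
      (xc (xx t) (NN t) k) (xc (xx t) (NN t) k.+1))).
  by apply: nearW => t; rewrite RpolE.
by rewrite RpolE; apply: tends_prod => k _; apply: tends_racah_factor.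
Qed.

Lemma tends_pochN k : tends F (fun t => poch (- NN t) k) (poch (- N) k).
Proof. by apply: tends_poch; apply: tendsN. Qed.

Lemma tends_Rden n' : tends F (fun t => Rden n' (bb t) (NN t)) (Rden n' b N).
Proof.
apply: tendsM; first by apply: tends_poch; apply: tendsB => //; apply: tendsN.
by apply: tends_prod => k _; apply: tends_poch; apply: tendsB.
Qed.

Lemma tends_Rhat n' : poch (- N) (nsum n') != 0 -> Rden n' b N != 0 ->
  tends F (fun t => Rhat n' (xx t) (bb t) (NN t)) (Rhat n' x b N).
Proof.
move=> p0 r0; apply: tendsM; first exact: tends_Rpol.
apply: tendsV; first by rewrite mulf_neq0.
by apply: tendsM; [exact: tends_pochN | exact: tends_Rden].
Qed.

Lemma poch_natN_neq0 (M k : nat) : (k <= M)%N -> poch (- M%:R : R) k != 0.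
Proof.
move=> kM; apply/prodf_neq0 => i _.
by rewrite addrC subr_eq0 eqr_nat; have := ltn_ord i; lia.
Qed.

(** Convergence along an arbitrary filter serves twice: for the limit N' -> N
    that defines the boundary terms, and for the approach to (x, beta, N)
    through generic parameters. *)
Lemma tends_raw m : admissible n N ->
  (forall k, (0 < k <= j)%N -> regular_at (dual_x n b N) (dual_b b N) k) ->
  m \in msupp (Ln R p j) -> ~~ has_neg (nshift n m) ->
  Rden (nadd n m) b N != 0 -> (\forall t \near F, NN t != N) ->
  tends F (fun t => raw_term j n (xx t) (bb t) m (NN t)) (limit_term m x b N).
Proof.
move=> adm reg mL nn r0 neN; rewrite /limit_term; case: ifPn => [|nbd].
  move=> /andP[/eqP NE /eqP Sm]; have rm : raised m by split.
  apply: (tends_near (f := fun t => raised_term m (xx t) (bb t) (NN t))).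
    by apply: filterS neN => t; rewrite NE => ne; rewrite raw_raised.
  apply: tendsM; last first.
    apply: tendsM; first exact: tends_Rpol.
    apply: tendsV; first by rewrite mulf_neq0 // NE poch_natN_neq0.
    by apply: tendsM; [exact: tends_pochN | exact: tends_Rden].
  apply: tendsM; last by apply: tends_chain_sumH_Ln => // *; exact: tends_cst.
  by apply: tendsB => //; apply: tendsB => //; exact: tends_cst.
apply: tendsM; first exact: tends_mcoeff.
apply: tends_Rhat => //; apply/prodf_neq0 => -[i ilt] _ /=.
rewrite addrC subr_eq0; apply: contra nbd => /eqP iN.
(* A zero of the Pochhammer symbol would put the shift on the boundary. *)
have [l sl lm] := msupp_Ln mL.
have le1 : (nsum (nadd n m) <= (nsum n).+1)%N.
  have := @psum_nadd p n l p; rewrite lm => /(_ nn (leqnn p)).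
  rewrite -!/(nsum _) subSnn; have := sl 1%N isT; have [-> _] := andP jp.
  by case=> ->; lia.
have := adm i (esym iN) => le2.
have e1 : i = nsum n by lia.
by rewrite /boundary -iN e1 eqxx /= eqn_leq le1; lia.
Qed.

End AlongFilter.

End SecondEquation.
(** * The dual equation in general *)

Section Conclusion.
Variables (R : realType) (p : nat) (n : 'rV[nat]_p) (j : nat).
Variables (b : 'rV[R]_p.+2) (x : 'rV[R]_p) (N : R).
Hypothesis jp : (0 < j <= p)%N.

(** Together with [xtilt] and N + t, these slopes make all the quantities in
    [generic_params] nonconstant in t. *)
Definition btilt (t : R) : 'rV[R]_p.+2 := b + t *: \row_k (k : nat)%:R.
Definition xtilt (t : R) : 'rV[R]_p := x + const_mx t.

Lemma bc_btilt t k : (k <= p.+1)%N -> bc (btilt t) k = bc b k + t * k%:R.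
Proof. by rewrite -ltnS => lt_k; rewrite /bc !(crd_lt _ _ lt_k) !mxE. Qed.

Lemma xc_xtilt t k : xc (xtilt t) (N + t) k = xc x N k + t.
Proof.
rewrite /xc; have [lt_kp|le_pk] := ltnP k.-1 p; last by rewrite !crd_ge.
by rewrite !(crd_lt _ _ lt_kp) !mxE.
Qed.

Lemma tends_id (a : R) : tends a^' (fun t => t) a.
Proof. exact: nbhs_dnbhs. Qed.

Lemma near_generic : \forall t \near 0^', generic_params (btilt t) (N + t) (xtilt t).
Proof.
have lin (c d : R) (k : nat) (f : R -> R) : (0 < k)%N ->
    (forall t, f t = c + t * k%:R) -> \forall t \near 0^', nonint (f t).
  move=> k0 fE; apply: (filterS (P := fun t => nonint (c + t * k%:R))).
    by move=> t; rewrite fE.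
  by apply: near_nonint; rewrite pnatr_eq0 -lt0n.
have all_k : \forall t \near 0^', forall k : 'I_p,
    [/\ nonint (bc (btilt t) k.+2 - bc (btilt t) 0),
      nonint (bc (btilt t) k.+1 - bc (btilt t) 0),
      nonint (bc (btilt t) k.+2 - bc (btilt t) k.+1),
      nonint (bc (btilt t) k.+2 + xc (xtilt t) (N + t) k.+2)
    & nonint (xc (xtilt t) (N + t) k.+2)].
  apply: filter_forall => k; have k2 : (k.+2 <= p.+1)%N by rewrite ltnS ltn_ord.
  have k1 := ltnW k2.
  near=> t; split; near: t.
  - apply: (lin (bc b k.+2 - bc b 0) 0 k.+2) => // t; rewrite !bc_btilt //; ring.
  - apply: (lin (bc b k.+1 - bc b 0) 0 k.+1) => // t; rewrite !bc_btilt //; ring.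
  - apply: (lin (bc b k.+2 - bc b k.+1) 0 1%N) => // t.
    by rewrite !bc_btilt // -(natr1 k.+1); ring.
  - apply: (lin (bc b k.+2 + xc x N k.+2) 0 k.+3) => // t.
    by rewrite xc_xtilt !bc_btilt // -(natr1 k.+2); ring.
  - by apply: (lin (xc x N k.+2) 0 1%N) => // t; rewrite xc_xtilt mulr1.
near=> t; split.
  near: t; apply: (lin (N + bc b 0) 0 1%N) => // t.
  by rewrite bc_btilt //; ring.
have tk : forall k : 'I_p,
    [/\ nonint (bc (btilt t) k.+2 - bc (btilt t) 0),
      nonint (bc (btilt t) k.+1 - bc (btilt t) 0),
      nonint (bc (btilt t) k.+2 - bc (btilt t) k.+1),
      nonint (bc (btilt t) k.+2 + xc (xtilt t) (N + t) k.+2)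
    & nonint (xc (xtilt t) (N + t) k.+2)] by near: t.
by case=> // k lt_kp; exact: (tk (Ordinal (lt_kp : (k < p)%N))).
Unshelve. all: by end_near.
Qed.

Lemma tends_btilt k : tends 0^' (fun t => bc (btilt t) k) (bc b k).
Proof.
have [lt_k|le_k] := leqP k p.+1; last first.
  by rewrite /bc crd_ge //; apply: (tends_near _ (@tends_cst _ _ _ _ _)); apply: nearW => t; rewrite crd_ge.
apply: (tends_near (f := fun t => bc b k + t * k%:R)).
  by apply: nearW => t; rewrite bc_btilt.
rewrite -[X in tends _ _ X]addr0 -[X in _ + X](mul0r (k%:R : R)).
by apply: tendsD; [exact: tends_cst | apply: tendsM; [exact: tends_id | exact: tends_cst]].
Qed.

Lemma tends_addt (c : R) : tends 0^' (fun t => c + t) c.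
Proof.
rewrite -[X in tends _ _ X]addr0; apply: tendsD; first exact: tends_cst.
exact: tends_id.
Qed.

Lemma tends_xtilt k : tends 0^' (fun t => xc (xtilt t) (N + t) k) (xc x N k).
Proof.
by apply: (tends_near _ (@tends_addt _)); apply: nearW => t; rewrite xc_xtilt.
Qed.

(** The generic equation holds near (x, beta, N), the sum of the dual terms is
    the limit of its left-hand side, and limits are unique. *)
Lemma second_equation : admissible n N -> Rden n b N != 0 -> dual_regular j n b N ->
  (forall m, m \in msupp (Ln R p j) -> ~~ has_neg (nshift n m) ->
     boundary n m N -> cvg (raw_term j n x b m @ N^'))
  /\ dact_n j n x b N = kappa j x b N * Rhat n x b N.
Proof.
move=> adm r0 [Lreg rden]; have [j0 lejp] := andP jp.
have reg := (regular_bpoint n b N lejp).1 Lreg.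
have limN m : m \in msupp (Ln R p j) -> ~~ has_neg (nshift n m) ->
    tends N^' (fun t => raw_term j n x b m t) (limit_term n j m x b N).
  move=> mL nn; apply: (@tends_raw _ _ n j jp _ N^' _ (fun=> b) (fun=> x) id b x N _ _ _ m adm reg mL nn).
  - by move=> k; exact: tends_cst.
  - move=> k; rewrite /xc; have [lt_k|le_k] := ltnP k.-1 p.
      rewrite (crd_lt _ _ lt_k); apply: (tends_near _ (@tends_cst _ _ _ _ _)).
      by apply: nearW => t; rewrite (crd_lt _ _ lt_k).
    rewrite crd_ge //; apply: (tends_near _ (@tends_id _)).
    by apply: nearW => t; rewrite crd_ge.
  - exact: tends_id.
  - exact: rden.
  - exact: nbhs_dnbhs_neq.
split=> [m mL nn _|].
  by apply/cvg_ex; exists (limit_term n j m x b N); exact: limN.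
have limt m : m \in msupp (Ln R p j) -> ~~ has_neg (nshift n m) ->
    tends 0^' (fun t => raw_term j n (xtilt t) (btilt t) m (N + t)) (limit_term n j m x b N).
  move=> mL nn.
  apply: (@tends_raw _ _ n j jp _ _ _ btilt xtilt (fun t => N + t) b x N _ _ _ m adm reg mL nn).
  - exact: tends_btilt.
  - exact: tends_xtilt.
  - exact: tends_addt.
  - exact: rden.
  apply: (filterS _ (nbhs_dnbhs_neq (0 : R))) => t t0.
  by rewrite -subr_eq0 addrAC subrr add0r.
have dualE m : m \in msupp (Ln R p j) -> dual_term j n x b N m =
    if has_neg (nshift n m) then 0 else limit_term n j m x b N.
  move=> mL; rewrite /dual_term; case: ifPn => // nn.
  rewrite [RHS]/limit_term; case: ifPn => // hb.
  by rewrite (cvg_lim _ (limN m mL nn)) /limit_term ?hb //; exact: norm_hausdorff.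
pose g t m := if has_neg (nshift n m) then 0
  else raw_term j n (xtilt t) (btilt t) m (N + t).
have lhs : tends 0^' (fun t => \sum_(m <- msupp (Ln R p j)) g t m) (dact_n j n x b N).
  rewrite /dact_n big_seq; apply: (tends_near (f := fun t =>
    \sum_(m <- msupp (Ln R p j) | m \in msupp (Ln R p j)) g t m)).
    by apply: nearW => t; rewrite [RHS]big_seq.
  apply: tends_sum => m mL; rewrite dualE // /g; case: ifPn => nn; first exact: tends_cst.
  exact: limt.
have poch0 : poch (- N) (nsum n) != 0.
  apply/prodf_neq0 => -[i ilt] _ /=; rewrite addrC subr_eq0.
  by apply/eqP => iN; have := adm i (esym iN); rewrite leqNgt ilt.
have rhs : tends 0^' (fun t => \sum_(m <- msupp (Ln R p j)) g t m)
    (kappa j x b N * Rhat n x b N).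
  apply: (tends_near (f := fun t => kappa j (xtilt t) (btilt t) (N + t)
     * Rhat n (xtilt t) (btilt t) (N + t))).
    apply: filterS near_generic => t gen.
    rewrite -second_equation_generic //; apply: eq_bigr => m _.
    by rewrite /g /dual_val /raw_term; case: ifP => // _; rewrite mulr0.
  have xl := @tends_xtilt (p.+1 - j); have bl := @tends_btilt (p.+1 - j).
  have Nl := @tends_addt N.
  apply: tendsM; last by apply: tends_Rhat => //; [exact: tends_btilt|exact: tends_xtilt].
  rewrite /kappa; apply: tendsM; first by apply: tendsN; exact: tendsB.
  by apply: tendsD => //; exact: tendsD.
exact: tends_unique lhs rhs.
Qed.

End Conclusion.

Theorem theorem4p6 (R : realType) (p : nat) (hp : (1 <= p)%N)
    (b : 'rV[R]_p.+2) (N : R) (n : 'rV[nat]_p) (hn : admissible n N)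
    (hden : Rden n b N != 0) (j : nat) (hj : (1 <= j <= p)%N) (x : 'rV[R]_p) :
  (Lx_regular j (Pt x b N) ->
     dact (Lx R p j) (fun y => Rhat n y b N) b N x = mu j n b * Rhat n x b N)
  /\
  (dual_regular j n b N ->
     (forall m, m \in msupp (Ln R p j) -> ~~ has_neg (nshift n m) ->
        boundary n m N -> cvg (raw_term j n x b m @ N^'))
     /\ dact_n j n x b N = kappa j x b N * Rhat n x b N).
Proof.
split; first exact: first_equation.
exact: second_equation.
Qed.
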